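(* Let $\Bbbk$ be an algebraically closed field with $\operatorname{char}(\Bbbk)\neq2$, let $\lambda\in\Bbbk$ with $\lambda(\lambda^3-1)\neq 0$, and let $A$ be the quadratic $\Bbbk$-algebra on generators $x_1,x_2,x_3$ with defining relations $$\lambda x_1x_2=x_2x_1,\qquad \lambda x_2x_3=x_3x_2-x_1^2,\qquad \lambda x_3x_1=x_1x_3-x_2^2.$$ If $\lambda^3=-1$, then $A$ is a graded skew Clifford algebra; if $\lambda^3\notin\{0,1\}$, then $A$ is an Ore extension of a regular graded skew Clifford algebra.
   Context: Regular algebras. A graded $\Bbbk$-algebra $A=\bigoplus_{n\ge 0}A_n$ with $A_0=\Bbbk$, generated by the finite-dimensional space $A_1$, is regular (in the sense of Artin–Schelter) of global dimension $d$ if it has finite global dimension $d$, has polynomial growth, and is Gorenstein, i.e. $\operatorname{Ext}^i_A(\Bbbk,A)=0$ for $i\ne d$ and $\operatorname{Ext}^d_A(\Bbbk,A)\cong\Bbbk$ up to a degree shift. It is quadratic if its defining relations are spanned by a subspace of $A_1\otimes_\Bbbk A_1$. Ore extensions. For a graded algebra $R$, a graded automorphism $\phi$ of $R$, and a left $\phi$-derivation $\delta$ of $R$ (linear, raising degree by one, $\delta(ab)=\phi(a)\delta(b)+\delta(a)b$), the Ore extension $R[z;\phi,\delta]$ is generated by $R$ and a degree-one element $z$ with $zr=\phi(r)z+\delta(r)$ for $r\in R$, and is free as a left $R$-module on the powers of $z$. Graded skew Clifford algebras ($\operatorname{char}(\Bbbk)\ne2$). Let $\mu=(\mu_{ij})\in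 M(n,\Bbbk)$ with $\mu_{ij}\in\Bbbk^\times$, $\mu_{ij}\mu_{ji}=1$ for $i\neq j$, $\mu_{ii}=1$. A matrix $M$ is $\mu$-symmetric if $M_{ij}=\mu_{ij}M_{ji}$ for all $i,j$. Given $\mu$-symmetric matrices $M_1,\dots,M_n$, an associated graded skew Clifford algebra is a graded $\Bbbk$-algebra on degree-one generators $x_1,\dots,x_n$ and degree-two generators $y_1,\dots,y_n$ with defining relations given by: (a) $x_ix_j+\mu_{ij}x_jx_i=\sum_{k=1}^n (M_k)_{ij}y_k$ for all $i,j$; and (b) the existence of a normalizing sequence $\{r_1,\dots,r_n\}$ of homogeneous degree-two elements spanning $\Bbbk y_1+\cdots+\Bbbk y_n$ (normalizing: the image of $r_{k+1}$ is a normal element in the quotient by $\langle r_1,\dots,r_k\rangle$ for each $k\geq 0$). A regular graded skew Clifford algebra is a graded skew Clifford algebra that is quadratic and regular. *)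

(* Defs.v *)
From HB Require Import structures.
From mathcomp Require Import all_boot all_order all_algebra.
From mathcomp Require Import finmap.
From mathcomp.multinomials Require Import monalg.

Set Implicit Arguments.
Unset Strict Implicit.
Unset Printing Implicit Defensive.

Import GRing.Theory.

Local Open Scope ring_scope.

Inductive ideal_gen (B : pzRingType) (S : B -> Prop) : B -> Prop :=
| ideal_gen0 : ideal_gen S 0
| ideal_genD (a s b t : B) :
    S s -> ideal_gen S t -> ideal_gen S (a * s * b + t).

(* The image of [r] in [B / J] is normal: it generates the same left and right
   ideal there. *)
Definition normal_mod (B : pzRingType) (J : B -> Prop) (r : B) : Prop :=
  forall a : B, (exists b, J (r * a - b * r)) /\ (exists b, J (a * r - r * b)).

Definition normalizing_sequence (B : pzRingType) n (r : 'I_n -> B) : Prop :=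
  forall i : 'I_n,
    normal_mod (ideal_gen (fun b => exists2 j : 'I_n, (j < i)%N & b = r j))
      (r i).

Definition direct_sum (I : eqType) (V : zmodType) (V_ : I -> V -> Prop) : Prop :=
  [/\ forall i, V_ i 0 /\ (forall u v, V_ i u -> V_ i v -> V_ i (u - v)),
      forall v, exists (s : seq I) (c : I -> V),
        (forall i, V_ i (c i)) /\ v = \sum_(i <- s) c i
    & forall (s : seq I) (c : I -> V), uniq s -> (forall i, V_ i (c i)) ->
        \sum_(i <- s) c i = 0 -> forall i, i \in s -> c i = 0].

(* Noncommutative polynomials: the monoid algebra of the free monoid on [I].
   The library only makes it an [lalgType k], which suffices here. *)
Notation freealg k I := {malg k[{fmonom I}]}.

Section FreeAlgebra.
Variables (k : fieldType) (I : choiceType).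

Definition fX (i : I) : freealg k I := << fmu i >>.

Definition word_weight (w : I -> nat) (m : {fmonom I}) : nat :=
  (\sum_(i <- (m : seq I)) w i)%N.

Definition homogeneous (w : I -> nat) (n : nat) (p : freealg k I) : Prop :=
  forall m, m \in msupp p -> word_weight w m = n.

Variable A : algType k.

Definition feval (g : I -> A) (p : freealg k I) : A :=
  mmap (GRing.in_alg A) (fun m : {fmonom I} => \prod_(i <- (m : seq I)) g i) p.

Definition presented_by (g : I -> A) (S : freealg k I -> Prop) : Prop :=
  (forall a, exists p, feval g p = a) /\
  (forall p, feval g p = 0 <-> ideal_gen S p).

Definition gen_grading (g : I -> A) (w : I -> nat) (n : nat) (a : A) : Prop :=
  exists2 p, homogeneous w n p & feval g p = a.

End FreeAlgebra.

Section LinearAlgebra.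
Variables (k : fieldType) (V : lmodType k).

Definition in_span m (v : 'I_m -> V) (u : V) : Prop :=
  exists c : 'I_m -> k, u = \sum_i c i *: v i.

Definition independent m (v : 'I_m -> V) : Prop :=
  forall c : 'I_m -> k, \sum_i c i *: v i = 0 -> forall i, c i = 0.

End LinearAlgebra.

Section GradedAlgebra.
Variables (k : fieldType) (A : algType k) (gr : nat -> A -> Prop).

Definition graded_algebra : Prop :=
  [/\ direct_sum gr,
      forall n (c : k) a, gr n a -> gr n (c *: a),
      gr 0%N 1
    & forall i j a b, gr i a -> gr j b -> gr (i + j)%N (a * b)].

Definition connected : Prop := forall a, gr 0%N a <-> exists c : k, a = c%:A.

Definition generated_in_degree1 : Prop :=
  exists m (v : 'I_m -> A),
    (forall a, gr 1%N a <-> in_span v a) /\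
    (forall a, exists p : freealg k 'I_m, feval v p = a).

Definition polynomial_growth : Prop :=
  exists C e : nat, forall n, exists m (v : 'I_m -> A),
    (m <= C * n.+1 ^ e)%N /\ (forall a, gr n a -> in_span v a).

(* [A] is the tensor algebra of [A_1] modulo relations in [A_1 (x) A_1]; a basis
   of [A_1] identifies the tensor algebra with a free algebra. *)
Definition quadratic : Prop :=
  exists m (v : 'I_m -> A) (S : freealg k 'I_m -> Prop),
    [/\ independent v, forall a, gr 1%N a <-> in_span v a,
        forall p, S p -> homogeneous (fun=> 1%N) 2 p
      & presented_by v S].

End GradedAlgebra.

(* Global dimension and Ext are those of left modules. *)

Section Homological.
Variable A : nzRingType.

Definition projective (P : lmodType A) : Prop :=
  forall (M N : lmodType A) (g : {linear M -> N}) (f : {linear P -> N}),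
    (forall y, exists x, g x = y) ->
    exists h : {linear P -> M}, forall p, g (h p) = f p.

Record resolution (M : lmodType A) := Resolution {
  res_mod :> nat -> lmodType A;
  res_d : forall i, {linear res_mod i.+1 -> res_mod i};
  res_aug : {linear res_mod 0%N -> M};
  res_projective : forall i, projective (res_mod i);
  res_aug_surj : forall y, exists p, res_aug p = y;
  res_exact0 : forall p, res_aug p = 0 <-> exists q, p = res_d 0%N q;
  res_exactS : forall i p, res_d i p = 0 <-> exists q, p = res_d i.+1 q
}.

Definition proj_dim_le (M : lmodType A) (d : nat) : Prop :=
  exists P : resolution M, forall i (p : P i), (d < i)%N -> p = 0.

Definition global_dim (d : nat) : Prop :=
  (forall M, proj_dim_le M d) /\
  (forall e, (e < d)%N -> exists M, ~ proj_dim_le M e).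

(* Cochains of [Hom_A(P, A)], whose cohomology is [Ext_A(M, A)]. *)

Definition cocycle M (P : resolution M) i (f : {linear P i -> A^o}) : Prop :=
  forall p, f (res_d P i p) = 0.

Definition coboundary M (P : resolution M) i : (P i -> A) -> Prop :=
  match i with
  | 0%N => fun f => forall p, f p = 0
  | j.+1 => fun f =>
      exists g : {linear P j -> A^o}, forall p, f p = g (res_d P j p)
  end.

Definition Ext_eq0 M (P : resolution M) i : Prop :=
  forall f : {linear P i -> A^o}, cocycle f -> coboundary (P := P) f.

End Homological.

Section Regular.
Variables (k : fieldType) (A : algType k) (gr : nat -> A -> Prop).

Definition gr_int (z : int) (a : A) : Prop :=
  match z with Posz n => gr n a | Negz _ => a = 0 end.

(* [T] is the module [k = A / A_{>0}]. *)
Definition trivial_module (T : lmodType A) : Prop :=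
  exists u : T,
    [/\ u != 0, forall t, exists c : k, t = (c%:A : A) *: u
      & forall n a, (0 < n)%N -> gr n a -> a *: u = 0].

Definition graded_module (M : lmodType A) (gM : int -> M -> Prop) : Prop :=
  direct_sum gM /\
  (forall (i : nat) (j : int) a m, gr i a -> gM j m -> gM (i%:Z + j) (a *: m)).

(* The differentials have degree 0; the resolved module sits in degree 0. *)
Definition graded_resolution (T : lmodType A) (P : resolution T)
    (gP : forall i, int -> P i -> Prop) : Prop :=
  [/\ forall i, graded_module (gP i),
      forall i j p, gP i.+1 j p -> gP i j (res_d P i p)
    & forall j p, gP 0%N j p -> j != 0 -> res_aug P p = 0].

(* [Ext^i_A(T, A)] is isomorphic to a shift of [k] as a graded right [A]-module:
   it is spanned over [k] by the nonzero class of a homogeneous cocycle which is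
   killed by [A_{>0}]. *)
Definition Ext_shift_k (T : lmodType A) (P : resolution T)
    (gP : forall i, int -> P i -> Prop) (i : nat) : Prop :=
  exists f0 : {linear P i -> A^o},
    [/\ cocycle f0,
        exists l : int, forall j p, gP i j p -> gr_int (j + l) (f0 p),
        ~ coboundary (P := P) (f0 : P i -> A),
        forall f : {linear P i -> A^o}, cocycle f -> exists c : k,
          coboundary (P := P) (fun p : P i => (f p : A) - c *: (f0 p : A))
      & forall n a, (0 < n)%N -> gr n a ->
          coboundary (P := P) (fun p : P i => (f0 p : A) * a)].

(* Ext does not depend on the projective resolution used to compute it. *)
Definition gorenstein (d : nat) : Prop :=
  exists (T : lmodType A) (P : resolution T) (gP : forall i, int -> P i -> Prop),
    [/\ trivial_module T, graded_resolution gP,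
        forall i, i != d -> Ext_eq0 P i
      & Ext_shift_k gP d].

Definition regular_of_dim (d : nat) : Prop :=
  [/\ [/\ graded_algebra gr, connected gr & generated_in_degree1 gr],
      global_dim A d, polynomial_growth gr & gorenstein d].

Definition regular : Prop := exists d, regular_of_dim d.

End Regular.

(* [A = R[z; phi, delta]] as graded algebras.  A polynomial [p : {poly R}] only
   serves as a finitely supported family of left coefficients of powers of
   [z]. *)
Definition ore_extension (k : fieldType)
    (R : algType k) (grR : nat -> R -> Prop)
    (A : algType k) (grA : nat -> A -> Prop) : Prop :=
  exists (iota : {lrmorphism R -> A}) (phi : {lrmorphism R -> R})
         (delta : {linear R -> R}) (z : A),
    [/\ [/\ graded_algebra grR, graded_algebra grA, grA 1%N z
          & forall n a, grR n a -> grA n (iota a)],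
        bijective phi /\ (forall n a, grR n a <-> grR n (phi a)),
        (forall n a, grR n a -> grR n.+1 (delta a)) /\
          (forall a b, delta (a * b) = phi a * delta b + delta a * b),
        forall a, z * iota a = iota (phi a) * z + iota (delta a)
      & forall a, exists! p : {poly R},
          a = \sum_(i < size p) iota p`_i * z ^+ i].

Section GradedSkewClifford.
Variables (k : fieldType) (n : nat).
Implicit Types (mu C : 'M[k]_n) (M : 'I_n -> 'M[k]_n).

Definition skew_parameters mu : Prop :=
  (forall i, mu i i = 1) /\
  (forall i j, mu i j != 0 /\ (i != j -> mu i j * mu j i = 1)).

Definition mu_symmetric mu (N : 'M[k]_n) : Prop :=
  forall i j, N i j = mu i j * N j i.

(* [inl i] stands for [x_i], of degree 1, and [inr i] for [y_i], of degree 2. *)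
Definition gsc_gen : choiceType := ('I_n + 'I_n)%type.
Definition gsc_weight (g : gsc_gen) : nat := if g is inl _ then 1%N else 2%N.
Notation F := (freealg k gsc_gen).
Definition fx (i : 'I_n) : F := fX k (inl i : gsc_gen).
Definition fy (i : 'I_n) : F := fX k (inr i : gsc_gen).

Definition clifford_relation mu M (p : F) : Prop :=
  exists i j,
    p = fx i * fx j + mu i j *: (fx j * fx i) - \sum_l M l i j *: fy l.

Definition lower_ideal C (i : 'I_n) : F -> Prop :=
  ideal_gen (fun q =>
    exists2 j : 'I_n, (j < i)%N & q = \sum_l C j l *: fy l).

(* [S] is a set of homogeneous relations imposing that the elements
   [r_i = \sum_l C i l *: y_l] form a normalizing sequence: for each generator
   [g] there is a relation rewriting [r_i g] as [g' r_i] and one rewriting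
   [g r_i] as [r_i g''], both modulo [r_j], [j < i]. *)
Definition normality_relations C (S : F -> Prop) : Prop :=
  let r i := \sum_l C i l *: fy l in
  exists left_ right_ cl cr : 'I_n -> gsc_gen -> F,
    (forall i g,
      [/\ homogeneous gsc_weight (gsc_weight g) (left_ i g),
          homogeneous gsc_weight (gsc_weight g) (right_ i g),
          homogeneous gsc_weight (gsc_weight g + 2) (cl i g) /\
            lower_ideal C i (cl i g)
        & homogeneous gsc_weight (gsc_weight g + 2) (cr i g) /\
            lower_ideal C i (cr i g)]) /\
    (forall p, S p <-> exists i g,
      p = r i * fX k g - left_ i g * r i - cl i g \/
      p = fX k g * r i - r i * right_ i g - cr i g).

(* The defining relations are the Clifford relations together with
   relations that make some spanning sequence of [k y_1 + ... + k y_n]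
   normalizing. *)
Definition gsca_for mu M (A : algType k) (gr : nat -> A -> Prop) : Prop :=
  exists (x y : 'I_n -> A) (C : 'M[k]_n) (S : F -> Prop),
    let gens (g : gsc_gen) := match g with inl i => x i | inr i => y i end in
    let r i := \sum_l C i l *: y l in
    [/\ forall d a, gr d a <-> gen_grading gens gsc_weight d a,
        forall l, in_span r (y l),
        normalizing_sequence r,
        normality_relations C S
      & presented_by gens (fun p => clifford_relation mu M p \/ S p)].

End GradedSkewClifford.

Definition graded_skew_clifford (k : fieldType) (A : algType k)
    (gr : nat -> A -> Prop) : Prop :=
  graded_algebra gr /\
  exists n (mu : 'M[k]_n) (M : 'I_n -> 'M[k]_n),
    [/\ skew_parameters mu, forall l, mu_symmetric mu (M l)
      & gsca_for mu M gr].

Definition regular_graded_skew_clifford (k : fieldType) (A : algType k)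
    (gr : nat -> A -> Prop) : Prop :=
  [/\ graded_skew_clifford gr, quadratic gr & regular gr].

Section Relations.
Variables (k : fieldType) (lam : k).
(* The generators are numbered from 0. *)
Let x1 := fX k (0 : 'I_3).
Let x2 := fX k (1 : 'I_3).
Let x3 := fX k (2 : 'I_3).

Definition A_relation (p : freealg k 'I_3) : Prop :=
  [\/ p = lam *: (x1 * x2) - x2 * x1,
      p = lam *: (x2 * x3) - (x3 * x2 - x1 ^+ 2)
    | p = lam *: (x3 * x1) - (x1 * x3 - x2 ^+ 2)].

End Relations.

(* Main.v *)
(* Put R = k<x1, x2> / (x2 x1 = lam x1 x2), which acts on k[x1, x2] and so has
   basis x1^a x2^b.  The relations of A say that x3 r = phi(r) x3 + delta(r) for
   the automorphism phi(x1) = lam^-1 x1, phi(x2) = lam x2 and the phi-derivation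
   delta(x1) = - lam^-1 x2^2, delta(x2) = x1^2; the powers of x3 are independent
   over R because A acts on polynomials over R with x3 acting by the skew shift.
   A quadratic algebra in which the squares of the generators x_i are normal is a
   graded skew Clifford algebra with y_i = x_i^2.  This applies to R, and to A
   when lam^3 = -1.  Regularity of R is read off the Koszul complex
   0 -> R (x) M -> (R (x) M)^2 -> R (x) M -> M, which resolves every R-module M. *)

Require Import Defs.
From HB Require Import structures.
From mathcomp Require Import all_boot all_order all_algebra.
From mathcomp Require Import finmap.
From mathcomp.multinomials Require Import monalg.
From mathcomp Require boolp classical_sets.

Set Implicit Arguments.
Unset Strict Implicit.
Unset Printing Implicit Defensive.

Import GRing.Theory.

Local Open Scope ring_scope.

(** * Ideals and free algebras *)

(** One construction carries most of the algebra: [qact] turns two operators with X2 X1 = lam X1 X2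
    into an action of R. It yields the product of R, the morphisms out of R, the derivation delta
    (through triangular operators on R (+) R) and the modules R (x) M, so that each of them costs
    one check of the relation on generators. The value lam^3 = -1 comes from the squares. Moving x3
    through x1^2 or x2^2 (or x3^2 through x1 or x2) leaves a cross term produced by the corrections
    x2^2 and x1^2 in the relations; it carries the factor lam^-1 + lam^2 or lam + lam^-2, and both
    vanish when lam^3 = -1. Global dimension quantifies over all modules, with no finiteness or
    grading. This is why the Koszul complex has coefficients in an arbitrary M, and why projectivity
    of its terms rests on splitting surjections of arbitrary vector spaces, by Zorn's lemma. The
    lower bound and the Gorenstein condition are read off the same complex for the trivial module,
    where the entries of the differentials lie in the augmentation ideal and Ext in degree 2 is R /
    (x1 R + x2 R). *)

Section Ideals.
Variables (B : pzRingType) (S : B -> Prop).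
Notation J := (ideal_gen S).

Lemma ideal_gen_mem s : S s -> J s.
Proof.
by move=> Ss; rewrite -[s]addr0 -[X in X + 0]mulr1 -[X in X * 1]mul1r;
  apply: ideal_genD => //; apply: ideal_gen0.
Qed.

Lemma ideal_gen_add s t : J s -> J t -> J (s + t).
Proof.
move=> Js Jt; elim: Js => [|a u b v Su _ IH]; first by rewrite add0r.
by rewrite -addrA; apply: ideal_genD.
Qed.

Lemma ideal_gen_mull a t : J t -> J (a * t).
Proof.
elim=> [|b u c v Su _ IH]; first by rewrite mulr0; apply: ideal_gen0.
by rewrite mulrDr !mulrA; apply: ideal_genD.
Qed.

Lemma ideal_gen_mulr a t : J t -> J (t * a).
Proof.
elim=> [|b u c v Su _ IH]; first by rewrite mul0r; apply: ideal_gen0.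
by rewrite mulrDl -[_ * c * a]mulrA; apply: ideal_genD.
Qed.

Lemma ideal_gen_opp t : J t -> J (- t).
Proof. by move=> Jt; rewrite -mulN1r; apply: ideal_gen_mull. Qed.

Lemma ideal_gen_sub s t : J s -> J t -> J (s - t).
Proof. by move=> Js Jt; apply: ideal_gen_add => //; apply: ideal_gen_opp. Qed.

Lemma ideal_gen_sum (I : Type) (r : seq I) (P : pred I) (f : I -> B) :
  (forall i, P i -> J (f i)) -> J (\sum_(i <- r | P i) f i).
Proof.
by move=> Jf; elim/big_rec: _ => [|i x /Jf Ji Jx];
  [apply: ideal_gen0 | apply: ideal_gen_add].
Qed.

Lemma ideal_gen_trans t u v : J (t - u) -> J (u - v) -> J (t - v).
Proof. by move=> Jt Ju; rewrite -(subrKA u); apply: ideal_gen_add. Qed.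

End Ideals.

Lemma ideal_gen_scale (k : pzRingType) (B : lalgType k) (S : B -> Prop) c t :
  ideal_gen S t -> ideal_gen S (c *: t).
Proof. by move=> Jt; rewrite -mulr_algl; apply: ideal_gen_mull. Qed.

Lemma ideal_gen_map (B C : pzRingType) (f : {rmorphism B -> C})
    (S : B -> Prop) (T : C -> Prop) :
  (forall s, S s -> ideal_gen T (f s)) ->
  forall t, ideal_gen S t -> ideal_gen T (f t).
Proof.
move=> fS t; elim=> [|a s b u /fS Ts _ IH]; first by rewrite rmorph0; constructor.
rewrite rmorphD !rmorphM; apply: ideal_gen_add => //.
by apply: ideal_gen_mulr; apply: ideal_gen_mull.
Qed.

Section FreeAlgebraTheory.
Variables (k : fieldType) (I : choiceType).
Notation F := (freealg k I).
Implicit Types (p q : F) (m : {fmonom I}).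

Lemma malg_scaleU (K : choiceType) (c d : k) (m : K) :
  c *: << d *g m >> = << c * d *g m >> :> {malg k[K]}.
Proof. by apply/malgP => n; rewrite mcoeffZ !mcoeffU mulrnAr. Qed.

Lemma malg_expand (K : choiceType) (p : {malg k[K]}) :
  p = \sum_(m <- msupp p) p@_m *: << m >>.
Proof.
by rewrite [LHS]monalgE; apply: eq_bigr => m _; rewrite malg_scaleU mulr1.
Qed.

Lemma freealg_mulU m n : << m >> * << n >> = << mmul m n >> :> F.
Proof. by rewrite malgM_def /fgmul !msuppU oner_eq0 !big_seq_fset1 !mcoeffUU mulr1. Qed.

(** Scalars are central because [k] is commutative; this provides the algebra structure of
    [free_algebra]. *)
Lemma freealg_scalerAr (c : k) p q : c *: (p * q) = p * (c *: q).
Proof.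
rewrite (malgMEw (fsubset_refl _) (msuppZ_le c q)) malgME.
rewrite scaler_sumr; apply: eq_bigr => m _; rewrite scaler_sumr.
by apply: eq_bigr => n _; rewrite malg_scaleU mcoeffZ mulrCA.
Qed.

Lemma word_cons i (s : seq I) :
  << FMonom (i :: s) >> = fX k i * << FMonom s >> :> F.
Proof.
rewrite /fX freealg_mulU; congr (<< _ *g _ >>).
by apply/eqP; rewrite fmP fmM fmU.
Qed.

Lemma word_nil : << FMonom [::] >> = 1 :> F.
Proof. by congr (<< _ *g _ >>); apply/eqP; rewrite fmP fm1. Qed.

Lemma freealg_ind (P : F -> Prop) :
    P 0 -> (forall p q, P p -> P q -> P (p + q)) ->
    (forall c p, P p -> P (c *: p)) -> P 1 ->
    (forall i p, P p -> P (fX k i * p)) ->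
  forall p, P p.
Proof.
move=> P0 PD PZ P1 PX p; rewrite (malg_expand p); elim/big_rec: _ => // m q _ Pq.
apply: PD => //; apply: PZ; case: m => s.
by elim: s => [|i s IH]; rewrite (word_nil, word_cons) //; apply: PX.
Qed.

End FreeAlgebraTheory.

Section Evaluation.
Variables (k : fieldType) (I : choiceType) (A : algType k) (g : I -> A).
Notation F := (freealg k I).
Implicit Types (p q : F).

Definition word_eval (m : {fmonom I}) : A := \prod_(i <- (m : seq I)) g i.

Lemma word_eval_is_multiplicative : mmorphism word_eval.
Proof.
by split=> [m n|]; rewrite /word_eval ?fmM ?fm1 ?big_cat ?big_nil.
Qed.

HB.instance Definition _ :=
  isMultiplicative.Build {fmonom I} A word_eval word_eval_is_multiplicative.

Lemma fevalU (c : k) m : feval g << c *g m >> = c *: word_eval m.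
Proof. by rewrite /feval mmapU mulr_algl. Qed.

Lemma feval_is_additive : zmod_morphism (feval g).
Proof. exact: mmap_is_additive. Qed.

Lemma feval_is_scalable : scalable (feval g).
Proof.
move=> c p; rewrite /feval (mmapEw (msuppZ_le _ _)) mmapE scaler_sumr.
by apply: eq_bigr => m _; rewrite mcoeffZ !mulr_algl scalerA.
Qed.

Lemma feval_is_multiplicative : monoid_morphism (feval g).
Proof.
have [|fM f1] := @commr_mmap_is_multiplicative _ _ _ (in_alg A) word_eval.
  by move=> p m n; rewrite /GRing.comm mulr_algl mulr_algr.
by split.
Qed.

HB.instance Definition _ :=
  GRing.isZmodMorphism.Build F A (feval g) feval_is_additive.
HB.instance Definition _ :=
  GRing.isScalable.Build k F A *:%R (feval g) feval_is_scalable.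
HB.instance Definition _ :=
  GRing.isMonoidMorphism.Build F A (feval g) feval_is_multiplicative.

Lemma feval1 : feval g 1 = 1. Proof. exact: rmorph1. Qed.
Lemma fevalM p q : feval g (p * q) = feval g p * feval g q.
Proof. exact: rmorphM. Qed.
Lemma fevalD p q : feval g (p + q) = feval g p + feval g q.
Proof. exact: raddfD. Qed.
Lemma fevalB p q : feval g (p - q) = feval g p - feval g q.
Proof. exact: raddfB. Qed.
Lemma fevalZ c p : feval g (c *: p) = c *: feval g p.
Proof. exact: feval_is_scalable. Qed.
Lemma feval0 : feval g 0 = 0. Proof. exact: raddf0. Qed.
Lemma fevalX i : feval g (fX k i) = g i.
Proof. by rewrite fevalU /word_eval fmU big_seq1 scale1r. Qed.

End Evaluation.

Lemma malg_lin_ind (k : fieldType) (K : choiceType) (P : {malg k[K]} -> Prop) :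
    P 0 -> (forall p q, P p -> P q -> P (p + q)) ->
    (forall c m, P (c *: << m >>)) -> forall p, P p.
Proof.
move=> P0 PD PU p; rewrite (malg_expand p); elim/big_rec: _ => // m q _ Pq.
by apply: PD => //; apply: PU.
Qed.

(** * Homogeneous components and the grading given by weighted generators *)

Section Homogeneous.
Variables (k : fieldType) (I : choiceType) (w : I -> nat).
Notation F := (freealg k I).
Notation weight := (word_weight w).
Implicit Types (p q : F) (m : {fmonom I}).

Lemma homogeneousP n p :
  homogeneous w n p <-> (forall m, p@_m != 0 -> weight m = n).
Proof.
by split=> hp m; [rewrite mcoeff_neq0 | rewrite -mcoeff_neq0]; apply: hp.
Qed.

Lemma homogeneous0 n : homogeneous w n (0 : F).
Proof. by move=> m; rewrite msupp0 in_fset0. Qed.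

Lemma homogeneousD n p q :
  homogeneous w n p -> homogeneous w n q -> homogeneous w n (p + q).
Proof.
move=> hp hq m mpq; have := fsubsetP (msuppD_le p q) m mpq.
by rewrite in_fsetU => /orP[/hp | /hq].
Qed.

Lemma homogeneousZ n c p : homogeneous w n p -> homogeneous w n (c *: p).
Proof. by move=> hp m mp; apply/hp/(fsubsetP (msuppZ_le c p)). Qed.

Lemma homogeneousN n p : homogeneous w n p -> homogeneous w n (- p).
Proof. by move=> hp m; rewrite msuppN => /hp. Qed.

Lemma homogeneousB n p q :
  homogeneous w n p -> homogeneous w n q -> homogeneous w n (p - q).
Proof. by move=> hp hq; apply: homogeneousD => //; apply: homogeneousN. Qed.

Lemma homogeneousU m : homogeneous w (weight m) (<< m >> : F).
Proof. by move=> n; rewrite msuppU1 in_fset1 => /eqP ->. Qed.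

Lemma homogeneous1 : homogeneous w 0 (1 : F).
Proof.
by move=> m; rewrite msuppU1 in_fset1 => /eqP ->; rewrite /word_weight fm1 big_nil.
Qed.

Lemma homogeneousX i : homogeneous w (w i) (fX k i).
Proof.
by move=> m; rewrite msuppU1 in_fset1 => /eqP ->; rewrite /word_weight fmU big_seq1.
Qed.

Lemma homogeneousM n1 n2 p q :
  homogeneous w n1 p -> homogeneous w n2 q -> homogeneous w (n1 + n2) (p * q).
Proof.
move=> hp hq m /msuppM_le[m1 [m2 [m1p m2q ->]]].
by rewrite -(hp _ m1p) -(hq _ m2q) /word_weight fmM big_cat.
Qed.

Definition hcomp n p : F := [malg m in msupp p => if weight m == n then p@_m else 0].

Lemma hcompE n p m : (hcomp n p)@_m = if weight m == n then p@_m else 0.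
Proof.
by rewrite mcoeffE; case: msuppP => // _; rewrite if_same.
Qed.

Lemma hcompD n p q : hcomp n (p + q) = hcomp n p + hcomp n q.
Proof.
by apply/malgP => m; rewrite mcoeffD !hcompE mcoeffD; case: eqP; rewrite ?addr0.
Qed.

Lemma hcomp0 n : hcomp n 0 = 0.
Proof. by apply/malgP => m; rewrite hcompE mcoeff0 if_same. Qed.

Lemma hcomp_homogeneous n p : homogeneous w n (hcomp n p).
Proof. by apply/homogeneousP => m; rewrite hcompE; case: (_ =P n); rewrite ?eqxx. Qed.

Lemma hcomp_id d n p : homogeneous w d p -> hcomp n p = if d == n then p else 0.
Proof.
move/homogeneousP => hp; apply/malgP => m; rewrite hcompE.
have [pm|/hp->] := eqVneq p@_m 0; last by case: eqP; rewrite ?mcoeff0.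
by rewrite pm if_same; case: (d == n); rewrite ?mcoeff0 ?pm.
Qed.

Lemma hcomp_sum_id (s : seq nat) (c : nat -> F) n :
    uniq s -> (forall i, homogeneous w i (c i)) -> n \in s ->
  hcomp n (\sum_(i <- s) c i) = c n.
Proof.
move=> us hc ns; rewrite (big_morph _ (hcompD n) (hcomp0 n)) (bigD1_seq n) //=.
rewrite (hcomp_id _ (hc n)) eqxx big1 ?addr0 // => i /negPf in_.
by rewrite (hcomp_id _ (hc i)) in_.
Qed.

Lemma hcomp_sum p :
  exists2 s : seq nat, uniq s & p = \sum_(n <- s) hcomp n p.
Proof.
exists (undup (map weight (msupp p))); first exact: undup_uniq.
apply/malgP => m; rewrite raddf_sum /=.
have [pm|pm] := eqVneq p@_m 0.
  by rewrite pm big1_seq // => n _; rewrite hcompE pm if_same.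
rewrite (bigD1_seq (weight m)) ?undup_uniq //=; last first.
  by rewrite mem_undup map_f // -mcoeff_neq0.
rewrite hcompE eqxx big1 ?addr0 // => n /negPf nm.
by rewrite hcompE eq_sym nm.
Qed.

(** By bilinearity the outer factors of [a * s * b] may be taken to be multiples of single words;
    the product is then homogeneous, so its component is either itself or 0. *)
Lemma ideal_gen_hcomp (S : F -> Prop) :
    (forall s, S s -> exists d, homogeneous w d s) ->
  forall n p, ideal_gen S p -> ideal_gen S (hcomp n p).
Proof.
move=> hS n p; elim=> [|a s b t Ss _ IH]; first by rewrite hcomp0; constructor.
rewrite hcompD; apply: ideal_gen_add => // {t IH}.
have [d hs] := hS s Ss; pattern a; apply: malg_lin_ind => [|a1 a2|c m].
- by rewrite !mul0r hcomp0; constructor.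
- by rewrite !mulrDl hcompD; apply: ideal_gen_add.
pattern b; apply: malg_lin_ind => [|b1 b2|e m'].
- by rewrite mulr0 hcomp0; constructor.
- by rewrite mulrDr hcompD; apply: ideal_gen_add.
have hU (z : k) l : homogeneous w (weight l) (z *: << l >>).
  by apply: homogeneousZ; apply: homogeneousU.
have hX := homogeneousM (homogeneousM (hU c m) hs) (hU e m').
rewrite (hcomp_id _ hX); case: eqP => _; last by constructor.
by apply/ideal_gen_mulr/ideal_gen_mull/ideal_gen_mem.
Qed.

Section Grading.
Variables (A : algType k) (g : I -> A).
Notation gr := (gen_grading g w).

Lemma gen_gradingX i : gr (w i) (g i).
Proof. by exists (fX k i); rewrite ?fevalX //; apply: homogeneousX. Qed.

Lemma gen_grading1 : gr 0 1.
Proof. by exists 1; rewrite ?feval1 //; apply: homogeneous1. Qed.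

Lemma gen_grading0 n : gr n 0.
Proof. by exists 0; rewrite ?feval0 //; apply: homogeneous0. Qed.

Lemma gen_gradingB n a b : gr n a -> gr n b -> gr n (a - b).
Proof.
move=> [p hp <-] [q hq <-].
by exists (p - q); rewrite ?fevalB //; apply: homogeneousB.
Qed.

Lemma gen_gradingD n a b : gr n a -> gr n b -> gr n (a + b).
Proof.
move=> [p hp <-] [q hq <-].
by exists (p + q); rewrite ?fevalD //; apply: homogeneousD.
Qed.

Lemma gen_gradingZ n c a : gr n a -> gr n (c *: a).
Proof.
by move=> [p hp <-]; exists (c *: p); rewrite ?fevalZ //; apply: homogeneousZ.
Qed.

Lemma gen_gradingM i j a b : gr i a -> gr j b -> gr (i + j)%N (a * b).
Proof.
move=> [p hp <-] [q hq <-].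
by exists (p * q); rewrite ?fevalM //; apply: homogeneousM.
Qed.

Lemma gen_grading_graded (S : F -> Prop) :
    presented_by g S -> (forall s, S s -> exists d, homogeneous w d s) ->
  graded_algebra gr.
Proof.
move=> [gsurj gker] hS; split.
- split=> [i|a|s c us hc sc0 i si].
  + by split; [apply: gen_grading0 | move=> u v; apply: gen_gradingB].
  + have [p <-] := gsurj a; have [s us {1}->] := hcomp_sum p.
    exists s, (fun n => feval g (hcomp n p)); split; last exact: raddf_sum.
    by move=> n; exists (hcomp n p) => //; apply: hcomp_homogeneous.
  (* Independence: homogeneous lifts [P i] of the [c i] sum to an element of the kernel, hence of
     the ideal. Its component in degree [i] is [P i], which therefore lies in the ideal too. *)
  have /boolp.choice[P hP] : forall i, exists p, homogeneous w i p /\ feval g p = c i.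
    by move=> j; have [p] := hc j; exists p.
  rewrite -(hP i).2 -(hcomp_sum_id us (fun i => (hP i).1) si).
  apply/gker/ideal_gen_hcomp => //; apply/gker.
  by rewrite raddf_sum -[RHS]sc0; apply: eq_bigr => j _; rewrite /= (hP j).2.
- exact: gen_gradingZ.
- exact: gen_grading1.
- exact: gen_gradingM.
Qed.

End Grading.
End Homogeneous.

Lemma presented_ind (k : fieldType) (I : choiceType) (A : algType k) (g : I -> A)
    (S : freealg k I -> Prop) (P : A -> Prop) :
    presented_by g S -> (forall a b, P a -> P b -> P (a + b)) ->
    (forall (c : k) a, P a -> P (c *: a)) -> P 1 -> (forall i a, P a -> P (g i * a)) ->
  forall a, P a.
Proof.
move=> [gsurj _] PD PZ P1 PX a; have [p <-] := gsurj a.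
pattern p; apply: freealg_ind => [|q r|c q|| i q].
- by rewrite feval0 -(scale0r 1); apply: PZ.
- by rewrite fevalD; apply: PD.
- by rewrite fevalZ; apply: PZ.
- by rewrite feval1.
- by rewrite fevalM fevalX; apply: PX.
Qed.

(** A second name for the free algebra that carries the full algebra structure, so that it can be
    the target of [feval] and an instance of identities stated for an [algType]. *)
Definition free_algebra (k : fieldType) (I : choiceType) : Type := freealg k I.

HB.instance Definition _ (k : fieldType) (I : choiceType) :=
  GRing.Lalgebra.on (free_algebra k I).
HB.instance Definition _ (k : fieldType) (I : choiceType) :=
  GRing.Lalgebra_isAlgebra.Build k (free_algebra k I) (@freealg_scalerAr k I).

(** A homogeneous element is a combination of words of equal weight, and each word arises by
    multiplying letters on the left, the degree growing by the weight of the letter. *)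
Lemma gen_grading_ind (k : fieldType) (I : choiceType) (A : algType k)
    (g : I -> A) (w : I -> nat) (Q : nat -> A -> Prop) :
    (forall d, Q d 0) -> (forall d a b, Q d a -> Q d b -> Q d (a + b)) ->
    (forall d (c : k) a, Q d a -> Q d (c *: a)) -> Q 0%N 1 ->
    (forall i d a, Q d a -> Q (w i + d)%N (g i * a)) ->
  forall d a, gen_grading g w d a -> Q d a.
Proof.
move=> Q0 QD QZ Q1 QX d _ [p hp <-]; rewrite (malg_expand p) raddf_sum big_seq.
elim/big_ind: _ => [|a b|m mp]; [exact: Q0 | exact: QD |].
rewrite /= fevalZ fevalU scale1r -(hp m mp); apply: QZ.
rewrite /word_eval /word_weight; elim: (m : seq I) => [|i s IH].
  by rewrite !big_nil.
by rewrite !big_cons; apply: QX.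
Qed.

Lemma gen_grading_sub (k : fieldType) (I J : choiceType) (A : algType k)
    (g : I -> A) (w : I -> nat) (h : J -> A) (v : J -> nat) :
    (forall i, gen_grading h v (w i) (g i)) ->
  forall d a, gen_grading g w d a -> gen_grading h v d a.
Proof.
move=> gh; apply: gen_grading_ind => [d|d a b|d c a||i d a ha].
- exact: gen_grading0.
- exact: gen_gradingD.
- exact: gen_gradingZ.
- exact: gen_grading1.
exact: (gen_gradingM (gh i) ha).
Qed.

Section FevalQuadratic.
Variables (k : fieldType) (I : choiceType) (B : algType k) (g : I -> B).

Lemma fevalXX i j : feval g (fX k i * fX k j) = g i * g j.
Proof. by rewrite fevalM; congr (_ * _); apply: fevalX. Qed.

Lemma fevalX2 i : feval g (fX k i ^+ 2) = g i ^+ 2.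
Proof. by rewrite expr2 fevalXX. Qed.

Lemma feval_clifford (i j : I) (m : k) n (c : 'I_n -> k) (q : 'I_n -> freealg k I) :
  feval g (fX k i * fX k j + m *: (fX k j * fX k i) - \sum_l c l *: q l) =
    g i * g j + m *: (g j * g i) - \sum_l c l *: feval g (q l).
Proof.
rewrite fevalB; congr (_ - _).
  by rewrite fevalD fevalZ; congr (_ + _ *: _); apply: fevalXX.
by rewrite raddf_sum; apply: eq_bigr => l _; apply: fevalZ.
Qed.

End FevalQuadratic.

(** * Clifford presentations from normal squares *)

Section CliffordPresentation.
Variables (k : fieldType) (n : nat) (A : algType k) (x : 'I_n -> A).
Variables (SA : freealg k 'I_n -> Prop) (hA : presented_by x SA).
Hypothesis two_neq0 : 2%:R != 0 :> k.
Variables (mu : 'M[k]_n) (M : 'I_n -> 'M[k]_n) (c : 'I_n -> 'I_n -> k).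
Hypothesis diag_M : forall l i, M l i i = if l == i then 2%:R else 0.
Hypothesis mu_diag : forall i, mu i i = 1.
Hypothesis c_neq0 : forall i j, c i j != 0.
Hypothesis sqr_comm : forall i j, x i ^+ 2 * x j = c i j *: (x j * x i ^+ 2).

(** The Clifford relations after elimination of the y's, each y_l being replaced by x_l^2. *)
Definition square_relation (p : freealg k 'I_n) : Prop :=
  exists i j, p = fX k i * fX k j + mu i j *: (fX k j * fX k i)
                  - \sum_l M l i j *: fX k l ^+ 2.

Hypothesis square_rel0 : forall p, square_relation p -> feval x p = 0.
Hypothesis SA_sub : forall p, SA p -> ideal_gen square_relation p.

Notation F := (freealg k (gsc_gen n)).
Notation w := (@gsc_weight n).
Notation x1 := (fun=> 1%N).

Definition sqr_gens (g : gsc_gen n) : A :=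
  match g with inl i => x i | inr i => x i ^+ 2 end.

Definition sqr_scalar (i : 'I_n) (g : gsc_gen n) : k :=
  match g with inl j => c i j | inr j => c i j ^+ 2 end.

(** Normality in its strongest form: y_i commutes with every generator up to a scalar, so that all
    corrections by earlier terms of the sequence are 0. *)
Definition sqr_normality (p : F) : Prop :=
  exists i g, p = fy k i * fX k g - (sqr_scalar i g *: fX k g) * fy k i \/
              p = fX k g * fy k i - fy k i * ((sqr_scalar i g)^-1 *: fX k g).

Notation J :=
  (ideal_gen (fun p => clifford_relation mu M p \/ sqr_normality p)).

Lemma sum_scalar_mx1 (V : lmodType k) (y : 'I_n -> V) i :
  \sum_l (1%:M : 'M[k]_n) i l *: y l = y i.
Proof.
rewrite (bigD1 i) //= mxE eqxx scale1r big1 ?addr0 // => l /negPf li.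
by rewrite mxE eq_sym li scale0r.
Qed.

Lemma sqr_scalar_neq0 i g : sqr_scalar i g != 0.
Proof. by case: g => j /=; rewrite ?expf_neq0. Qed.

Lemma sqr_gens_comm i g :
  x i ^+ 2 * sqr_gens g = sqr_scalar i g *: (sqr_gens g * x i ^+ 2).
Proof.
case: g => j; first exact: sqr_comm.
rewrite /sqr_gens /sqr_scalar [x j ^+ 2]expr2 mulrA sqr_comm -scalerAl.
by rewrite -[_ * _ * x j]mulrA sqr_comm -scalerAr scalerA mulrA.
Qed.

Lemma sqr_gens_comm' i g :
  sqr_gens g * x i ^+ 2 = (sqr_scalar i g)^-1 *: (x i ^+ 2 * sqr_gens g).
Proof. by rewrite sqr_gens_comm scalerA mulVf ?scale1r ?sqr_scalar_neq0. Qed.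

(** The commutation with generators is exact and not merely modulo earlier squares, so any [K]
    containing 0 serves; the square is moved through [a] one letter at a time. *)
Lemma sqr_normal i (K : A -> Prop) : K 0 -> normal_mod K (x i ^+ 2).
Proof.
move=> K0 a; suff [[b rb] [b' rb']] :
    (exists b, x i ^+ 2 * a = b * x i ^+ 2) /\ (exists b, a * x i ^+ 2 = x i ^+ 2 * b).
  by split; [exists b; rewrite rb subrr | exists b'; rewrite rb' subrr].
pattern a; apply: (presented_ind hA) => [a1 a2|z a1||j a1].
- move=> [[b1 e1] [d1 f1]] [[b2 e2] [d2 f2]]; split.
    by exists (b1 + b2); rewrite mulrDr mulrDl e1 e2.
  by exists (d1 + d2); rewrite mulrDr mulrDl f1 f2.
- move=> [[b1 e1] [d1 f1]]; split.
    by exists (z *: b1); rewrite -scalerAr -scalerAl e1.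
  by exists (z *: d1); rewrite -scalerAr -scalerAl f1.
- by split; exists 1; rewrite mulr1 mul1r.
move=> [[b1 e1] [d1 f1]]; split.
  exists (c i j *: (x j * b1)).
  by rewrite mulrA sqr_comm -scalerAl -[_ * _ * a1]mulrA e1 mulrA scalerAl.
exists ((c i j)^-1 *: (x j * d1)).
by rewrite -mulrA f1 mulrA (sqr_gens_comm' i (inl j)) -scalerAl -scalerAr mulrA.
Qed.

Notation fxA := (fun i => fx k i : free_algebra k (gsc_gen n)).

Definition embed (p : freealg k 'I_n) : F :=
  feval fxA p.

Lemma embed0 : embed 0 = 0. Proof. exact: (feval0 fxA). Qed.
Lemma embed1 : embed 1 = 1. Proof. exact: (feval1 fxA). Qed.
Lemma embedX i : embed (fX k i) = fx k i. Proof. exact: (fevalX fxA). Qed.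
Lemma embedD p q : embed (p + q) = embed p + embed q.
Proof. exact: (fevalD fxA). Qed.
Lemma embedZ a p : embed (a *: p) = a *: embed p.
Proof. exact: (fevalZ fxA). Qed.
Lemma embedM p q : embed (p * q) = embed p * embed q.
Proof. exact: (fevalM fxA). Qed.

(** The diagonal Clifford relation reads 2 x_i^2 = 2 y_i; this is where the characteristic being
    different from 2 enters. *)
Lemma sqr_eq_y i : J (fx k i ^+ 2 - fy k i).
Proof.
have -> : fx k i ^+ 2 - fy k i =
    2%:R^-1 *: (fx k i * fx k i + mu i i *: (fx k i * fx k i)
                - \sum_l M l i i *: fy k l).
  rewrite mu_diag scale1r (bigD1 i) //= big1 ?addr0; last first.
    by move=> l /negPf li; rewrite diag_M li scale0r.
  rewrite diag_M eqxx -expr2 -mulr2n -scaler_nat -scalerBr.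
  by rewrite scalerA mulVf ?scale1r.
by apply/ideal_gen_scale/ideal_gen_mem; left; exists i, i.
Qed.

Lemma embed_relation p : square_relation p -> J (embed p).
Proof.
move=> [i [j ->]].
have -> : embed (fX k i * fX k j + mu i j *: (fX k j * fX k i)
                  - \sum_l M l i j *: fX k l ^+ 2) =
    (fx k i * fx k j + mu i j *: (fx k j * fx k i) - \sum_l M l i j *: fy k l)
    - \sum_l M l i j *: (fx k l ^+ 2 - fy k l).
  have e := feval_clifford fxA i j (mu i j) (fun l => M l i j) (fun l => fX k l ^+ 2).
  rewrite -[RHS]addrA -opprD -big_split; apply: (etrans e).
  congr (_ - _); apply: eq_bigr => l _.
  by rewrite /= -scalerDr addrC subrK; congr (_ *: _); apply: (fevalX2 fxA).
apply: ideal_gen_sub; first by apply: ideal_gen_mem; left; exists i, j.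
by apply: ideal_gen_sum => l _; apply/ideal_gen_scale/sqr_eq_y.
Qed.

Lemma embed_ideal p : ideal_gen SA p -> J (embed p).
Proof.
apply: (ideal_gen_map (f := feval fxA)).
move=> s /SA_sub; apply: ideal_gen_map => q; exact: embed_relation.
Qed.

(** Modulo the relations every y_i is a square, so a polynomial in the x's and y's is congruent to
    one in the x's alone. *)
Lemma embed_mod p : exists q, J (p - embed q).
Proof.
pattern p; apply: freealg_ind => [|q r [q' Jq] [r' Jr]|z q [q' Jq]||[] i q [q' Jq]].
- by exists 0; rewrite embed0 subrr; constructor.
- exists (q' + r'); rewrite embedD opprD addrACA.
  exact: (ideal_gen_add Jq Jr).
- by exists (z *: q'); rewrite embedZ -scalerBr; apply: ideal_gen_scale.
- by exists 1; rewrite embed1 subrr; constructor.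
- exists (fX k i * q'); rewrite embedM embedX -mulrBr.
  exact: (ideal_gen_mull _ Jq).
exists (fX k i ^+ 2 * q'); rewrite embedM [in embed _]expr2 embedM embedX -expr2.
apply: (@ideal_gen_trans _ _ _ (fx k i ^+ 2 * q)); last first.
  rewrite -mulrBr; exact: (ideal_gen_mull _ Jq).
by rewrite -mulrBl -opprB mulNr; apply/ideal_gen_opp/ideal_gen_mulr/sqr_eq_y.
Qed.

Lemma feval_embed p : feval sqr_gens (embed p) = feval x p.
Proof.
pattern p; apply: freealg_ind => [|q r IHq IHr|z q IHq||i q IHq].
- by rewrite embed0 !feval0.
- rewrite embedD; transitivity (feval x q + feval x r); last by rewrite -fevalD.
  by rewrite -IHq -IHr -fevalD.
- by rewrite embedZ (fevalZ sqr_gens) IHq (fevalZ x).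
- by rewrite embed1 !feval1.
- by rewrite embedM embedX (fevalM sqr_gens) fevalX IHq (fevalM x) fevalX.
Qed.

(** For the kernel, elimination of the y's leaves a polynomial in the x's that evaluates to 0, hence
    lies in the ideal of [SA]; [SA_sub] carries this ideal into that of the Clifford relations. *)
Lemma sqr_presented :
  presented_by sqr_gens (fun p => clifford_relation mu M p \/ sqr_normality p).
Proof.
split=> [a|p].
  by have [p <-] := hA.1 a; exists (embed p); apply: feval_embed.
have soundJ q : J q -> feval sqr_gens q = 0.
  elim=> [|a s b t Ss _ IH]; first exact: feval0.
  rewrite fevalD !fevalM IH addr0.
  suff -> : feval sqr_gens s = 0 by rewrite mulr0 mul0r.
  case: Ss => [[i [j ->]] | [i [g [->|->]]]].
  - have := square_rel0 (ex_intro _ i (ex_intro _ j erefl)).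
    rewrite feval_clifford => e; rewrite feval_clifford -[RHS]e; congr (_ - _).
    by apply: eq_bigr => l _; rewrite fevalX2; congr (_ *: _); apply: fevalX.
  - rewrite -scalerAl fevalB.
    transitivity (x i ^+ 2 * sqr_gens g - sqr_scalar i g *: (sqr_gens g * x i ^+ 2)).
      congr (_ - _); first exact: (fevalXX sqr_gens (inr i) g).
      by rewrite fevalZ; congr (_ *: _); exact: (fevalXX sqr_gens g (inr i)).
    by rewrite sqr_gens_comm subrr.
  - rewrite -freealg_scalerAr fevalB.
    transitivity (sqr_gens g * x i ^+ 2 - (sqr_scalar i g)^-1 *: (x i ^+ 2 * sqr_gens g)).
      congr (_ - _); first exact: (fevalXX sqr_gens g (inr i)).
      by rewrite fevalZ; congr (_ *: _); exact: (fevalXX sqr_gens (inr i) g).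
    by rewrite sqr_gens_comm' subrr.
split; last exact: soundJ.
have [q Jpq] := embed_mod p => p0.
rewrite -(subrK (embed q) p); apply: ideal_gen_add => //.
apply/embed_ideal/hA.2; rewrite -feval_embed.
by move/soundJ: Jpq; rewrite fevalB p0 sub0r => /eqP; rewrite oppr_eq0 => /eqP.
Qed.

Lemma sqr_grading d a : gen_grading x x1 d a <-> gen_grading sqr_gens w d a.
Proof.
split; apply: gen_grading_sub; first by move=> i; apply: (gen_gradingX w sqr_gens (inl i)).
case=> i; first exact: (gen_gradingX x1 x i).
by rewrite /= expr2; apply: (@gen_gradingM _ _ x1 _ x 1 1); apply: (gen_gradingX x1 x).
Qed.

Lemma sqr_gsca : gsca_for mu M (gen_grading x x1).
Proof.
(* The normalizing sequence is y_1, ..., y_n itself, whence the identity matrix. *)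
exists x, (fun i => x i ^+ 2), 1%:M, sqr_normality.
have y1 i : \sum_l (1%:M : 'M[k]_n) i l *: x l ^+ 2 = x i ^+ 2.
  by rewrite (sum_scalar_mx1 (fun l => x l ^+ 2)).
have f1 i : \sum_l (1%:M : 'M[k]_n) i l *: fy k l = fy k i.
  by rewrite (sum_scalar_mx1 (@fy k n)).
split.
- exact: sqr_grading.
- move=> l; exists ((1%:M : 'M[k]_n) l).
  by rewrite -[LHS]y1; apply: eq_bigr => i _; rewrite y1.
- by move=> i; rewrite y1; apply: sqr_normal; constructor.
- exists (fun i g => sqr_scalar i g *: fX k g), (fun i g => (sqr_scalar i g)^-1 *: fX k g),
    (fun _ _ => 0), (fun _ _ => 0); split.
    move=> i g; split; do ?[by apply/homogeneousZ/homogeneousX];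
      by split; [apply: homogeneous0 | constructor].
  move=> p; split=> -[i [g E]]; exists i, g; move: E; rewrite f1 /= => E.
    by case: E => E; [left | right]; exact: (etrans E (esym (subr0 _))).
  by case: E => E; [left | right]; exact: (etrans E (subr0 _)).
exact: sqr_presented.
Qed.

End CliffordPresentation.

(** * The quantum plane *)

Section MalgLift.
Variables (K : choiceType) (V W : zmodType).
Implicit Types (u v : {malg V[K]}).

(* Locked: comparing two such sums up to conversion is prohibitively slow. *)
Fact mlift_key : unit. Proof. by []. Qed.
Definition mlift := locked_with mlift_key
  (fun (f : K -> V -> W) u => \sum_(m <- msupp u) f m (mcoeff m u)).

Lemma mliftE f u : mlift f u = \sum_(m <- msupp u) f m (mcoeff m u).
Proof. by rewrite /mlift unlock. Qed.

Lemma mlift0 f : mlift f 0 = 0.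
Proof. by rewrite mliftE msupp0 big_seq_fset0. Qed.

Variable (f : K -> V -> W).
Hypothesis f_add : forall m x y, f m (x + y) = f m x + f m y.

Lemma mliftEw (d : {fset K}) u :
  (msupp u `<=` d)%fset -> mlift f u = \sum_(m <- d) f m (mcoeff m u).
Proof.
move=> le; rewrite mliftE (big_fset_incl _ le) // => m _ /mcoeff_outdom ->.
by apply: (addIr (f m 0)); rewrite -f_add !add0r.
Qed.

Lemma mliftD u v : mlift f (u + v) = mlift f u + mlift f v.
Proof.
rewrite (mliftEw (msuppD_le u v)) (mliftEw (fsubsetUl (msupp u) (msupp v))).
rewrite (mliftEw (fsubsetUr (msupp u) (msupp v))) -big_split.
by apply: eq_bigr => m _; rewrite mcoeffD f_add.
Qed.

Lemma mliftU m x : mlift f << x *g m >> = f m x.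
Proof. by rewrite (mliftEw msuppU_le) big_seq_fset1 mcoeffUU. Qed.

End MalgLift.

(* [tens V] stands for [k[x1, x2] (x) V], the monomial [x1^a x2^b (x) v] being
   [mono a b v]. *)
Definition tens (k : fieldType) (V : lmodType k) : Type := {malg V[(nat * nat)%type]}.

Section Tens.
Variables (k : fieldType) (V : lmodType k).
Notation T := (tens V).
Implicit Types (u v : T) (x : V) (a b : nat).

HB.instance Definition _ := GRing.Zmodule.on T.

Fact tcoef_key : unit. Proof. by []. Qed.
Definition tcoef := locked_with tcoef_key (fun u a b => mcoeff (a, b) u : V).
Definition mono a b x : T := mkmalgU (a, b) x.

Lemma tcoefE u a b : tcoef u a b = mcoeff (a, b) u.
Proof. by rewrite /tcoef unlock. Qed.

Lemma tensP u v : (forall a b, tcoef u a b = tcoef v a b) -> u = v.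
Proof. by move=> uv; apply/malgP => -[a b]; rewrite -!tcoefE. Qed.

Lemma tcoef0 a b : tcoef 0 a b = 0. Proof. by rewrite tcoefE mcoeff0. Qed.
Lemma tcoefD u v a b : tcoef (u + v) a b = tcoef u a b + tcoef v a b.
Proof. by rewrite !tcoefE mcoeffD. Qed.
Lemma tcoefB u v a b : tcoef (u - v) a b = tcoef u a b - tcoef v a b.
Proof. by rewrite !tcoefE mcoeffB. Qed.
Lemma tcoefN u a b : tcoef (- u) a b = - tcoef u a b.
Proof. by rewrite !tcoefE mcoeffN. Qed.
Lemma tcoef_mono a b x a' b' :
  tcoef (mono a b x) a' b' = if (a == a') && (b == b') then x else 0.
Proof. by rewrite tcoefE mcoeffU xpair_eqE; case: ifP. Qed.

Lemma mono0 a b : mono a b 0 = 0. Proof. exact: monalgU0. Qed.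
Lemma monoD a b x y : mono a b (x + y) = mono a b x + mono a b y.
Proof. exact: monalgUD. Qed.

Fact tscale_key : unit. Proof. by []. Qed.
Definition tscale := locked_with tscale_key
  (fun (c : k) u => [malg m in msupp u => c *: mcoeff m u] : T).

Lemma tcoef_tscale c u a b : tcoef (tscale c u) a b = c *: tcoef u a b.
Proof.
rewrite !tcoefE /tscale unlock mcoeffE; case: msuppP => // _.
by rewrite scaler0.
Qed.

Fact tscaleA c d u : tscale c (tscale d u) = tscale (c * d) u.
Proof. by apply: tensP => a b; rewrite !tcoef_tscale scalerA. Qed.
Fact tscale1 : left_id 1 tscale.
Proof. by move=> u; apply: tensP => a b; rewrite tcoef_tscale scale1r. Qed.
Fact tscaleDr : right_distributive tscale +%R.
Proof.
by move=> c u v; apply: tensP => a b; rewrite !(tcoef_tscale, tcoefD) scalerDr.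
Qed.
Fact tscaleDl v : {morph tscale^~ v : c d / c + d}.
Proof.
by move=> c d; apply: tensP => a b; rewrite !(tcoef_tscale, tcoefD) scalerDl.
Qed.

HB.instance Definition _ := GRing.Zmodule_isLmodule.Build k T
  tscaleA tscale1 tscaleDr tscaleDl.

Lemma tcoefZ c u a b : tcoef (c *: u) a b = c *: tcoef u a b.
Proof. exact: tcoef_tscale. Qed.

Lemma monoZ c a b x : mono a b (c *: x) = c *: mono a b x.
Proof.
by apply: tensP => i j; rewrite tcoefZ !tcoef_mono; case: ifP; rewrite ?scaler0.
Qed.

Lemma tens_ind (P : T -> Prop) :
    P 0 -> (forall u v, P u -> P v -> P (u + v)) ->
    (forall a b x, P (mono a b x)) ->
  forall u, P u.
Proof.
move=> P0 PD PU u; rewrite (monalgE u); elim/big_rec: _ => // -[a b] v _ Pv.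
by apply: PD => //; apply: PU.
Qed.

Definition tlift (W : zmodType) (f : nat -> nat -> V -> W) (u : T) : W :=
  mlift (fun m => f m.1 m.2) u.

Section Lift.
Variables (W : zmodType) (f : nat -> nat -> V -> W).
Hypothesis f_add : forall a b x y, f a b (x + y) = f a b x + f a b y.

Lemma tlift0 : tlift f 0 = 0.
Proof. exact: mlift0. Qed.

Lemma tliftD u v : tlift f (u + v) = tlift f u + tlift f v.
Proof. exact: mliftD. Qed.

Lemma tlift_mono a b x : tlift f (mono a b x) = f a b x.
Proof. exact: mliftU. Qed.

End Lift.

Lemma tliftZ (W : lmodType k) (f : nat -> nat -> V -> W) c u :
    (forall a b, linear (f a b)) -> tlift f (c *: u) = c *: tlift f u.
Proof.
move=> f_lin; have fD a b x y : f a b (x + y) = f a b x + f a b y.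
  by rewrite -[x]scale1r f_lin !scale1r.
have f0 a b : f a b 0 = 0 by apply: (addIr (f a b 0)); rewrite -fD !add0r.
pattern u; apply: tens_ind => [|v w IHv IHw|a b x].
- by rewrite scaler0 tlift0 scaler0.
- by rewrite scalerDr !tliftD // IHv IHw scalerDr.
by rewrite -monoZ !tlift_mono // -[_ *: x]addr0 f_lin f0 addr0.
Qed.

Lemma tlift_linear (W : lmodType k) (f : nat -> nat -> V -> W) :
  (forall a b, linear (f a b)) -> linear (tlift f).
Proof.
move=> f_lin c u v; rewrite tliftD ?tliftZ // => a b x y.
by rewrite -[x]scale1r f_lin !scale1r.
Qed.

End Tens.

(** Every multiplication operator below shifts exponents by a fixed (s, t) while acting on
    coefficients; this formula turns identities between such operators into a case analysis on
    exponents. *)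
Lemma tcoef_tlift_shift (k : fieldType) (V : lmodType k) (s t : nat)
    (f : nat -> nat -> V -> V) (u : tens V) a b :
    (forall a b, linear (f a b)) ->
  tcoef (tlift (fun a b x => mono (s + a) (t + b) (f a b x)) u) a b =
    if (s <= a)%N && (t <= b)%N then f (a - s)%N (b - t)%N (tcoef u (a - s) (b - t))
    else 0.
Proof.
move=> f_lin; have fD i j x y : f i j (x + y) = f i j x + f i j y.
  by rewrite -[x]scale1r f_lin !scale1r.
have f0 i j : f i j 0 = 0 by apply: (addIr (f i j 0)); rewrite -fD !add0r.
have gD i j x y : mono (s + i) (t + j) (f i j (x + y)) =
    mono (s + i) (t + j) (f i j x) + mono (s + i) (t + j) (f i j y).
  by rewrite fD monoD.
pattern u; apply: tens_ind => [|v w IHv IHw|i j x].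
- by rewrite tlift0 !tcoef0 f0 if_same.
- by rewrite tliftD // !tcoefD IHv IHw; case: ifP; rewrite ?fD ?addr0.
rewrite tlift_mono // !tcoef_mono; case: ifP => [/andP[/eqP <- /eqP <-]|ne].
  by rewrite !leq_addr !addKn !eqxx.
case: ifP => // /andP[sa tb]; case: ifP => // /andP[/eqP ia /eqP jb].
by rewrite ia jb !subnKC // !eqxx in ne.
Qed.

Section Operators.
Variables (k : fieldType) (lam : k) (V : lmodType k).
Notation T := (tens V).
Implicit Types (u : T) (x : V).

Fact shift_key : unit. Proof. by []. Qed.
Definition shift := locked_with shift_key
  (fun (s t : nat) (f : nat -> nat -> V -> V) =>
    tlift (fun a b x => mono (s + a) (t + b) (f a b x)) : T -> T).

Lemma shiftE s t f :
  shift s t f = tlift (fun a b x => mono (s + a) (t + b) (f a b x)).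
Proof. by rewrite /shift unlock. Qed.

Lemma shift_linear s t f : (forall a b, linear (f a b)) -> linear (shift s t f).
Proof. by move=> fl; rewrite shiftE; apply: tlift_linear => a b c x y; rewrite fl monoD monoZ. Qed.

Lemma shift_mono s t f a b x : (forall a b, linear (f a b)) ->
  shift s t f (mono a b x) = mono (s + a) (t + b) (f a b x).
Proof.
move=> fl; rewrite shiftE tlift_mono // => i j y z.
by rewrite -[y]scale1r fl scale1r monoD scale1r.
Qed.

Lemma scale_linear (c : k) : linear (fun x : V => c *: x).
Proof. by move=> d x y; rewrite scalerDr !scalerA mulrC. Qed.

(* Left and right multiplication by [x1] and [x2] on [k[x1, x2]] where
   [x2 x1 = lam x1 x2]. *)
Definition lmul1 : T -> T := shift 1 0 (fun _ _ x => x).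
Definition lmul2 : T -> T := shift 0 1 (fun a _ x => lam ^+ a *: x).
Definition rmul1 : T -> T := shift 1 0 (fun _ b x => lam ^+ b *: x).
Definition rmul2 : T -> T := shift 0 1 (fun _ _ x => x).
Definition tmap (f : V -> V) : T -> T := shift 0 0 (fun _ _ => f).

HB.instance Definition _ := GRing.isLinear.Build k T T *:%R lmul1
  (shift_linear _ _ (fun _ _ _ _ _ => erefl)).
HB.instance Definition _ := GRing.isLinear.Build k T T *:%R lmul2
  (shift_linear _ _ (fun a _ => scale_linear (lam ^+ a))).
HB.instance Definition _ := GRing.isLinear.Build k T T *:%R rmul1
  (shift_linear _ _ (fun _ b => scale_linear (lam ^+ b))).
HB.instance Definition _ := GRing.isLinear.Build k T T *:%R rmul2
  (shift_linear _ _ (fun _ _ _ _ _ => erefl)).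
HB.instance Definition _ (f : {linear V -> V}) :=
  GRing.isLinear.Build k T T *:%R (tmap f)
  (shift_linear _ _ (fun _ _ => linearP f)).

Lemma lmul1_mono a b x : lmul1 (mono a b x) = mono a.+1 b x.
Proof. exact: shift_mono. Qed.
Lemma lmul2_mono a b x : lmul2 (mono a b x) = mono a b.+1 (lam ^+ a *: x).
Proof. by apply: shift_mono => *; apply: scale_linear. Qed.
Lemma rmul1_mono a b x : rmul1 (mono a b x) = mono a.+1 b (lam ^+ b *: x).
Proof. by apply: shift_mono => *; apply: scale_linear. Qed.
Lemma rmul2_mono a b x : rmul2 (mono a b x) = mono a b.+1 x.
Proof. exact: shift_mono. Qed.
Lemma tmap_mono (f : {linear V -> V}) a b x : tmap f (mono a b x) = mono a b (f x).
Proof. by apply: shift_mono => *; apply: linearP. Qed.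

Lemma tcoef_lmul1 u a b : tcoef (lmul1 u) a b = if a is a'.+1 then tcoef u a' b else 0.
Proof. by rewrite /lmul1 shiftE tcoef_tlift_shift //; case: a => //= a; rewrite subn1 subn0. Qed.
Lemma tcoef_lmul2 u a b :
  tcoef (lmul2 u) a b = if b is b'.+1 then lam ^+ a *: tcoef u a b' else 0.
Proof.
rewrite /lmul2 shiftE tcoef_tlift_shift; last by move=> *; apply: scale_linear.
by case: b => //= b; rewrite subn1 subn0.
Qed.
Lemma tcoef_rmul1 u a b :
  tcoef (rmul1 u) a b = if a is a'.+1 then lam ^+ b *: tcoef u a' b else 0.
Proof.
rewrite /rmul1 shiftE tcoef_tlift_shift; last by move=> *; apply: scale_linear.
by case: a => //= a; rewrite subn1 subn0.
Qed.
Lemma tcoef_rmul2 u a b : tcoef (rmul2 u) a b = if b is b'.+1 then tcoef u a b' else 0.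
Proof. by rewrite /rmul2 shiftE tcoef_tlift_shift //; case: b => [|b]; rewrite ?subn1 ?subn0. Qed.
Lemma tcoef_tmap (f : {linear V -> V}) u a b : tcoef (tmap f u) a b = f (tcoef u a b).
Proof.
rewrite /tmap shiftE tcoef_tlift_shift; last by move=> *; apply: linearP.
by rewrite !subn0.
Qed.

Lemma lmul12 u : lmul2 (lmul1 u) = lam *: lmul1 (lmul2 u).
Proof.
apply: tensP => -[|a] [|b]; rewrite tcoefZ !(tcoef_lmul1, tcoef_lmul2) ?scaler0 //.
by rewrite exprS scalerA.
Qed.

End Operators.

Arguments lmul1 {k V}.
Arguments rmul2 {k V}.
Arguments lmul2 {k} lam {V}.
Arguments rmul1 {k} lam {V}.
Arguments tmap {k V}.

Lemma iter_linear (k : fieldType) (W : lmodType k) (X : {linear W -> W}) n :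
  linear (iter n X).
Proof. by elim: n => [|n IH] c u v //=; rewrite IH linearP. Qed.

Section PlaneAction.
Variables (k : fieldType) (lam : k) (W : lmodType k).
Variables (X1 X2 : {linear W -> W}).
Hypothesis X12 : forall w, X2 (X1 w) = lam *: X1 (X2 w).
Notation P := (tens k^o).
Implicit Types (r s : P) (w : W) (c : k).

Fact qact_key : unit. Proof. by []. Qed.
(** The action in which x1 and x2 act as [X1] and [X2], written on the basis x1^a x2^b;
    compatibility with products is [qact_qmul]. *)
Definition qact := locked_with qact_key (fun r w =>
  tlift (fun a b (c : k^o) => (c : k) *: iter a X1 (iter b X2 w)) r : W).

Lemma qactE r w :
  qact r w = tlift (fun a b (c : k^o) => (c : k) *: iter a X1 (iter b X2 w)) r.
Proof. by rewrite /qact unlock. Qed.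

Lemma qact_family_linear w a b :
  linear (fun c : k^o => (c : k) *: iter a X1 (iter b X2 w)).
Proof. by move=> c d e; rewrite scalerDl -scalerA. Qed.

Lemma qact_linear w : linear (qact^~ w).
Proof.
by move=> c r s; rewrite !qactE tlift_linear // => a b; apply: qact_family_linear.
Qed.

Lemma qactD r s w : qact (r + s) w = qact r w + qact s w.
Proof. by rewrite -[r in LHS]scale1r qact_linear scale1r. Qed.
Lemma qact0 w : qact 0 w = 0.
Proof. by rewrite qactE tlift0. Qed.
Lemma qactZ c r w : qact (c *: r) w = c *: qact r w.
Proof. by rewrite -[_ *: r]addr0 qact_linear qact0 addr0. Qed.

Lemma qact_mono a b (c : k^o) w :
  qact (mono a b c) w = (c : k) *: iter a X1 (iter b X2 w).
Proof. by rewrite qactE tlift_mono // => *; rewrite scalerDl. Qed.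

Lemma qact_linearr r : linear (qact r).
Proof.
move=> c u v; pattern r; apply: tens_ind => [|s t IHs IHt|a b d].
- by rewrite !qact0 scaler0 addr0.
- by rewrite 3!qactD IHs IHt scalerDr addrACA.
by rewrite !qact_mono !iter_linear scalerDr !scalerA mulrC.
Qed.

Lemma qactDr r u v : qact r (u + v) = qact r u + qact r v.
Proof. by rewrite -[u in LHS]scale1r qact_linearr scale1r. Qed.
Lemma qactr0 r : qact r 0 = 0.
Proof. by apply: (addIr (qact r 0)); rewrite -qactDr !add0r. Qed.
Lemma qactZr c r w : qact r (c *: w) = c *: qact r w.
Proof. by rewrite -[_ *: w]addr0 qact_linearr qactr0 addr0. Qed.

Lemma iter_X12 a w : X2 (iter a X1 w) = lam ^+ a *: iter a X1 (X2 w).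
Proof.
elim: a => [|a IH] /=; first by rewrite scale1r.
by rewrite X12 IH linearZ scalerA exprS.
Qed.

Lemma qact_lmul1 r w : qact (lmul1 r) w = X1 (qact r w).
Proof.
pattern r; apply: tens_ind => [|s t IHs IHt|a b d].
- by rewrite linear0 !qact0 linear0.
- by rewrite (linearD lmul1) [LHS]qactD IHs IHt -linearD -qactD.
by rewrite lmul1_mono !qact_mono linearZ.
Qed.

(** Moving [X2] past a copies of [X1] costs lam^a, which is the factor that [lmul2] inserts. *)
Lemma qact_lmul2 r w : qact (lmul2 lam r) w = X2 (qact r w).
Proof.
pattern r; apply: tens_ind => [|s t IHs IHt|a b d].
- by rewrite linear0 !qact0 linear0.
- by rewrite (linearD (lmul2 lam)) [LHS]qactD IHs IHt -linearD -qactD.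
by rewrite lmul2_mono !qact_mono linearZ iter_X12 /= scalerA mulrC.
Qed.

Definition tone : P := mono 0 0 1.

Lemma qact_one w : qact tone w = w.
Proof. by rewrite qact_mono scale1r. Qed.

End PlaneAction.

Lemma iter_lmul1 (k : fieldType) (V : lmodType k) a i j (x : V) :
  iter a (@lmul1 k V) (mono i j x) = mono (a + i) j x.
Proof. by elim: a => //= a ->; rewrite lmul1_mono. Qed.

Lemma iter_lmul2 (k : fieldType) (lam : k) (V : lmodType k) b j (x : V) :
  iter b (lmul2 lam) (mono 0 j x) = mono 0 (b + j) x.
Proof. by elim: b => //= b ->; rewrite lmul2_mono scale1r. Qed.

Lemma plane_ind (k : fieldType) (lam : k) (Q : tens k^o -> Prop) :
    (forall r s, Q r -> Q s -> Q (r + s)) -> (forall (c : k) r, Q r -> Q (c *: r)) ->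
    Q (tone k) -> (forall r, Q r -> Q (lmul1 r)) ->
    (forall r, Q r -> Q (lmul2 lam r)) ->
  forall r, Q r.
Proof.
move=> QD QZ Q1 QX QY r; pattern r; apply: tens_ind => [||a b c] //.
  by rewrite -(scale0r (tone k)); apply: QZ.
have -> : mono a b c = (c : k) *: iter a (@lmul1 k k^o) (iter b (lmul2 lam) (tone k)).
  by rewrite iter_lmul2 iter_lmul1 !addn0 -monoZ /GRing.scale /= mulr1.
apply: QZ; elim: a => [|a IH] /=; last exact: QX.
by elim: b => [|b IH] //=; apply: QY.
Qed.

(* The quantum plane [k<x1, x2> / (x2 x1 = lam x1 x2)]. *)
Definition qplane (k : fieldType) (lam : k) : Type := tens k^o.

Section QuantumPlane.
Variables (k : fieldType) (lam : k).
Notation R := (qplane lam).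
Implicit Types (r s t : R).

HB.instance Definition _ := GRing.Lmodule.on R.

(** The plane acts on itself through its two left multiplication operators. *)
Definition qmul r s : R := qact (@lmul1 k k^o) (lmul2 lam) r s.

(** Induction on [r], built from 1 by left multiplication by x1 and x2. For [W] the plane itself
    this is associativity, so triple products of monomials are never expanded. *)
Lemma qact_qmul (W : lmodType k) (X1 X2 : {linear W -> W}) r s w :
    (forall w, X2 (X1 w) = lam *: X1 (X2 w)) ->
  qact X1 X2 (qmul r s) w = qact X1 X2 r (qact X1 X2 s w).
Proof.
move=> X12; rewrite /qmul; pattern r.
apply: (plane_ind (lam := lam)) => [r1 r2 IH1 IH2|c r1 IH||r1 IH|r1 IH].
- by rewrite (qactD lmul1) [LHS](qactD X1) IH1 IH2 -(qactD X1).
- by rewrite (qactZ lmul1) [LHS](qactZ X1) IH -(qactZ X1).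
- by rewrite !qact_one.
- by rewrite (qact_lmul1 lmul1) [LHS](qact_lmul1 X1) IH -(qact_lmul1 X1).
- by rewrite (qact_lmul2 (@lmul12 k lam k^o)) [LHS](qact_lmul2 X12) IH -(qact_lmul2 X12).
Qed.

Fact qmulA : associative qmul.
Proof. by move=> r s t; rewrite {1 3}/qmul qact_qmul //; apply: lmul12. Qed.
Fact qmul1r : left_id (tone k : R) qmul.
Proof. by move=> r; apply: qact_one. Qed.
Fact qmulr1 : right_id (tone k : R) qmul.
Proof.
rewrite /left_id /right_id /qmul => r; pattern r.
apply: (plane_ind (lam := lam)) => [r1 r2 IH1 IH2|c r1 IH||r1 IH|r1 IH].
- by rewrite qactD IH1 IH2.
- by rewrite qactZ IH.
- by rewrite qact_one.
- by rewrite qact_lmul1 IH.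
- by rewrite (qact_lmul2 (@lmul12 k lam k^o)) IH.
Qed.
Fact qmulDl : left_distributive qmul +%R.
Proof. by move=> r s t; apply: qactD. Qed.
Fact qmulDr : right_distributive qmul +%R.
Proof. by move=> r s t; apply: qactDr. Qed.
Fact tone_neq0 : (tone k : R) != 0.
Proof.
apply/eqP => /(congr1 (fun u : tens k^o => tcoef u 0 0)) /eqP.
by rewrite tcoef_mono tcoef0 oner_eq0.
Qed.

HB.instance Definition _ := GRing.Zmodule_isNzRing.Build R
  qmulA qmul1r qmulr1 qmulDl qmulDr tone_neq0.

Fact qscaleAl (c : k) r s : c *: (r * s) = c *: r * s.
Proof. by symmetry; apply: qactZ. Qed.
HB.instance Definition _ := GRing.Lmodule_isLalgebra.Build k R qscaleAl.

Fact qscaleAr (c : k) r s : c *: (r * s) = r * (c *: s).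
Proof. by symmetry; apply: qactZr. Qed.
HB.instance Definition _ := GRing.Lalgebra_isAlgebra.Build k R qscaleAr.

Definition qx1 : R := mono 1 0 1.
Definition qx2 : R := mono 0 1 1.

Lemma qx1M r : qx1 * r = lmul1 r.
Proof. by rewrite -[LHS]/(qact _ _ _ _) qact_mono scale1r. Qed.
Lemma qx2M r : qx2 * r = lmul2 lam r.
Proof. by rewrite -[LHS]/(qact _ _ _ _) qact_mono scale1r. Qed.

Lemma qplane_ind (Q : R -> Prop) :
    (forall r s, Q r -> Q s -> Q (r + s)) -> (forall (c : k) r, Q r -> Q (c *: r)) ->
    Q 1 -> (forall r, Q r -> Q (qx1 * r)) -> (forall r, Q r -> Q (qx2 * r)) ->
  forall r, Q r.
Proof.
move=> QD QZ Q1 QX QY; apply: (plane_ind (lam := lam)) => // r.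
  by move=> /QX; rewrite qx1M.
by move=> /QY; rewrite qx2M.
Qed.

Lemma qx21 : qx2 * qx1 = lam *: (qx1 * qx2).
Proof.
by rewrite qx1M qx2M lmul1_mono lmul2_mono expr1 -monoZ.
Qed.

Lemma qx1X a : qx1 ^+ a = mono a 0 1.
Proof.
elim: a => [|a IH] //; rewrite exprS IH qx1M; exact: lmul1_mono.
Qed.
Lemma qx2X b : qx2 ^+ b = mono 0 b 1.
Proof.
by elim: b => [|b IH] //; rewrite exprS IH qx2M lmul2_mono scale1r.
Qed.
Lemma qmono a b (c : k^o) : mono a b c = (c : k) *: (qx1 ^+ a * qx2 ^+ b) :> R.
Proof.
have -> : qx1 ^+ a * qx2 ^+ b = mono a b 1.
  by rewrite qx2X qx1X -[LHS]/(qact _ _ _ _) qact_mono scale1r iter_lmul1 addn0.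
by rewrite -[RHS](monoZ (V := k^o)) /GRing.scale /= mulr1.
Qed.

End QuantumPlane.

(* The representation of the quantum plane given by operators [X1], [X2]. *)
Definition qrep (k : fieldType) (lam : k) (W : lmodType k) (X1 X2 : {linear W -> W})
  (X12 : forall w, X2 (X1 w) = lam *: X1 (X2 w)) : Type := W.

Section Representation.
Variables (k : fieldType) (lam : k) (W : lmodType k) (X1 X2 : {linear W -> W}).
Variable (X12 : forall w, X2 (X1 w) = lam *: X1 (X2 w)).
Notation N := (qrep X12).
Notation R := (qplane lam).

HB.instance Definition _ := GRing.Zmodule.on N.

Definition qrep_scale (r : R) (w : N) : N := qact X1 X2 r w.

Fact qrep_scaleA r s w : qrep_scale r (qrep_scale s w) = qrep_scale (r * s) w.
Proof. by symmetry; apply: qact_qmul. Qed.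
Fact qrep_scale1 : left_id 1 qrep_scale.
Proof. by move=> w; apply: qact_one. Qed.
Fact qrep_scaleDr : right_distributive qrep_scale +%R.
Proof. by move=> r u v; apply: qactDr. Qed.
Fact qrep_scaleDl w : {morph qrep_scale^~ w : r s / r + s}.
Proof. by move=> r s; apply: qactD. Qed.

HB.instance Definition _ := GRing.Zmodule_isLmodule.Build R N
  qrep_scaleA qrep_scale1 qrep_scaleDr qrep_scaleDl.

Lemma qrep_x1 (w : N) : qx1 lam *: w = X1 w :> W.
Proof. by rewrite -[LHS]/(qact _ _ _ _) qact_mono scale1r. Qed.
Lemma qrep_x2 (w : N) : qx2 lam *: w = X2 w :> W.
Proof. by rewrite -[LHS]/(qact _ _ _ _) qact_mono scale1r. Qed.
Lemma qrepZ (c : k) (w : N) : (c%:A : R) *: w = c *: (w : W) :> W.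
Proof. by rewrite -[LHS]/(qact _ _ _ _) qactZ qact_one. Qed.

End Representation.

Lemma homogeneous_XX (k : fieldType) (I : choiceType) (i j : I) :
  homogeneous (fun=> 1%N) 2 (fX k i * fX k j).
Proof. by apply: (@homogeneousM _ _ _ 1 1); apply: homogeneousX. Qed.

Section PlaneIdentities.
Variables (k : fieldType) (B : algType k) (u v : B).
Implicit Types (c d : k).

(** The three identities of this section isolate the bookkeeping of scalars when v is moved past
    powers of u; they are instantiated in [free_algebra]. *)
Lemma plane_commuteS c a :
  c *: (u * v) * u ^+ a - c ^+ a.+1 *: (u ^+ a.+1 * v) =
    c *: (u * (v * u ^+ a - c ^+ a *: (u ^+ a * v))).
Proof. by rewrite mulrBr scalerBr -scalerAr scalerA -exprS !mulrA -exprS -scalerAl. Qed.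

Lemma plane_mul_u c a b : u * (c *: (u ^+ a * v ^+ b)) = c *: (u ^+ a.+1 * v ^+ b).
Proof. by rewrite -scalerAr mulrA -exprS. Qed.

Lemma plane_mul_v c d a b :
  v * (c *: (u ^+ a * v ^+ b)) - (d * c) *: (u ^+ a * v ^+ b.+1) =
    c *: ((v * u ^+ a - d *: (u ^+ a * v)) * v ^+ b).
Proof. by rewrite mulrBl -scalerAr scalerBr -scalerAl scalerA mulrC exprS !mulrA. Qed.

End PlaneIdentities.

Section PlanePresentation.
Variables (k : fieldType) (lam : k).
Notation R := (qplane lam).
Notation F := (freealg k 'I_2).
Notation X i := (fX k (i : 'I_2)).

Definition plane_relation (p : F) : Prop := p = X 1 * X 0 - lam *: (X 0 * X 1).

Definition plane_gens (i : 'I_2) : R := if i == 0 then qx1 lam else qx2 lam.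

Notation J := (ideal_gen plane_relation).
Notation ev := (feval plane_gens).

(** The ordered representative of a basis element in the free algebra, against which membership in
    the ideal is tested. *)
Definition normal_form (r : R) : F :=
  tlift (fun a b (c : k^o) => (c : k) *: (X 0 ^+ a * X 1 ^+ b)) r.

Lemma normal_form_linear (c : k) (r s : R) :
  normal_form (c *: r + s) = c *: normal_form r + normal_form s.
Proof. by apply: tlift_linear => a b d x y; rewrite scalerDl -scalerA. Qed.

Lemma normal_form0 : normal_form 0 = 0.
Proof. exact: tlift0. Qed.

Lemma normal_formD r s : normal_form (r + s) = normal_form r + normal_form s.
Proof. by rewrite -[r in LHS]scale1r normal_form_linear scale1r. Qed.

Lemma normal_formZ (c : k) r : normal_form (c *: r) = c *: normal_form r.
Proof. by rewrite -[_ *: r]addr0 normal_form_linear normal_form0 addr0. Qed.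

Lemma normal_form_mono a b (c : k^o) :
  normal_form (mono a b c) = (c : k) *: (X 0 ^+ a * X 1 ^+ b).
Proof. by apply: tlift_mono => *; rewrite scalerDl. Qed.

Lemma plane_commute a : J (X 1 * X 0 ^+ a - lam ^+ a *: (X 0 ^+ a * X 1)).
Proof.
elim: a => [|a IH]; first by rewrite !expr0 mulr1 mul1r scale1r subrr; constructor.
apply: (@ideal_gen_trans _ _ _ (lam *: (X 0 * X 1) * X 0 ^+ a)).
  rewrite exprS mulrA -mulrBl; apply/ideal_gen_mulr/ideal_gen_mem.
  by [].
have -> : lam *: (X 0 * X 1) * X 0 ^+ a - lam ^+ a.+1 *: (X 0 ^+ a.+1 * X 1) =
    lam *: (X 0 * (X 1 * X 0 ^+ a - lam ^+ a *: (X 0 ^+ a * X 1))).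
  exact: (plane_commuteS (B := free_algebra k 'I_2)).
by apply: ideal_gen_scale; exact: (ideal_gen_mull _ IH).
Qed.

(** Only the letter x2 needs the relation, in order to be moved past x1^a. *)
Lemma normal_form_step i r : J (fX k i * normal_form r - normal_form (plane_gens i * r)).
Proof.
pattern r; apply: tens_ind => [|s t Js Jt|a b c].
- by rewrite mulr0 normal_form0 mulr0 subrr; constructor.
- rewrite mulrDr !normal_formD mulrDr opprD addrACA.
  exact: (ideal_gen_add Js Jt).
have [->|->] : i = 0 \/ i = 1.
- by case: i => -[|[|//]] h; [left | right]; apply: val_inj.
- rewrite [plane_gens _ * _]qx1M lmul1_mono !normal_form_mono.
  have -> : X 0 * ((c : k) *: (X 0 ^+ a * X 1 ^+ b)) = (c : k) *: (X 0 ^+ a.+1 * X 1 ^+ b).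
    exact: (plane_mul_u (B := free_algebra k 'I_2)).
  by rewrite subrr; constructor.
rewrite [plane_gens _ * _]qx2M lmul2_mono !normal_form_mono.
have -> : X 1 * ((c : k) *: (X 0 ^+ a * X 1 ^+ b))
    - (lam ^+ a * c) *: (X 0 ^+ a * X 1 ^+ b.+1) =
    (c : k) *: ((X 1 * X 0 ^+ a - lam ^+ a *: (X 0 ^+ a * X 1)) * X 1 ^+ b).
  exact: (plane_mul_v (B := free_algebra k 'I_2)).
by apply: ideal_gen_scale; exact: (ideal_gen_mulr _ (plane_commute a)).
Qed.

(** Since [normal_form] sees only the value of [p], a polynomial that evaluates to 0 is congruent to
    0: the kernel of evaluation is contained in the ideal. *)
Lemma normal_form_feval p : J (p - normal_form (ev p)).
Proof.
pattern p; apply: freealg_ind => [|q r Jq Jr|c q Jq||i q Jq].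
- by rewrite feval0 normal_form0 subrr; constructor.
- rewrite fevalD normal_formD opprD addrACA.
  exact: (ideal_gen_add Jq Jr).
- by rewrite fevalZ normal_formZ -scalerBr; apply: ideal_gen_scale.
- rewrite feval1 (normal_form_mono 0 0) scale1r !expr0 mulr1 subrr; constructor.
have Jq' : J (fX k i * q - fX k i * normal_form (ev q)).
  by rewrite -mulrBr; exact: (ideal_gen_mull _ Jq).
have -> : ev (fX k i * q) = plane_gens i * ev q.
  by rewrite fevalM; congr (_ * _); apply: fevalX.
exact: (ideal_gen_trans Jq' (normal_form_step i (ev q))).
Qed.

Lemma plane_presented : presented_by plane_gens plane_relation.
Proof.
split=> [r|p].
  pattern r; apply: qplane_ind => [s t [p <-] [q <-]|c s [p <-]||s [p <-]|s [p <-]].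
  - by exists (p + q); rewrite fevalD.
  - by exists (c *: p); rewrite fevalZ.
  - by exists 1; rewrite feval1.
  - by exists (X 0 * p); rewrite fevalM; congr (_ * _); apply: fevalX.
  - by exists (X 1 * p); rewrite fevalM; congr (_ * _); apply: fevalX.
split=> [p0|].
  by have := normal_form_feval p; rewrite p0 normal_form0 subr0.
elim=> [|a s b t -> _ IH]; first exact: feval0.
rewrite fevalD IH addr0 !fevalM.
suff -> : ev (X 1 * X 0 - lam *: (X 0 * X 1)) = 0 by rewrite mulr0 mul0r.
transitivity (qx2 lam * qx1 lam - lam *: (qx1 lam * qx2 lam)).
  rewrite fevalB; congr (_ - _); first exact: fevalXX.
  by rewrite fevalZ; congr (_ *: _); exact: fevalXX.
by rewrite qx21 subrr.
Qed.

Definition plane_gr := gen_grading plane_gens (fun=> 1%N).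

Lemma plane_relation_homogeneous p : plane_relation p -> homogeneous (fun=> 1%N) 2 p.
Proof.
move=> ->; apply: homogeneousB; first exact: homogeneous_XX.
by apply: homogeneousZ; apply: homogeneous_XX.
Qed.

Lemma plane_graded : graded_algebra plane_gr.
Proof.
apply: (gen_grading_graded plane_presented) => p /plane_relation_homogeneous.
by exists 2.
Qed.

End PlanePresentation.

Lemma tens_expand (k : fieldType) (V : lmodType k) (u : tens V) :
  u = \sum_(m <- msupp u) mono m.1 m.2 (tcoef u m.1 m.2).
Proof. by rewrite [LHS]monalgE; apply: eq_bigr => -[a b] _; rewrite tcoefE. Qed.

Lemma tens_support_ind (k : fieldType) (V : lmodType k) (Q : tens V -> Prop) u :
    Q 0 -> (forall v w, Q v -> Q w -> Q (v + w)) ->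
    (forall a b, tcoef u a b != 0 -> Q (mono a b (tcoef u a b))) -> Q u.
Proof.
move=> Q0 QD QU; rewrite (tens_expand u) big_seq.
elim/big_ind: _ => // -[a b] mu /=; apply: QU.
by rewrite tcoefE mcoeff_neq0.
Qed.

Lemma ord2P (i : 'I_2) : i = 0 \/ i = 1.
Proof. by case: i => -[|[|//]] h; [left | right]; apply: val_inj. Qed.

(** * Grading, quadraticity and growth of the quantum plane *)

Section PlaneGrading.
Variables (k : fieldType) (lam : k).
Notation R := (qplane lam).
Notation gr := (@plane_gr k lam).
Notation gens := (@plane_gens k lam).
Implicit Types (r : R).

(** Replaces the grading by words with a condition on exponents, the form in which later degree
    arguments on the plane use it. *)
Lemma plane_grP n r :
  gr n r <-> (forall a b, tcoef r a b != 0 -> (a + b)%N = n).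
Proof.
split.
  move: n r; apply: gen_grading_ind => [n|n r s hr hs|n c r hr||i n r hr] a b.
  - by rewrite tcoef0 eqxx.
  - rewrite tcoefD; have [->|/hr->//] := eqVneq (tcoef r a b) 0.
    by rewrite add0r; apply: hs.
  - rewrite tcoefZ; have [->|/hr->//] := eqVneq (tcoef r a b) 0.
    by rewrite scaler0 eqxx.
  - by rewrite tcoef_mono; case: a b => [|a] [|b]; rewrite ?eqxx.
  have [->|->] := ord2P i.
    rewrite [gens _ * _]qx1M tcoef_lmul1; case: a => [|a]; first by rewrite eqxx.
    by move/hr <-.
  rewrite [gens _ * _]qx2M tcoef_lmul2; case: b => [|b]; first by rewrite eqxx.
  have [->|/hr <- _] := eqVneq (tcoef r a b) 0; first by rewrite scaler0 eqxx.
  by rewrite addnS.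
move=> hr; apply: tens_support_ind => [|s t|a b /hr <-].
- exact: gen_grading0.
- exact: gen_gradingD.
rewrite qmono; apply: gen_gradingZ; apply: gen_gradingM.
  elim: a => [|a IH]; first exact: gen_grading1.
  by rewrite exprS; apply: (@gen_gradingM _ _ _ _ _ 1); rewrite // -[qx1 _]/(gens 0);
    apply: (gen_gradingX (fun=> 1%N) gens).
elim: b => [|b IH]; first exact: gen_grading1.
by rewrite exprS; apply: (@gen_gradingM _ _ _ _ _ 1); rewrite // -[qx2 _]/(gens 1);
  apply: (gen_gradingX (fun=> 1%N) gens).
Qed.

Lemma tcoef_tone a b : tcoef (1 : R) a b = if (a == 0)%N && (b == 0)%N then 1 else 0.
Proof. by rewrite tcoef_mono ![(0 == _)%N]eq_sym. Qed.

Lemma tcoefZ1 (c : k) (u : tens k^o) a b : tcoef (c *: u) a b = c * (tcoef u a b : k).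
Proof. exact: tcoefZ. Qed.

Lemma plane_connected : connected gr.
Proof.
move=> r; split=> [/plane_grP hr|[c ->]]; last exact/gen_gradingZ/gen_grading1.
exists (tcoef r 0 0); apply: tensP => a b; rewrite tcoefZ1 tcoef_tone.
case: ifP => [/andP[/eqP-> /eqP->]|ab]; first by rewrite mulr1.
rewrite mulr0; apply/eqP; apply: contraFT ab => /hr /eqP.
by rewrite addn_eq0.
Qed.

Lemma tcoef_lincomb (c : 'I_2 -> k) a b :
  tcoef (\sum_i c i *: gens i : R) a b =
    if (a == 1)%N && (b == 0)%N then c 0 else
    if (a == 0)%N && (b == 1)%N then c 1 else 0.
Proof.
rewrite !big_ord_recl big_ord0 addr0 tcoefD !tcoefZ1.
have -> : lift ord0 ord0 = 1 :> 'I_2 by apply: val_inj.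
rewrite -[gens ord0]/(mono 1 0 1) -[gens 1]/(mono 0 1 1) !tcoef_mono.
by case: a b => [|[|a]] [|[|b]] /=; rewrite ?mulr0 ?mulr1 ?addr0 ?add0r.
Qed.

Lemma plane_gr1 r : gr 1 r <-> in_span gens r.
Proof.
split=> [/plane_grP hr|[c ->]]; last first.
  apply/plane_grP => a b; rewrite tcoef_lincomb.
  by case: a b => [|[|a]] [|[|b]] //=; rewrite eqxx.
exists (fun i => if i == 0 then tcoef r 1 0 else tcoef r 0 1).
apply: tensP => a b; rewrite tcoef_lincomb /=.
case: ifP => [/andP[/eqP-> /eqP->] //|ab]; case: ifP => [/andP[/eqP-> /eqP->] //|ab'].
have [//|/hr] := eqVneq (tcoef r a b) 0.
by move: ab ab'; case: a b => [|[|a]] [|[|b]].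
Qed.

Lemma plane_independent : independent gens.
Proof.
move=> c c0 i; have e a b : tcoef (\sum_i c i *: gens i : R) a b = 0.
  by rewrite c0 tcoef0.
by have [->|->] := ord2P i; [have := e 1 0 | have := e 0 1]; rewrite tcoef_lincomb.
Qed.

Lemma plane_generated : generated_in_degree1 gr.
Proof.
by exists 2, gens; split; [exact: plane_gr1 | exact: (plane_presented lam).1].
Qed.

Lemma plane_quadratic : quadratic gr.
Proof.
exists 2, gens, (plane_relation lam); split.
- exact: plane_independent.
- exact: plane_gr1.
- exact: plane_relation_homogeneous.
- exact: plane_presented.
Qed.

Lemma plane_growth : polynomial_growth gr.
Proof.
(* Degree n is spanned by the n + 1 monomials x1^i x2^(n-i), which gives the bound 1 * (n + 1)^1. *)
exists 1%N, 1%N => n; exists n.+1, (fun i : 'I_n.+1 => mono i (n - i) 1 : R).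
split=> [|r /plane_grP hr]; first by rewrite mul1n expn1.
exists (fun i => tcoef r i (n - i)); apply: tensP => a b.
rewrite (big_morph (fun u : R => tcoef u a b) (fun u v => tcoefD u v a b) (tcoef0 _ a b)).
under eq_bigr => i _ do rewrite tcoefZ1 tcoef_mono.
have [abn|abn] := eqVneq (a + b)%N n; last first.
  rewrite big1 => [|i _]; first by apply/eqP; apply: contraNT abn => /hr ->.
  case: ifP => [/andP[/eqP ia /eqP ib]|_]; last by rewrite mulr0.
  by rewrite -ia -ib subnKC ?eqxx // -ltnS in abn.
have an : (a < n.+1)%N by rewrite ltnS -abn leq_addr.
rewrite (bigD1 (Ordinal an)) //= big1 => [|i ia].
  by rewrite -abn addKn !eqxx mulr1 addr0.
case: ifP => [/andP[/eqP ia' _]|_]; last by rewrite mulr0.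
by case/eqP: ia; apply: val_inj.
Qed.

End PlaneGrading.

(** * Clifford structures on the plane and on the cyclic algebra *)

Section SkewSquares.
Variables (k : fieldType) (B : algType k).
Implicit Types (u w t : B) (a : k).

(** Expanding w (w u) gives a^2 u w^2 plus the obstruction a t w + w t. This obstruction and its
    mirror image in [skew_sqr_l] are the source of the condition lam^3 = -1. *)
Lemma skew_sqr_r u w t a : w * u = a *: (u * w) + t -> a *: (t * w) + w * t = 0 ->
  w ^+ 2 * u = a ^+ 2 *: (u * w ^+ 2).
Proof.
move=> wu tw; rewrite !expr2 -mulrA wu mulrDr -scalerAr [w * (u * w)]mulrA wu mulrDl scalerDr.
by rewrite -addrA tw addr0 -scalerAl scalerA mulrA.
Qed.

Lemma skew_sqr_l u w t a : w * u = a *: (u * w) + t -> a *: (u * t) + t * u = 0 ->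
  w * u ^+ 2 = a ^+ 2 *: (u ^+ 2 * w).
Proof.
move=> wu tu; rewrite !expr2 mulrA wu mulrDl -scalerAl -[u * w * u]mulrA wu mulrDr scalerDr.
by rewrite -addrA tu addr0 -scalerAr scalerA !mulrA.
Qed.

Lemma skew_sqr_inv u w a : a != 0 -> w * u = a *: (u * w) -> u * w = a^-1 *: (w * u).
Proof. by move=> a0 ->; rewrite scalerA mulVf // scale1r. Qed.

End SkewSquares.

Section CyclicMu.
Variables (k : fieldType) (lam : k).
Hypothesis lam_neq0 : lam != 0.

(** Reading each relation of the algebra as x_i x_j + mu_ij x_j x_i = (multiple of a square) forces
    - lam^-1 along the cycle 0, 1, 2, 0 and - lam against it. The size is a parameter, so that the
    plane uses the upper left corner of the same matrix. *)
Definition cyclic_mu n : 'M[k]_n :=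
  \matrix_(i, j) match nat_of_ord i, nat_of_ord j with
                 | 0, 1 | 1, 2 | 2, 0 => - lam^-1
                 | 0, 2 | 1, 0 | 2, 1 => - lam
                 | _, _ => 1
                 end.

Lemma cyclic_mu_skew n : (n <= 3)%N -> skew_parameters (cyclic_mu n).
Proof.
move=> n3; have li (i : 'I_n) := leq_trans (ltn_ord i) n3.
split=> [i|i j]; first by rewrite mxE; case: i (li i) => -[|[|[|i]]].
rewrite !mxE; case: i j (li i) (li j) => -[|[|[|i]]] hi [] -[|[|[|j]]] hj // _ _;
  by rewrite /= ?oppr_eq0 ?invr_eq0 ?oner_neq0 ?lam_neq0 ?mulrNN ?mulVf ?mulfV //; split.
Qed.

End CyclicMu.

Section PlaneClifford.
Variables (k : fieldType) (lam : k).
Hypotheses (two_neq0 : 2%:R != 0 :> k) (lam_neq0 : lam != 0).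
Notation R := (qplane lam).
Notation gens := (@plane_gens k lam).

(** The diagonal relations become 2 x_l^2 = 2 y_l and the others skew commutation without a square
    term. *)
Definition plane_M (l : 'I_2) : 'M[k]_2 := 2%:R *: delta_mx l l.

Lemma plane_M_sum (V : lmodType k) (y : 'I_2 -> V) i j :
  \sum_l plane_M l i j *: y l = if i == j then 2%:R *: y i else 0.
Proof.
rewrite (bigD1 i) //= big1 => [|l /negPf li]; last first.
  by rewrite !mxE eq_sym li mulr0 scale0r.
by rewrite !mxE eqxx eq_sym addr0; case: eqP; rewrite ?mulr1 ?mulr0 ?scale0r.
Qed.

Lemma plane_sqr_comm i j :
  gens i ^+ 2 * gens j = cyclic_mu lam 2 i j ^+ 2 *: (gens j * gens i ^+ 2).
Proof.
have x21 := qx21 lam.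
have x12 := skew_sqr_inv lam_neq0 x21.
have [->|->] := ord2P i; have [->|->] := ord2P j; rewrite mxE ?sqrrN.
- by rewrite expr1n scale1r -exprSr exprS.
- apply: (skew_sqr_r (t := 0)); first by rewrite addr0; exact: x12.
  by rewrite mulr0 mul0r scaler0 addr0.
- apply: (skew_sqr_r (t := 0)); first by rewrite addr0; exact: x21.
  by rewrite mulr0 mul0r scaler0 addr0.
by rewrite expr1n scale1r -exprSr exprS.
Qed.

Lemma plane_square_rel p :
  square_relation (cyclic_mu lam 2) plane_M p -> feval gens p = 0.
Proof.
move=> [i [j ->]]; rewrite feval_clifford plane_M_sum.
have x21 := qx21 lam.
have [->|->] := ord2P i; have [->|->] := ord2P j; rewrite mxE.
- by rewrite eqxx fevalX2 scale1r -expr2 scaler_nat mulr2n subrr.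
- rewrite subr0 scaleNr; apply/eqP; rewrite subr_eq0; apply/eqP.
  exact: (skew_sqr_inv lam_neq0 x21).
- rewrite subr0 scaleNr; apply/eqP; rewrite subr_eq0; apply/eqP.
  exact: x21.
by rewrite eqxx fevalX2 scale1r -expr2 scaler_nat mulr2n subrr.
Qed.

Lemma plane_relation_sub p :
  plane_relation lam p -> ideal_gen (square_relation (cyclic_mu lam 2) plane_M) p.
Proof.
move=> ->; apply: ideal_gen_mem; exists 1, 0.
rewrite plane_M_sum subr0 mxE.
by rewrite (scaleNr (V := freealg k 'I_2)).
Qed.

Lemma plane_clifford : graded_skew_clifford (@plane_gr k lam).
Proof.
split; first exact: plane_graded.
exists 2, (cyclic_mu lam 2), plane_M; split; first exact: cyclic_mu_skew.
  move=> l i j; rewrite !mxE; have [<-|ij] := eqVneq i j.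
    by rewrite andbb; case: i => -[|[|//]] hi; rewrite mul1r.
  have -> : (i == l) && (j == l) = false.
    by apply: contraNF ij => /andP[/eqP-> /eqP->].
  have -> : (j == l) && (i == l) = false.
    by apply: contraNF ij => /andP[/eqP-> /eqP->].
  by rewrite !mulr0.
apply: (sqr_gsca (plane_presented lam) two_neq0 (c := fun i j => cyclic_mu lam 2 i j ^+ 2)).
- move=> l i; rewrite !mxE andbb eq_sym; case: eqP; rewrite ?mulr1 ?mulr0 //.
- exact: (cyclic_mu_skew lam_neq0 (n := 2) isT).1.
- by move=> i j; rewrite expf_neq0 // ((cyclic_mu_skew lam_neq0 (n := 2) isT).2 i j).1.
- exact: plane_sqr_comm.
- exact: plane_square_rel.
- exact: plane_relation_sub.
Qed.

End PlaneClifford.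

(** * The algebra A and the case lam^3 = -1 *)

Section CyclicClifford.
Variables (k : fieldType) (lam : k).
Hypotheses (two_neq0 : 2%:R != 0 :> k) (lam_neq0 : lam != 0).
Variables (A : algType k) (x : 'I_3 -> A) (hA : presented_by x (A_relation lam)).

(** The entries 1 come from x3 x2 - lam x2 x3 = x1^2 and x1 x3 - lam x3 x1 = x2^2; their transposes
    - lam^-1 are then forced by mu-symmetry. *)
Definition cyclic_M (l : 'I_3) : 'M[k]_3 :=
  \matrix_(i, j) match nat_of_ord l, nat_of_ord i, nat_of_ord j with
                 | 0, 0, 0 | 1, 1, 1 | 2, 2, 2 => 2%:R
                 | 0, 2, 1 | 1, 0, 2 => 1
                 | 0, 1, 2 | 1, 2, 0 => - lam^-1
                 | _, _, _ => 0
                 end.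

Lemma ord3P (i : 'I_3) : [\/ i = 0, i = 1 | i = 2%:R].
Proof.
by case: i => -[|[|[|//]]] h; [apply: Or31 | apply: Or32 | apply: Or33]; apply: val_inj.
Qed.

Lemma cyclic_M_sum (V : lmodType k) (y : 'I_3 -> V) i j :
  \sum_l cyclic_M l i j *: y l =
    match nat_of_ord i, nat_of_ord j with
    | 0, 0 => 2%:R *: y 0 | 1, 1 => 2%:R *: y 1 | 2, 2 => 2%:R *: y 2%:R
    | 2, 1 => y 0 | 0, 2 => y 1
    | 1, 2 => - lam^-1 *: y 0 | 2, 0 => - lam^-1 *: y 1
    | _, _ => 0
    end.
Proof.
rewrite !big_ord_recl big_ord0 !mxE.
have -> : lift ord0 ord0 = 1 :> 'I_3 by apply: val_inj.
have -> : lift ord0 (lift ord0 ord0) = 2%:R :> 'I_3 by apply: val_inj.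
case: i j => -[|[|[|//]]] hi [] -[|[|[|//]]] hj /=;
  by rewrite ?scale1r ?scale0r ?addr0 ?add0r.
Qed.

Lemma A_rel i j q : A_relation lam (lam *: (fX k i * fX k j) - q) ->
  lam *: (x i * x j) = feval x q.
Proof.
move=> r; have : feval x (lam *: (fX k i * fX k j) - q) = 0.
  by apply/hA.2/ideal_gen_mem.
rewrite fevalB fevalZ => /eqP; rewrite subr_eq0 => /eqP <-.
by congr (_ *: _); rewrite fevalXX.
Qed.

Lemma feval_XX_X2 a b c : feval x (fX k a * fX k b - fX k c ^+ 2) = x a * x b - x c ^+ 2.
Proof. by rewrite fevalB; congr (_ - _); [apply: fevalXX | apply: fevalX2]. Qed.

Notation x1 := (x 0).
Notation x2 := (x 1).
Notation x3 := (x 2%:R).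

Lemma A_rel21 : x2 * x1 = lam *: (x1 * x2).
Proof.
rewrite -(fevalXX x 1 0) -(@A_rel 0 1 (fX k 1 * fX k 0)) //; exact: Or31.
Qed.

Lemma A_rel32 : x3 * x2 = lam *: (x2 * x3) + x1 ^+ 2.
Proof.
rewrite (@A_rel 1 2%:R (fX k 2%:R * fX k 1 - fX k 0 ^+ 2)); last exact: Or32.
by rewrite feval_XX_X2 subrK.
Qed.

Lemma A_rel31 : x3 * x1 = lam^-1 *: (x1 * x3) - lam^-1 *: x2 ^+ 2.
Proof.
rewrite -scalerBr -feval_XX_X2.
rewrite -(@A_rel 2%:R 0 (fX k 0 * fX k 2%:R - fX k 1 ^+ 2)); last exact: Or33.
by rewrite scalerA mulVf // scale1r.
Qed.

Section CubeMinusOne.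
Hypothesis lam3 : lam ^+ 3 = -1.

(** The two forms in which lam^3 = -1 is used; each is the sum of the two scalars of an obstruction
    term in [skew_sqr_l] or [skew_sqr_r]. *)
Let lamV2 : lam^-1 + lam ^+ 2 = 0.
Proof.
by apply: (mulfI lam_neq0); rewrite mulrDr mulfV // -exprS lam3 subrr mulr0.
Qed.

Let lamV2' : lam + lam^-1 ^+ 2 = 0.
Proof.
apply: (mulfI (expf_neq0 2 lam_neq0)).
by rewrite mulrDr -exprSr lam3 exprVn mulfV ?expf_neq0 // addNr mulr0.
Qed.

Lemma sqr1_x2 : x1 ^+ 2 * x2 = lam^-1 ^+ 2 *: (x2 * x1 ^+ 2).
Proof.
apply: (skew_sqr_r (t := 0)); last by rewrite mulr0 mul0r scaler0 addr0.
by rewrite addr0; exact: (skew_sqr_inv lam_neq0 A_rel21).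
Qed.

Lemma sqr2_x1 : x2 ^+ 2 * x1 = lam ^+ 2 *: (x1 * x2 ^+ 2).
Proof.
apply: (skew_sqr_r (t := 0)); last by rewrite mulr0 mul0r scaler0 addr0.
by rewrite addr0 A_rel21.
Qed.

(** The obstruction involves only x1 and x2^2, whose commutation is already known. Once x3 passes
    x1^2 and x2^2, the same pattern handles x3^2. *)
Lemma x3_sqr1 : x3 * x1 ^+ 2 = lam^-1 ^+ 2 *: (x1 ^+ 2 * x3).
Proof.
apply: (skew_sqr_l A_rel31); rewrite mulrN mulNr -scalerAr -scalerAl sqr2_x1.
by rewrite scalerN -opprD -scalerDr -scalerDl lamV2 scale0r scaler0 oppr0.
Qed.

Lemma x3_sqr2 : x3 * x2 ^+ 2 = lam ^+ 2 *: (x2 ^+ 2 * x3).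
Proof.
apply: (skew_sqr_l A_rel32).
by rewrite sqr1_x2 -scalerDl lamV2' scale0r.
Qed.

Lemma sqr3_x1 : x3 ^+ 2 * x1 = lam^-1 ^+ 2 *: (x1 * x3 ^+ 2).
Proof.
apply: (skew_sqr_r A_rel31); rewrite mulrN mulNr -scalerAr -scalerAl x3_sqr2.
by rewrite scalerN -opprD -scalerDr -scalerDl lamV2 scale0r scaler0 oppr0.
Qed.

Lemma sqr3_x2 : x3 ^+ 2 * x2 = lam ^+ 2 *: (x2 * x3 ^+ 2).
Proof.
apply: (skew_sqr_r A_rel32); rewrite x3_sqr1 -scalerDl lamV2' scale0r //.
Qed.

Lemma A_sqr_comm i j :
  x i ^+ 2 * x j = cyclic_mu lam 3 i j ^+ 2 *: (x j * x i ^+ 2).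
Proof.
have l2 : lam ^+ 2 != 0 by rewrite expf_neq0.
have lV2 : lam^-1 ^+ 2 != 0 by rewrite expf_neq0 ?invr_eq0.
have [->|->|->] := ord3P i; have [->|->|->] := ord3P j; rewrite mxE ?sqrrN.
- by rewrite expr1n scale1r -exprSr exprS.
- exact: sqr1_x2.
- by rewrite [LHS](skew_sqr_inv lV2 x3_sqr1) exprVn invrK.
- exact: sqr2_x1.
- by rewrite expr1n scale1r -exprSr exprS.
- by rewrite [LHS](skew_sqr_inv l2 x3_sqr2) exprVn.
- exact: sqr3_x1.
- exact: sqr3_x2.
by rewrite expr1n scale1r -exprSr exprS.
Qed.

Lemma A_square_rel p :
  square_relation (cyclic_mu lam 3) cyclic_M p -> feval x p = 0.
Proof.
move=> [i [j ->]]; rewrite feval_clifford cyclic_M_sum.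
have rel12 : x1 * x2 = lam^-1 *: (x2 * x1) by rewrite A_rel21 scalerA mulVf // scale1r.
have lK (u : A) : lam *: (lam^-1 *: u) = u by rewrite scalerA mulfV // scale1r.
have Kl (u : A) : lam^-1 *: (lam *: u) = u by rewrite scalerA mulVf // scale1r.
have [->|->|->] := ord3P i; have [->|->|->] := ord3P j; rewrite mxE /= ?fevalX2.
- by rewrite scale1r -expr2 scaler_nat mulr2n subrr.
- by rewrite subr0 scaleNr rel12 subrr.
- by rewrite scaleNr A_rel31 -scalerBr lK subKr subrr.
- by rewrite subr0 scaleNr A_rel21 subrr.
- by rewrite scale1r -expr2 scaler_nat mulr2n subrr.
- by rewrite !scaleNr A_rel32 scalerDr Kl opprD addrA subrr add0r opprK addNr.
- by rewrite !scaleNr A_rel31 opprK addrAC subrK subrr.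
- by rewrite !scaleNr A_rel32 addrAC addrK subrr.
by rewrite scale1r -expr2 scaler_nat mulr2n subrr.
Qed.

End CubeMinusOne.

(** Exhibits a defining relation as a scalar multiple of a Clifford relation; [relation_identity]
    does the same for the relations with a square term, with factor -1. *)
Lemma commutator_identity (B : algType k) (u v : B) :
  lam *: (u * v) - v * u = lam *: (u * v + - lam^-1 *: (v * u) - 0).
Proof. by rewrite subr0 scalerDr scaleNr scalerN scalerA mulfV // scale1r. Qed.

Lemma relation_identity (B : algType k) (u v t : B) :
  lam *: (u * v) - (v * u - t) = - (v * u + - lam *: (u * v) - t).
Proof. by rewrite scaleNr !opprB addrCA. Qed.

Lemma A_relation_sub p :
  A_relation lam p -> ideal_gen (square_relation (cyclic_mu lam 3) cyclic_M) p.
Proof.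
have mem i j : ideal_gen (square_relation (cyclic_mu lam 3) cyclic_M)
    (fX k i * fX k j + cyclic_mu lam 3 i j *: (fX k j * fX k i)
     - \sum_l cyclic_M l i j *: fX k l ^+ 2).
  by apply: ideal_gen_mem; exists i, j.
case=> ->.
- have := ideal_gen_scale lam (mem 0 1); rewrite cyclic_M_sum mxE.
  by rewrite -(commutator_identity (fX k 0 : free_algebra k 'I_3)).
- have := ideal_gen_opp (mem 2%:R 1); rewrite cyclic_M_sum mxE.
  by rewrite -(relation_identity (fX k 1 : free_algebra k 'I_3)).
have := ideal_gen_opp (mem 0 2%:R); rewrite cyclic_M_sum mxE.
by rewrite -(relation_identity (fX k 2%:R : free_algebra k 'I_3)).
Qed.

Lemma A_relation_homogeneous p : A_relation lam p -> homogeneous (fun=> 1%N) 2 p.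
Proof.
by case=> ->; do ![apply: homogeneousB | apply: homogeneousZ | apply: homogeneous_XX].
Qed.

Lemma A_graded : graded_algebra (gen_grading x (fun=> 1%N)).
Proof.
apply: (gen_grading_graded hA) => p /A_relation_homogeneous.
by exists 2.
Qed.

Lemma A_clifford : lam ^+ 3 = -1 -> graded_skew_clifford (gen_grading x (fun=> 1%N)).
Proof.
move=> lam3; split; first exact: A_graded.
have mu_skew := cyclic_mu_skew lam_neq0 (n := 3) isT.
exists 3, (cyclic_mu lam 3), cyclic_M; split; first exact: mu_skew.
  move=> l i j; rewrite !mxE.
  case: l i j => -[|[|[|//]]] hl [] -[|[|[|//]]] hi [] -[|[|[|//]]] hj /=;
    by rewrite ?mul1r ?mulr0 ?mulrNN ?mulfV ?mulVf ?mulr1.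
apply: (sqr_gsca hA two_neq0 (c := fun i j => cyclic_mu lam 3 i j ^+ 2)).
- by move=> l i; rewrite !mxE; case: l i => -[|[|[|//]]] hl [] -[|[|[|//]]] hi.
- exact: mu_skew.1.
- by move=> i j; rewrite expf_neq0 // (mu_skew.2 i j).1.
- exact: A_sqr_comm.
- exact: A_square_rel.
- exact: A_relation_sub.
Qed.

End CyclicClifford.

(** * The Ore extension *)

Section LeftMultiplication.
Variables (k : fieldType) (B : algType k).

Definition lmulA (a b : B) : B := a * b.
Fact lmulA_linear a : linear (lmulA a).
Proof. by move=> c u v; rewrite /lmulA mulrDr scalerAr. Qed.
HB.instance Definition _ a := GRing.isLinear.Build k B B *:%R (lmulA a) (lmulA_linear a).

End LeftMultiplication.

(* The morphism [x1 |-> u], [x2 |-> v] out of the quantum plane. *)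
Definition qmorph (k : fieldType) (lam : k) (B : algType k) (u v : B)
    (uv : v * u = lam *: (u * v)) (r : qplane lam) : B :=
  qact (lmulA u) (lmulA v) r 1.

Section PlaneMorphisms.
Variables (k : fieldType) (lam : k) (B : algType k) (u v : B).
Variable (uv : v * u = lam *: (u * v)).
Notation R := (qplane lam).
Implicit Types (r s : R).

Let X12 b : lmulA v (lmulA u b) = lam *: lmulA u (lmulA v b).
Proof. by rewrite /lmulA !mulrA uv -scalerAl. Qed.

(** The action through left multiplications commutes with right multiplications, so it is determined
    by its value at 1; this makes [qmorph] multiplicative. *)
Lemma qact_lmulA r b : qact (lmulA u) (lmulA v) r b = qmorph uv r * b.
Proof.
rewrite /qmorph; pattern r; apply: (plane_ind (lam := lam)) => [s t Hs Ht|c s Hs||s Hs|s Hs].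
- by rewrite !qactD Hs Ht mulrDl.
- by rewrite !qactZ Hs scalerAl.
- by rewrite !qact_one mul1r.
- by rewrite !qact_lmul1 Hs; apply: mulrA.
- by rewrite !(qact_lmul2 X12) Hs; apply: mulrA.
Qed.

Fact qmorph_linear : linear (qmorph uv).
Proof. exact: qact_linear. Qed.
HB.instance Definition _ := GRing.isLinear.Build k R B *:%R (qmorph uv) qmorph_linear.

Fact qmorph_multiplicative : monoid_morphism (qmorph uv).
Proof.
split=> [|r s]; first exact: qact_one.
by rewrite {1}/qmorph (qact_qmul _ _ _ X12) qact_lmulA.
Qed.
HB.instance Definition _ := GRing.isMonoidMorphism.Build R B (qmorph uv) qmorph_multiplicative.

Lemma qmorph_x1 : qmorph uv (qx1 lam) = u.
Proof. by rewrite /qmorph qact_mono scale1r /= /lmulA mulr1. Qed.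
Lemma qmorph_x2 : qmorph uv (qx2 lam) = v.
Proof. by rewrite /qmorph qact_mono scale1r /= /lmulA mulr1. Qed.

Lemma qmorph_grading (I : choiceType) (g : I -> B) (w : I -> nat) :
    gen_grading g w 1 u -> gen_grading g w 1 v ->
  forall n r, plane_gr n r -> gen_grading g w n (qmorph uv r).
Proof.
move=> gu gv; apply: gen_grading_ind => [n|n r s Hr Hs|n c r Hr||i n r Hr].
- by rewrite linear0; apply: gen_grading0.
- by rewrite linearD; apply: gen_gradingD.
- by rewrite linearZ; apply: gen_gradingZ.
- by rewrite rmorph1; apply: gen_grading1.
rewrite rmorphM; apply: gen_gradingM => //.
have [->|->] := ord2P i; first by rewrite [X in gen_grading _ _ _ X]qmorph_x1.
by rewrite [X in gen_grading _ _ _ X]qmorph_x2.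
Qed.

End PlaneMorphisms.

(** The second coordinate of D2 D1 = lam D1 D2 for triangular operators. The hypothesis on [d1] and
    [d2] says that the skew derivation respects the relation x2 x1 = lam x1 x2. *)
Lemma twisted_leibniz (k : fieldType) (B : algType k) (c : k) (a1 a2 d1 d2 u1 u2 s t : B) :
    a2 * a1 = c *: (a1 * a2) -> a2 * d1 + d2 * u1 = c *: (a1 * d2 + d1 * u2) ->
  a2 * (a1 * t + d1 * s) + d2 * (u1 * s) = c *: (a1 * (a2 * t + d2 * s) + d1 * (u2 * s)).
Proof.
move=> e1 e2; rewrite !mulrDr !mulrA e1 -addrA -mulrDl e2.
by rewrite -!scalerAl -scalerDr -addrA -mulrDl.
Qed.

(** * The automorphism and the skew derivation of the plane *)

Section PlaneDerivation.
Variables (k : fieldType) (lam : k).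
Hypothesis lam_neq0 : lam != 0.
Notation R := (qplane lam).
Notation x1 := (qx1 lam).
Notation x2 := (qx2 lam).
Implicit Types (r s t : R).

(** Rescaling the two generators preserves the relation, so each pair of scalars defines an
    endomorphism; inverse pairs give [plane_phi] and [plane_psi]. *)
Lemma plane_scale_comm (a b : k) : (b *: x2) * (a *: x1) = lam *: ((a *: x1) * (b *: x2)).
Proof.
rewrite -!scalerAl -!scalerAr qx21 !scalerA.
by congr (_ *: _); rewrite mulrC mulrA mulrAC.
Qed.

Definition plane_phi : R -> R := qmorph (plane_scale_comm lam^-1 lam).
Definition plane_psi : R -> R := qmorph (plane_scale_comm lam lam^-1).
HB.instance Definition _ := GRing.LRMorphism.on plane_phi.
HB.instance Definition _ := GRing.LRMorphism.on plane_psi.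

Lemma phi_x1 : plane_phi x1 = lam^-1 *: x1. Proof. exact: qmorph_x1. Qed.
Lemma phi_x2 : plane_phi x2 = lam *: x2. Proof. exact: qmorph_x2. Qed.
Lemma psi_x1 : plane_psi x1 = lam *: x1. Proof. exact: qmorph_x1. Qed.
Lemma psi_x2 : plane_psi x2 = lam^-1 *: x2. Proof. exact: qmorph_x2. Qed.

Lemma phi_psi : cancel plane_phi plane_psi.
Proof.
move=> r; pattern r; apply: qplane_ind => [s t Hs Ht|c s Hs||s Hs|s Hs].
- by rewrite !linearD /= Hs Ht.
- by rewrite !linearZ /= Hs.
- by rewrite !rmorph1.
- by rewrite rmorphM /= phi_x1 rmorphM /= linearZ /= psi_x1 Hs scalerA mulVf // scale1r.
- by rewrite rmorphM /= phi_x2 rmorphM /= linearZ /= psi_x2 Hs scalerA mulfV // scale1r.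
Qed.

Lemma psi_phi : cancel plane_psi plane_phi.
Proof.
move=> r; pattern r; apply: qplane_ind => [s t Hs Ht|c s Hs||s Hs|s Hs].
- by rewrite !linearD /= Hs Ht.
- by rewrite !linearZ /= Hs.
- by rewrite !rmorph1.
- by rewrite rmorphM /= psi_x1 rmorphM /= linearZ /= phi_x1 Hs scalerA mulfV // scale1r.
- by rewrite rmorphM /= psi_x2 rmorphM /= linearZ /= phi_x2 Hs scalerA mulVf // scale1r.
Qed.

Lemma plane_gr_x1 : plane_gr 1 x1.
Proof. exact: (gen_gradingX (fun=> 1%N) (plane_gens lam) 0). Qed.
Lemma plane_gr_x2 : plane_gr 1 x2.
Proof. exact: (gen_gradingX (fun=> 1%N) (plane_gens lam) 1). Qed.

Lemma phi_gr n r : plane_gr n r <-> plane_gr n (plane_phi r).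
Proof.
have gZ1 a : plane_gr 1 (a *: x1) by apply: gen_gradingZ; apply: plane_gr_x1.
have gZ2 a : plane_gr 1 (a *: x2) by apply: gen_gradingZ; apply: plane_gr_x2.
split; first by apply: qmorph_grading; [apply: gZ1 | apply: gZ2].
by rewrite -{2}[r]phi_psi; apply: qmorph_grading; [apply: gZ1 | apply: gZ2].
Qed.

(* The operator of [a] on [R (+) R] is [(s, t) |-> (a s, phi(a) t + delta(a) s)],
   whose multiplicativity is the twisted Leibniz rule. *)
Definition skew_op (a d : R) (p : (R * R)%type) : (R * R)%type :=
  (a * p.1, plane_phi a * p.2 + d * p.1).
Fact skew_op_linear a d : linear (skew_op a d).
Proof.
move=> c [u1 u2] [v1 v2]; rewrite /skew_op /=.
congr (_, _); rewrite /= !mulrDr -!scalerAr //.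
by rewrite scalerDr addrACA.
Qed.
HB.instance Definition _ a d :=
  GRing.isLinear.Build k (R * R)%type (R * R)%type *:%R (skew_op a d) (skew_op_linear a d).

Definition delta_x1 : R := - lam^-1 *: x2 ^+ 2.
Definition delta_x2 : R := x1 ^+ 2.
Notation D1 := (skew_op x1 delta_x1).
Notation D2 := (skew_op x2 delta_x2).

Lemma skew_op12 p : D2 (D1 p) = lam *: D1 (D2 p).
Proof.
case: p => u v; rewrite /skew_op /= phi_x1 phi_x2.
congr (_, _); first by rewrite !mulrA qx21 -scalerAl.
apply: twisted_leibniz; first exact: plane_scale_comm.
(* Both sides equal x1^3 - x2^3. *)
rewrite /delta_x1 /delta_x2 -!scalerAl -!scalerAr scalerA mulrN mulfV // scaleN1r.
by rewrite scalerDr !scalerA mulrN mulfV // scale1r scaleN1r addrC -!exprSr -!exprS.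
Qed.

(** The off-diagonal entry of the triangular operator of [r], read off at the vector (1, 0). *)
Definition plane_delta r : R := (qact D1 D2 r (1, 0)).2.

Fact plane_delta_linear : linear plane_delta.
Proof. by move=> c r s; rewrite /plane_delta qact_linear. Qed.
HB.instance Definition _ := GRing.isLinear.Build k R R *:%R plane_delta plane_delta_linear.

Lemma skew_qact r s t :
  qact D1 D2 r (s, t) = (r * s, plane_phi r * t + plane_delta r * s).
Proof.
(* The first coordinate at (1, 0) is carried along because [plane_delta] of x1 r or x2 r involves
   it. *)
suff [e1 [e2 ->]] : (qact D1 D2 r (1, 0)).1 = r /\ True /\
    qact D1 D2 r (s, t) = (r * s, plane_phi r * t + plane_delta r * s) by [].
rewrite /plane_delta; pattern r.
apply: (plane_ind (lam := lam)) =>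
  [a b [Ha [_ Ea]] [Hb [_ Eb]]|c a [Ha [_ Ea]]||a [Ha [_ Ea]]|a [Ha [_ Ea]]].
- rewrite !qactD /= Ha Hb Ea Eb; do !split; congr (_, _); rewrite /= mulrDl //.
  by rewrite linearD !mulrDl addrACA.
- rewrite !qactZ /= Ha Ea; do !split; congr (_, _); rewrite /= -?scalerAl //.
  by rewrite linearZ -!scalerAl scalerDr.
- by rewrite !qact_one; do !split; rewrite [plane_phi _]rmorph1 mul0r addr0 !mul1r.
- rewrite !qact_lmul1 Ea /= Ha -!(@qx1M k lam).
  do !split; congr (_, _); rewrite /= ?mulrA //.
  by rewrite rmorphM mulrDr mulrDl !mulrA addrA.
- rewrite !(qact_lmul2 skew_op12) Ea /= Ha -!(@qx2M k lam).
  do !split; congr (_, _); rewrite /= ?mulrA //.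
  by rewrite rmorphM mulrDr mulrDl !mulrA addrA.
Qed.

(** [s] sends (1, 0) to (s, delta(s)); the second coordinate after the action of [r] is the rule. *)
Lemma plane_deltaM r s : plane_delta (r * s) = plane_phi r * plane_delta s + plane_delta r * s.
Proof.
rewrite {1}/plane_delta (qact_qmul _ _ _ skew_op12).
have s1 : (qact D1 D2 s (1, 0)).1 = s by rewrite skew_qact /= mulr1.
by rewrite [qact _ _ s _]surjective_pairing skew_qact /= s1.
Qed.

Lemma plane_delta1 : plane_delta 1 = 0.
Proof. by rewrite /plane_delta qact_one. Qed.

Lemma delta_x1E : plane_delta x1 = delta_x1.
Proof.
by rewrite /plane_delta qact_mono scale1r /= mulr0 add0r mulr1.
Qed.

Lemma delta_x2E : plane_delta x2 = delta_x2.
Proof.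
by rewrite /plane_delta qact_mono scale1r /= mulr0 add0r mulr1.
Qed.

Lemma delta_gr n r : plane_gr n r -> plane_gr n.+1 (plane_delta r).
Proof.
(* The degree of [r] itself is needed for the term delta(g) r of delta(g r). *)
move=> gr; suff : plane_gr n r /\ plane_gr n.+1 (plane_delta r) by case.
have grX2 u : plane_gr 1 u -> plane_gr 2 (u ^+ 2).
  by move=> gu; rewrite expr2; apply: (gen_gradingM gu gu).
move: n r gr; apply: gen_grading_ind => [n|n r s [hr dr] [hs ds]|n c r [hr dr]||i n r [hr dr]].
- by rewrite linear0; split; apply: gen_grading0.
- by rewrite linearD; split; apply: gen_gradingD.
- by rewrite linearZ; split; apply: gen_gradingZ.
- by rewrite plane_delta1; split; [apply: gen_grading1 | apply: gen_grading0].
split; first by apply: gen_gradingM => //; apply: (gen_gradingX (fun=> 1%N)).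
rewrite plane_deltaM; apply: gen_gradingD.
  apply: (gen_gradingM (i := 1)) => //; apply: (phi_gr 1 (plane_gens lam i)).1.
  exact: (gen_gradingX (fun=> 1%N) (plane_gens lam)).
apply: (gen_gradingM (i := 2)) => //; have [->|->] := ord2P i.
  rewrite [plane_delta _]delta_x1E; apply/gen_gradingZ/grX2; exact: plane_gr_x2.
by rewrite [plane_delta _]delta_x2E; apply/grX2; exact: plane_gr_x1.
Qed.

End PlaneDerivation.

(** The module seen as a vector space, [c] acting through [c%:A]; a separate carrier name keeps the
    two module structures apart. *)
Definition krestr (k : fieldType) (B : algType k) (M : lmodType B) : Type := M.

Section Restriction.
Variables (k : fieldType) (B : algType k) (M : lmodType B).
Notation V := (krestr M).

HB.instance Definition _ := GRing.Zmodule.on V.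

Definition krestr_scale (c : k) (m : V) : V := (c%:A : B) *: (m : M).

Fact krestr_scaleA c d m : krestr_scale c (krestr_scale d m) = krestr_scale (c * d) m.
Proof. by rewrite /krestr_scale scalerA -scalerAl mul1r scalerA. Qed.
Fact krestr_scale1 : left_id 1 krestr_scale.
Proof. by move=> m; rewrite /krestr_scale !scale1r. Qed.
Fact krestr_scaleDr : right_distributive krestr_scale +%R.
Proof. by move=> c m n; rewrite /krestr_scale scalerDr. Qed.
Fact krestr_scaleDl m : {morph krestr_scale^~ m : c d / c + d}.
Proof. by move=> c d; rewrite /krestr_scale !scalerDl. Qed.

HB.instance Definition _ := GRing.Zmodule_isLmodule.Build k V
  krestr_scaleA krestr_scale1 krestr_scaleDr krestr_scaleDl.

Lemma krestrE (c : k) (m : V) : c *: m = (c%:A : B) *: (m : M) :> M.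
Proof. by []. Qed.

Definition krestr_op (b : B) (m : V) : V := b *: (m : M).
Fact krestr_op_linear b : linear (krestr_op b).
Proof.
move=> c u v; rewrite /krestr_op scalerDr; congr (_ + _).
by rewrite !krestrE !scalerA mulr_algl mulr_algr.
Qed.
HB.instance Definition _ b :=
  GRing.isLinear.Build k V V *:%R (krestr_op b) (krestr_op_linear b).

End Restriction.

Section FreeAction.
Variables (k : fieldType) (I : choiceType) (V : lmodType k) (op : I -> {linear V -> V}).
Notation F := (freealg k I).
Implicit Types (p q : F) (v : V).

Definition word_act (m : {fmonom I}) v : V := foldr (fun i u => op i u) v m.

Definition free_act p v : V :=
  mlift (fun (m : {fmonom I}) (c : k) => c *: word_act m v) p.

Lemma free_act0 v : free_act 0 v = 0. Proof. exact: mlift0. Qed.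

Lemma free_actD p q v : free_act (p + q) v = free_act p v + free_act q v.
Proof. by apply: mliftD => m c d; rewrite scalerDl. Qed.

Lemma free_actU (c : k) m v : free_act << c *g m >> v = c *: word_act m v.
Proof. by apply: mliftU => n a b; rewrite scalerDl. Qed.

Lemma free_actZ c p v : free_act (c *: p) v = c *: free_act p v.
Proof.
rewrite /free_act (mliftEw _ (msuppZ_le c p)) => [|m a b]; last by rewrite scalerDl.
by rewrite mliftE scaler_sumr; apply: eq_bigr => m _; rewrite mcoeffZ scalerA.
Qed.

Lemma free_act1 v : free_act 1 v = v.
Proof. by rewrite free_actU /word_act fm1 scale1r. Qed.

Lemma free_actXM i p v : free_act (fX k i * p) v = op i (free_act p v).
Proof.
pattern p; apply: malg_lin_ind => [|q r Hq Hr|d m].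
- by rewrite mulr0 free_act0 linear0.
- rewrite [fX k i * (q + r)]mulrDr [LHS]free_actD [in RHS]free_actD linearD.
  by congr (_ + _); [exact: Hq | exact: Hr].
rewrite -freealg_scalerAr [LHS]free_actZ [in RHS]free_actZ linearZ; congr (_ *: _).
by rewrite freealg_mulU [LHS]free_actU [in RHS]free_actU /word_act fmM fmU !scale1r.
Qed.

Lemma free_actX i v : free_act (fX k i) v = op i v.
Proof. by rewrite -[in RHS](free_act1 v) -free_actXM mulr1. Qed.

Lemma free_actXX i j v : free_act (fX k i * fX k j) v = op i (op j v).
Proof. by rewrite free_actXM free_actX. Qed.

Lemma free_actB p q v : free_act (p - q) v = free_act p v - free_act q v.
Proof. by rewrite free_actD -[- q]scaleN1r free_actZ scaleN1r. Qed.

Lemma free_actM p q v : free_act (p * q) v = free_act p (free_act q v).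
Proof.
pattern p; apply: freealg_ind => [|r s Hr Hs|c r Hr||i r Hr].
- by rewrite mul0r !free_act0.
- rewrite [(r + s) * q]mulrDl [LHS]free_actD [in RHS]free_actD.
  by congr (_ + _); [exact: Hr | exact: Hs].
- by rewrite -scalerAl [LHS]free_actZ Hr [in RHS]free_actZ.
- by rewrite mul1r free_act1.
rewrite -mulrA [LHS]free_actXM [in RHS]free_actXM; congr (op i _); exact: Hr.
Qed.

Lemma free_actr0 p : free_act p 0 = 0.
Proof.
pattern p; apply: freealg_ind => [|r s Hr Hs|c r Hr||i r Hr].
- by rewrite free_act0.
- by rewrite free_actD Hr Hs addr0.
- by rewrite free_actZ Hr scaler0.
- by rewrite free_act1.
by rewrite free_actXM Hr linear0.
Qed.

(** Lets an action of the free algebra descend to a quotient: only the relations have to be checked,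
    as operator identities. *)
Lemma free_act_ideal (S : F -> Prop) :
    (forall s, S s -> forall v, free_act s v = 0) ->
  forall p, ideal_gen S p -> forall v, free_act p v = 0.
Proof.
move=> S0 p; elim=> [|a s b t Ss _ IH] v; first exact: free_act0.
by rewrite free_actD IH addr0 !free_actM (S0 s Ss) free_actr0.
Qed.

End FreeAction.

Section SkewShift.
Variables (k : fieldType) (lam : k).
Hypothesis lam_neq0 : lam != 0.
Notation R := (qplane lam).
Notation phi := (@plane_phi k lam).
Notation delta := (@plane_delta k lam).
Notation V := (krestr ({poly R} : lmodType R)).

(* Left multiplication by [z] on the polynomials [\sum_i r_i z^i]. *)
Definition skew_shift (p : {poly R}) : {poly R} :=
  map_poly phi p * 'X + map_poly delta p.

Lemma coef_skew_shift (p : {poly R}) i :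
  (skew_shift p)`_i = (if i is j.+1 then phi p`_j else 0) + delta p`_i.
Proof.
rewrite coefD coefMX !coef_map_id0 ?linear0 //; by case: i.
Qed.

Lemma skew_shiftD (p q : {poly R}) : skew_shift (p + q) = skew_shift p + skew_shift q.
Proof.
apply/polyP => i; rewrite coef_skew_shift [RHS]coefD 2!coef_skew_shift coefD linearD addrACA.
by case: i => [|i]; rewrite ?coefD ?linearD ?addr0.
Qed.

(** The rule z r = phi(r) z + delta(r) for operators on polynomials; it rests on the twisted Leibniz
    rule. *)
Lemma skew_shiftZ r (p : {poly R}) :
  skew_shift (r *: p) = phi r *: skew_shift p + delta r *: p.
Proof.
apply/polyP => i; rewrite coef_skew_shift [RHS]coefD 2!coefZ coef_skew_shift coefZ.
rewrite plane_deltaM // mulrDr.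
by case: i => [|i]; rewrite ?mulr0 -?addrA ?coefZ ?rmorphM.
Qed.

Definition skew_shift_op (p : V) : V := skew_shift p.
Fact skew_shift_linear : linear skew_shift_op.
Proof.
move=> c u v; rewrite [LHS]skew_shiftD !krestrE skew_shiftZ.
by rewrite !linearZ /= plane_delta1 scaler0 scale0r addr0 rmorph1.
Qed.
HB.instance Definition _ :=
  GRing.isLinear.Build k V V *:%R skew_shift_op skew_shift_linear.

(** As phi(1) = 1 and delta(1) = 0, each shift raises the exponent by one. Acting on 1 therefore
    recovers the coefficients of a polynomial in z. *)
Lemma skew_shiftX n : iter n skew_shift 1 = 'X^n.
Proof.
elim: n => [|n IH] //=; rewrite IH; apply/polyP => i.
rewrite coef_skew_shift !coefXn; case: i => [|i].
  by rewrite add0r; case: eqP => _; rewrite ?plane_delta1 ?linear0.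
rewrite coefXn eqSS; have -> : delta (i.+1 == n)%:R = 0.
  by case: eqP => _; rewrite ?plane_delta1 ?linear0.
by rewrite addr0 rmorph_nat.
Qed.

Definition ore_op (i : 'I_3) : {linear V -> V} :=
  match nat_of_ord i with
  | 0 => krestr_op (M := {poly R}) (qx1 lam)
  | 1 => krestr_op (M := {poly R}) (qx2 lam)
  | _ => skew_shift_op
  end.

Lemma ore_op_relation p : A_relation lam p -> forall v, free_act ore_op p v = 0.
Proof.
have quad c i j q v : free_act ore_op (c *: (fX k i * fX k j) - q) v =
    c *: ore_op i (ore_op j v) - free_act ore_op q v.
  by rewrite free_actB free_actZ free_actXX.
have quad' i j l v : free_act ore_op (fX k i * fX k j - fX k l ^+ 2) v =
    ore_op i (ore_op j v) - ore_op l (ore_op l v).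
  rewrite free_actB; congr (_ - _); first exact: free_actXX.
  by rewrite expr2; exact: free_actXX.
case=> -> v; rewrite quad ?quad' ?free_actXX; apply/eqP; rewrite subr_eq0; apply/eqP.
- rewrite krestrE -[LHS]/(lam%:A *: (qx1 lam *: (qx2 lam *: (v : {poly R})))).
  rewrite -[RHS]/(qx2 lam *: (qx1 lam *: (v : {poly R}))) !scalerA.
  by rewrite mulr_algl qx21.
- rewrite krestrE -[LHS]/(lam%:A *: (qx2 lam *: skew_shift v)).
  rewrite -[RHS]/(skew_shift (qx2 lam *: (v : {poly R}))
    - qx1 lam *: (qx1 lam *: (v : {poly R}))).
  by rewrite skew_shiftZ phi_x2 delta_x2E scalerA -expr2 addrK scalerA mulr_algl.
rewrite krestrE -[LHS]/(lam%:A *: skew_shift (qx1 lam *: (v : {poly R}))).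
rewrite -[RHS]/(qx1 lam *: skew_shift v - qx2 lam *: (qx2 lam *: (v : {poly R}))).
rewrite skew_shiftZ phi_x1 delta_x1E scalerDr !scalerA !mulr_algl !scalerA mulfV //.
by rewrite mulrN mulfV // scaleN1r scale1r scaleNr.
Qed.

End SkewShift.

Section OreExtension.
Variables (k : fieldType) (lam : k).
Hypothesis lam_neq0 : lam != 0.
Variables (A : algType k) (x : 'I_3 -> A) (hA : presented_by x (A_relation lam)).
Notation R := (qplane lam).
Notation phi := (@plane_phi k lam).
Notation delta := (@plane_delta k lam).
Notation x1 := (qx1 lam).
Notation x2 := (qx2 lam).
Notation z := (x 2%:R).
Implicit Types (r s : R) (p q : {poly R}).

Definition ore_iota : R -> A := qmorph (A_rel21 hA).
HB.instance Definition _ := GRing.LRMorphism.on ore_iota.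
Notation iota := ore_iota.

Lemma iota_x1 : iota x1 = x 0. Proof. exact: qmorph_x1. Qed.
Lemma iota_x2 : iota x2 = x 1. Proof. exact: qmorph_x2. Qed.

Lemma ore_commutation r : z * iota r = iota (phi r) * z + iota (delta r).
Proof.
(* The rule is stable under products, so the two generators decide. *)
have step u : z * iota u = iota (phi u) * z + iota (delta u) -> forall s,
    z * iota s = iota (phi s) * z + iota (delta s) ->
    z * iota (u * s) = iota (phi (u * s)) * z + iota (delta (u * s)).
  move=> hu s hs; rewrite plane_deltaM // 2!rmorphM /= mulrA hu mulrDl -mulrA hs.
  by rewrite mulrDr linearD !rmorphM !mulrA addrA.
pattern r; apply: qplane_ind => [s t hs ht|c s hs||s|s].
- by rewrite !linearD /= mulrDr hs ht mulrDl addrACA.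
- by rewrite !linearZ /= -scalerAr hs scalerDr -scalerAl.
- by rewrite plane_delta1 linear0 !rmorph1 mulr1 mul1r addr0.
- apply: step; rewrite phi_x1 delta_x1E linearZ /= iota_x1 (A_rel31 lam_neq0 hA).
  by rewrite [iota (_ *: _)]linearZ /= rmorphXn /= iota_x2 -scalerAl scaleNr.
apply: step; rewrite phi_x2 delta_x2E linearZ /= iota_x2 (A_rel32 hA).
by rewrite /delta_x2 rmorphXn /= iota_x1 -scalerAl.
Qed.

Definition ore_eval p : A := \sum_(i < size p) iota p`_i * z ^+ i.

Lemma ore_evalE p : ore_eval p = (map_poly iota p).[z].
Proof.
rewrite (@horner_coef_wide _ (size p)) ?size_poly //.
by apply: eq_bigr => i _; rewrite coef_map.
Qed.

Lemma ore_evalD p q : ore_eval (p + q) = ore_eval p + ore_eval q.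
Proof. by rewrite !ore_evalE rmorphD hornerD. Qed.
Lemma ore_evalZ r p : ore_eval (r *: p) = iota r * ore_eval p.
Proof. by rewrite !ore_evalE linearZ hornerZ. Qed.
Lemma ore_evalMX p : ore_eval (p * 'X) = ore_eval p * z.
Proof. by rewrite !ore_evalE rmorphM /= map_polyX hornerMX. Qed.
Lemma ore_evalC r : ore_eval r%:P = iota r.
Proof. by rewrite ore_evalE map_polyC hornerC. Qed.

Lemma ore_eval_surj a : exists p, a = ore_eval p.
Proof.
(* The set of values is stable under left multiplication by z, because the commutation rule carries
   z past each coefficient. *)
have shift p : exists q, z * ore_eval p = ore_eval q.
  elim/poly_ind: p => [|p r [q IH]].
    by exists 0; rewrite /ore_eval size_poly0 !big_ord0 mulr0.
  exists (q * 'X + ((phi r)%:P * 'X + (delta r)%:P)).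
  rewrite !ore_evalD !ore_evalMX !ore_evalC mulrDr mulrA IH.
  by rewrite ore_commutation.
pattern a; apply: (presented_ind hA) => [b c [p ->] [q ->]|c b [p ->]||i b [p ->]].
- by exists (p + q); rewrite ore_evalD.
- by exists (c%:A *: p); rewrite ore_evalZ linearZ /= rmorph1 mulr_algl.
- by exists 1%:P; rewrite ore_evalC rmorph1.
have [->|->|->] := ord3P i.
- by exists (x1 *: p); rewrite ore_evalZ iota_x1.
- by exists (x2 *: p); rewrite ore_evalZ iota_x2.
exact: shift.
Qed.

Notation V := (krestr ({poly R} : lmodType R)).

(** The action of A on polynomials over R, given as a relation between elements and operators
    through some lift to the free algebra; independence of the lift is [represents_fun]. *)
Definition represents (a : A) (T : V -> V) : Prop :=
  exists2 P, feval x P = a & forall v, free_act (ore_op lam_neq0) P v = T v.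

Lemma represents_fun a T T' : represents a T -> represents a T' -> T =1 T'.
Proof.
move=> [P Pa PT] [Q Qa QT] v; apply/eqP; rewrite -PT -QT -subr_eq0 -free_actB.
apply/eqP; apply: (free_act_ideal (S := A_relation lam)).
  by move=> s /ore_op_relation; apply.
by apply/hA.2; rewrite fevalB Pa Qa subrr.
Qed.

Lemma representsX i : represents (x i) (ore_op lam_neq0 i).
Proof. by exists (fX k i); [apply: fevalX | apply: free_actX]. Qed.

Lemma represents1 : represents 1 id.
Proof. by exists 1; [apply: feval1 | apply: free_act1]. Qed.

Lemma represents0 : represents 0 (fun=> 0).
Proof. by exists 0; [apply: feval0 | apply: free_act0]. Qed.

Lemma representsD a b T U :
  represents a T -> represents b U -> represents (a + b) (fun v => T v + U v).
Proof.
by move=> [P <- PT] [Q <- QT]; exists (P + Q) => [|v]; rewrite ?fevalD ?free_actD ?PT ?QT.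
Qed.

Lemma representsZ c a T : represents a T -> represents (c *: a) (fun v => c *: T v).
Proof. by move=> [P <- PT]; exists (c *: P) => [|v]; rewrite ?fevalZ ?free_actZ ?PT. Qed.

Lemma representsM a b T U :
  represents a T -> represents b U -> represents (a * b) (T \o U).
Proof.
by move=> [P <- PT] [Q <- QT]; exists (P * Q) => [|v]; rewrite ?fevalM ?free_actM ?PT ?QT.
Qed.

Lemma represents_eq a T T' : T =1 T' -> represents a T -> represents a T'.
Proof. by move=> TT' [P Pa PT]; exists P => // v; rewrite PT TT'. Qed.

Lemma represents_iota r : represents (iota r) (fun p : {poly R} => r *: p).
Proof.
pattern r; apply: qplane_ind => [s t hs ht|c s hs||s hs|s hs].
- rewrite linearD; apply: represents_eq (representsD hs ht) => v.
  by rewrite scalerDl.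
- rewrite linearZ; apply: represents_eq (representsZ c hs) => v.
  by rewrite krestrE scalerA mulr_algl.
- by rewrite rmorph1; apply: represents_eq represents1 => v; rewrite scale1r.
- rewrite rmorphM /= iota_x1; apply: represents_eq (representsM (representsX 0) hs) => v.
  by rewrite -scalerA.
rewrite rmorphM /= iota_x2; apply: represents_eq (representsM (representsX 1) hs) => v.
by rewrite -scalerA.
Qed.

Lemma represents_ore_eval p : represents (ore_eval p)
  (fun v => \sum_(i < size p) p`_i *: (iter i (@skew_shift k lam) v : {poly R})).
Proof.
rewrite /ore_eval; elim: (size p) => [|n IH].
  by rewrite big_ord0; apply: represents_eq represents0 => v; rewrite big_ord0.
rewrite big_ord_recr /=.
apply: represents_eq (representsD IH (representsM (represents_iota p`_n) _)).
  by move=> v; rewrite big_ord_recr.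
elim: n {IH} => [|n IH]; first exact: represents1.
by rewrite exprS; apply: represents_eq (representsM (representsX 2%:R) IH) => v.
Qed.

Lemma ore_eval_inj : injective ore_eval.
Proof.
(* Equal elements act equally on 1, and [ore_eval p] sends 1 to [p]. *)
move=> p q pq; have := represents_fun (represents_ore_eval p) (T' := _).
rewrite pq => /(_ _ (represents_ore_eval q) 1).
under eq_bigr => i _ do rewrite skew_shiftX.
under [in X in _ = X -> _]eq_bigr => i _ do rewrite skew_shiftX.
by rewrite -!poly_def !coefK.
Qed.

Lemma A_ore_extension :
  ore_extension (@plane_gr k lam) (gen_grading x (fun=> 1%N)).
Proof.
exists iota, phi, delta, z; split.
- split.
  + exact: (plane_graded lam).
  + exact: (A_graded hA).
  + exact: (gen_gradingX (fun=> 1%N) x 2%:R).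
  apply: qmorph_grading; first exact: (gen_gradingX (fun=> 1%N) x 0).
  exact: (gen_gradingX (fun=> 1%N) x 1).
- split; first by exists (@plane_psi k lam); [exact: phi_psi | exact: psi_phi].
  exact: phi_gr.
- by split; [exact: delta_gr | move=> a b; apply: plane_deltaM].
- exact: ore_commutation.
move=> a; have [p ap] := ore_eval_surj a; exists p; split=> // q aq.
by apply: ore_eval_inj; rewrite -[ore_eval p]ap -[ore_eval q]aq.
Qed.

End OreExtension.

(** * The Koszul resolution *)

Section VectorSpaceSection.
Variables (k : fieldType) (X Y : lmodType k) (g : {linear X -> Y}).
Hypothesis g_surj : forall y, exists x, g x = y.

(* A maximal subspace meeting the kernel trivially is mapped bijectively
   onto [Y]. *)
Let transverse (W : classical_sets.set X) : Prop :=
  (forall (c : k) u v, W u -> W v -> W (c *: u + v)) /\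
  (forall u, W u -> g u = 0 -> u = 0).

Lemma transverse_max : exists W, transverse W /\
  forall W', (forall u, W u -> W' u) -> transverse W' -> forall u, W' u -> W u.
Proof.
have [|W [TW maxW]] := @classical_sets.Zorn_bigcup X transverse.
  move=> F FT Ftot; split=> [c u v [A FA Au] [B FB Bv]|u [A FA Au]]; last exact: (FT A FA).2.
  have [AB|BA] := Ftot A B FA FB.
    by exists B => //; apply: (FT B FB).1 => //; apply: AB.
  by exists A => //; apply: (FT A FA).1 => //; apply: BA.
exists W; split=> // W' WW' TW' u W'u; apply: boolp.contrapT => nWu.
by apply: (maxW W') => //; split=> // /(_ u W'u).
Qed.

Lemma linear_section : exists s : Y -> X, linear s /\ forall y, g (s y) = y.
Proof.
have [W [[Wlin Wker] maxW]] := transverse_max.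
(* The empty set satisfies [transverse], as Zorn's lemma requires for the empty chain; that 0 lies
   in [W] thus comes from maximality. *)
have W0 : W 0.
  apply: (maxW (fun u => W u \/ u = 0)) => [u|| ]; [by left | split | by right].
    move=> c u v [Wu|->] [Wv|->].
    - by left; apply: Wlin.
    - left; apply: (Wlin) => //.
      by rewrite -(addNr u) -scaleN1r; apply: Wlin.
    - by left; rewrite scaler0 add0r.
    - by right; rewrite scaler0 addr0.
  by move=> u [/Wker //|].
have WZ c u : W u -> W (c *: u) by move=> Wu; rewrite -[c *: u]addr0; apply: Wlin.
have WD u v : W u -> W v -> W (u + v) by rewrite -{2}[u]scale1r; apply: Wlin.
have Winj u v : W u -> W v -> g u = g v -> u = v.
  move=> Wu Wv guv; apply/eqP; rewrite -subr_eq0; apply/eqP/Wker.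
    by apply: WD => //; rewrite -scaleN1r; apply: WZ.
  by rewrite linearB /= guv subrr.
(* If [y] were missed, a preimage [x] of it could be adjoined: W + k x still meets the kernel
   trivially, contradicting maximality. *)
have Wsurj y : exists x, W x /\ g x = y.
  apply: boolp.contrapT => ny; have [x gx] := g_surj y.
  suff Wx : W x by apply: ny; exists x.
  apply: (maxW (fun u => exists w c, W w /\ u = w + c *: x)).
  - by move=> u Wu; exists u, 0; rewrite scale0r addr0.
  - split=> [c u v [w [d [Ww ->]]] [w' [d' [Ww' ->]]]|u [w [c [Ww ->]]]].
      exists (c *: w + w'), (c * d + d'); split; first exact: Wlin.
      by rewrite scalerDr scalerA scalerDl addrACA.
    rewrite linearD linearZ /= gx => e.
    have [c0|c0] := eqVneq c 0.
      by move: e; rewrite c0 !scale0r !addr0; apply: Wker.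
    case: ny; exists (- c^-1 *: w); split; first exact: WZ.
    rewrite linearZ /=; have -> : g w = - (c *: y) by apply/eqP; rewrite -addr_eq0 e.
    by rewrite scalerN scaleNr opprK scalerA mulVf // scale1r.
  by exists 0, 1; rewrite scale1r add0r.
have [s sP] := boolp.choice Wsurj.
exists s; split=> [c u v|y]; last by case: (sP y).
apply: Winj; first by case: (sP (c *: u + v)).
  by apply: Wlin; [case: (sP u) | case: (sP v)].
by rewrite linearP (sP u).2 (sP v).2 (sP _).2.
Qed.

End VectorSpaceSection.

(** The elements r with f (r u) = r f(u) for all u form a subalgebra, so scalars and the two
    generators suffice. *)
Lemma plane_linear (k : fieldType) (lam : k) (M N : lmodType (qplane lam)) (f : M -> N) :
    (forall u v, f (u + v) = f u + f v) ->
    (forall (c : k) u, f ((c%:A : qplane lam) *: u) = (c%:A : qplane lam) *: f u) ->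
    (forall u, f (qx1 lam *: u) = qx1 lam *: f u) ->
    (forall u, f (qx2 lam *: u) = qx2 lam *: f u) ->
  linear f.
Proof.
move=> fD fZ f1 f2 r u v; rewrite fD; congr (_ + _).
move: r u {v}; apply: qplane_ind => [s t hs ht u|c s hs u|u|s hs u|s hs u].
- by rewrite !scalerDl fD hs ht.
- by rewrite -mulr_algl -!scalerA fZ hs.
- by rewrite !scale1r.
- by rewrite -!scalerA f1 hs.
- by rewrite -!scalerA f2 hs.
Qed.

(* The free module [R (x)_k M]. *)
Definition kos (k : fieldType) (lam : k) (M : lmodType (qplane lam)) : Type :=
  qrep (@lmul12 k lam (krestr M)).

HB.instance Definition _ (k : fieldType) (lam : k) (M : lmodType (qplane lam)) :=
  GRing.Lmodule.on (kos M).

Section FreeModule.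
Variables (k : fieldType) (lam : k) (M : lmodType (qplane lam)).
Notation R := (qplane lam).
Notation x1 := (qx1 lam).
Notation x2 := (qx2 lam).
Notation Q := (kos M).
Notation K := (krestr M).

Definition ktens (m : M) : Q := mono 0 0 (m : K).

Lemma kos_x1 (u : Q) : x1 *: u = lmul1 u :> tens K. Proof. exact: qrep_x1. Qed.
Lemma kos_x2 (u : Q) : x2 *: u = lmul2 lam u :> tens K. Proof. exact: qrep_x2. Qed.
Lemma kosZ (c : k) (u : Q) : (c%:A : R) *: u = c *: (u : tens K) :> tens K.
Proof. exact: qrepZ. Qed.

Lemma qx1_mono a b : x1 * mono a b 1 = mono a.+1 b 1 :> R.
Proof. by rewrite qx1M lmul1_mono. Qed.
Lemma qx2_mono a b : x2 * mono a b 1 = lam ^+ a *: (mono a b.+1 1 : R) :> R.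
Proof. by rewrite qx2M lmul2_mono monoZ. Qed.

Section Extension.
Variables (N : lmodType R) (h : M -> N).
Hypothesis hD : forall m n, h (m + n) = h m + h n.
Hypothesis hZ : forall (c : k) m, h ((c%:A : R) *: m) = (c%:A : R) *: h m.

(** The universal property of R (x) M: the R-linear map determined by its k-linear restriction [h]
    to 1 (x) M. *)
Definition ext (u : Q) : N := tlift (fun a b (m : K) => (mono a b 1 : R) *: h m) u.

Lemma ext_mono a b (m : K) : ext (mono a b m) = (mono a b 1 : R) *: h m.
Proof. by rewrite /ext tlift_mono // => i j m1 m2; rewrite hD scalerDr. Qed.

Lemma extD (u v : Q) : ext (u + v) = ext u + ext v.
Proof. by rewrite /ext tliftD // => i j m1 m2; rewrite hD scalerDr. Qed.

Lemma ext_tens m : ext (ktens m) = h m.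
Proof. by rewrite ext_mono scale1r. Qed.

Fact ext_linear : linear ext.
Proof.
have hZ' (c : k) (m : K) : h (c *: m) = (c%:A : R) *: h m by apply: hZ.
apply: plane_linear => [u v|c u|u|u]; first exact: extD.
- rewrite kosZ; pattern u; apply: tens_ind => [|v w hv hw|a b m].
  + by rewrite scaler0 /ext tlift0 scaler0.
  + by rewrite scalerDr !extD hv hw scalerDr.
  by rewrite -monoZ !ext_mono hZ' !scalerA mulr_algl mulr_algr.
- rewrite kos_x1; pattern u; apply: tens_ind => [|v w hv hw|a b m].
  + by rewrite linear0 /ext tlift0 scaler0.
  + by rewrite linearD !extD hv hw scalerDr.
  by rewrite lmul1_mono !ext_mono scalerA qx1_mono.
rewrite kos_x2; pattern u; apply: tens_ind => [|v w hv hw|a b m].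
+ by rewrite linear0 /ext tlift0 scaler0.
+ by rewrite linearD !extD hv hw scalerDr.
by rewrite lmul2_mono !ext_mono hZ' !scalerA qx2_mono mulr_algr.
Qed.
Definition ext_lin : {linear Q -> N} :=
  HB.pack ext (GRing.isLinear.Build R Q N *:%R ext ext_linear).

End Extension.

Lemma mono_ktens a b (m : M) : mono a b (m : K) = (mono a b 1 : R) *: ktens m :> Q.
Proof.
rewrite -[RHS]/(qact _ _ _ _) qact_mono scale1r.
by rewrite iter_lmul2 iter_lmul1 !addn0.
Qed.

Lemma ktensD m n : ktens (m + n) = ktens m + ktens n.
Proof. exact: (monoD (V := K)). Qed.
Lemma ktensZ (c : k) m : ktens ((c%:A : R) *: m) = (c%:A : R) *: ktens m.
Proof. by rewrite kosZ; apply: (monoZ (V := K)). Qed.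

Lemma kos_ext (N : lmodType R) (f g : {linear Q -> N}) :
  (forall m, f (ktens m) = g (ktens m)) -> f =1 g.
Proof.
move=> fg u; pattern u; apply: tens_ind => [|v w hv hw|a b m].
- by rewrite !linear0.
- by rewrite !linearD hv hw.
by rewrite mono_ktens !linearZ fg.
Qed.

(** A lift only has to be k-linear on 1 (x) M: compose [f] there with a linear section of [g], then
    extend. No basis of M is chosen. *)
Lemma kos_projective : projective (Q : lmodType R).
Proof.
move=> X Y g f g_surj.
have gK_lin : linear (g : krestr X -> krestr Y) by move=> c u v; apply: linearP.
pose gK : {linear krestr X -> krestr Y} :=
  HB.pack (g : krestr X -> krestr Y)
    (GRing.isLinear.Build _ _ _ _ (g : krestr X -> krestr Y) gK_lin).
have [s [s_lin gs]] := linear_section (g := gK) g_surj.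
have sD u v : s (u + v) = s u + s v by rewrite -[u in LHS]scale1r s_lin scale1r.
have s0 : s 0 = 0 by apply: (addIr (s 0)); rewrite -sD !add0r.
have hD m n : s (f (ktens (m + n))) = s (f (ktens m)) + s (f (ktens n)).
  by rewrite -sD ktensD linearD.
have hZ (c : k) m : s (f (ktens ((c%:A : R) *: m))) = (c%:A : R) *: (s (f (ktens m)) : X).
  rewrite ktensZ.
  by rewrite linearZ -[X in s X]addr0 s_lin s0 addr0.
exists (ext_lin (N := X) hD hZ) => u; pattern u.
have [gext gextE] : exists f' : {linear Q -> Y}, forall v, f' v = g (ext_lin (N := X) hD hZ v).
  by exists (g \o ext_lin (N := X) hD hZ : {linear Q -> Y}).
rewrite -gextE; apply: kos_ext => m; rewrite gextE.
by rewrite [ext_lin _ _ _]ext_tens // gs.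
Qed.

End FreeModule.

Lemma cross_cancel (V : zmodType) (a b c d : V) :
  (a - b) - (c - d) + ((- a + c) - (- b + d)) = 0.
Proof.
rewrite [- (- b + d)]opprD opprK [X in _ + X]addrACA [- a + b]addrC -[b - a]opprB.
by rewrite addrACA subrr addNr addr0.
Qed.

Section KoszulComplex.
Variables (k : fieldType) (lam : k).
Variable (M : lmodType (qplane lam)).
Notation R := (qplane lam).
Notation x1 := (qx1 lam).
Notation x2 := (qx2 lam).
Notation Q := (kos M).
Notation K := (krestr M).
Implicit Types (u v w : tens K) (m : M) (s t : k).

Definition mact1 : tens K -> tens K := tmap (krestr_op (M := M) x1).
Definition mact2 : tens K -> tens K := tmap (krestr_op (M := M) x2).
HB.instance Definition _ := GRing.Linear.on mact1.
HB.instance Definition _ := GRing.Linear.on mact2.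

(** r (x) m |-> s (r x1 (x) m) - t (r (x) x1 m). Multiplying on the right keeps it linear over R
    acting on the left; the two scalars serve both differentials. *)
Definition kop1 s t : tens K -> tens K :=
  (s \*: (rmul1 lam : tens K -> tens K)) \- (t \*: mact1).
Definition kop2 s t : tens K -> tens K :=
  (s \*: (rmul2 : tens K -> tens K)) \- (t \*: mact2).
HB.instance Definition _ s t := GRing.Linear.on (kop1 s t).
HB.instance Definition _ s t := GRing.Linear.on (kop2 s t).

Lemma kop1E s t u : kop1 s t u = s *: rmul1 lam u - t *: mact1 u.
Proof. by []. Qed.
Lemma kop2E s t u : kop2 s t u = s *: rmul2 u - t *: mact2 u.
Proof. by []. Qed.

Lemma kop1_mono s t a b (m : K) :
  kop1 s t (mono a b m) = mono a.+1 b ((s * lam ^+ b) *: m) - mono a b (t *: krestr_op x1 m).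
Proof. by rewrite kop1E rmul1_mono /mact1 tmap_mono -!monoZ scalerA. Qed.
Lemma kop2_mono s t a b (m : K) :
  kop2 s t (mono a b m) = mono a b.+1 (s *: m) - mono a b (t *: krestr_op x2 m).
Proof. by rewrite kop2E rmul2_mono /mact2 tmap_mono -!monoZ. Qed.

Lemma tcoef_kop1 s t u a b : tcoef (kop1 s t u) a b =
  (if a is a'.+1 then (s * lam ^+ b) *: tcoef u a' b else 0) - t *: krestr_op x1 (tcoef u a b).
Proof.
rewrite kop1E tcoefB !tcoefZ tcoef_rmul1 /mact1 tcoef_tmap.
by case: a => [|a]; rewrite ?scaler0 ?scalerA.
Qed.
Lemma tcoef_kop2 s t u a b : tcoef (kop2 s t u) a b =
  (if b is b'.+1 then s *: tcoef u a b' else 0) - t *: krestr_op x2 (tcoef u a b).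
Proof.
rewrite kop2E tcoefB !tcoefZ tcoef_rmul2 /mact2 tcoef_tmap.
by case: b => [|b]; rewrite ?scaler0.
Qed.

Lemma rmul_lmul11 u : rmul1 lam (lmul1 u) = lmul1 (rmul1 lam u).
Proof. by apply: tensP => -[|[|a]] b; rewrite !(tcoef_rmul1, tcoef_lmul1) ?scaler0. Qed.
Lemma rmul_lmul12 u : rmul1 lam (lmul2 lam u) = lmul2 lam (rmul1 lam u).
Proof.
apply: tensP => -[|a] [|b]; rewrite !(tcoef_rmul1, tcoef_lmul2) ?scaler0 //.
by rewrite !scalerA !exprS mulrAC.
Qed.
Lemma rmul_lmul21 u : rmul2 (lmul1 u) = lmul1 (rmul2 u).
Proof. by apply: tensP => -[|a] [|b]; rewrite !(tcoef_rmul2, tcoef_lmul1). Qed.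
Lemma rmul_lmul22 u : rmul2 (lmul2 lam u) = lmul2 lam (rmul2 u).
Proof. by apply: tensP => a [|[|b]]; rewrite !(tcoef_rmul2, tcoef_lmul2) ?scaler0. Qed.

Lemma tmap_lmul1 (f : {linear K -> K}) u : tmap f (lmul1 u) = lmul1 (tmap f u).
Proof. by apply: tensP => -[|a] b; rewrite !(tcoef_tmap, tcoef_lmul1) ?linear0. Qed.
Lemma tmap_lmul2 (f : {linear K -> K}) u : tmap f (lmul2 lam u) = lmul2 lam (tmap f u).
Proof. by apply: tensP => a [|b]; rewrite !(tcoef_tmap, tcoef_lmul2) ?linear0 ?linearZ. Qed.
Lemma tmap_rmul1 (f : {linear K -> K}) u : tmap f (rmul1 lam u) = rmul1 lam (tmap f u).
Proof. by apply: tensP => -[|a] b; rewrite !(tcoef_tmap, tcoef_rmul1) ?linear0 ?linearZ. Qed.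
Lemma tmap_rmul2 (f : {linear K -> K}) u : tmap f (rmul2 u) = rmul2 (tmap f u).
Proof. by apply: tensP => a [|b]; rewrite !(tcoef_tmap, tcoef_rmul2) ?linear0. Qed.

Lemma rmul12 u : rmul1 lam (rmul2 u) = lam *: rmul2 (rmul1 lam u).
Proof.
apply: tensP => -[|a] [|b]; rewrite tcoefZ !(tcoef_rmul1, tcoef_rmul2) ?scaler0 //.
by rewrite exprS scalerA.
Qed.

Lemma mact21 u : mact2 (mact1 u) = lam *: mact1 (mact2 u).
Proof.
apply: tensP => a b; rewrite tcoefZ /mact1 /mact2 !tcoef_tmap.
rewrite -[LHS]/(x2 *: (x1 *: (tcoef u a b : M))).
by rewrite -[RHS]/(lam%:A *: (x1 *: (x2 *: (tcoef u a b : M)))) !scalerA mulr_algl qx21.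
Qed.

Lemma kos_linear (f : {linear tens K -> tens K}) :
    (forall u, f (lmul1 u) = lmul1 (f u)) -> (forall u, f (lmul2 lam u) = lmul2 lam (f u)) ->
  linear (f : Q -> Q).
Proof.
move=> f1 f2; apply: plane_linear => [u v|c u|u|u]; first exact: linearD.
- by rewrite !kosZ linearZ.
- by rewrite !kos_x1 f1.
by rewrite !kos_x2 f2.
Qed.

Lemma kop1_kos s t : linear (kop1 s t : Q -> Q).
Proof.
apply: (kos_linear (f := kop1 s t)) => u; rewrite /= !kop1E.
  by rewrite rmul_lmul11 [mact1 _]tmap_lmul1 (linearB lmul1) /=; congr (_ - _); rewrite linearZ.
by rewrite rmul_lmul12 [mact1 _]tmap_lmul2 (linearB (lmul2 lam)) /=; congr (_ - _); rewrite linearZ.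
Qed.

Lemma kop2_kos s t : linear (kop2 s t : Q -> Q).
Proof.
apply: (kos_linear (f := kop2 s t)) => u; rewrite /= !kop2E.
  by rewrite rmul_lmul21 [mact2 _]tmap_lmul1 (linearB lmul1) /=; congr (_ - _); rewrite linearZ.
by rewrite rmul_lmul22 [mact2 _]tmap_lmul2 (linearB (lmul2 lam)) /=; congr (_ - _); rewrite linearZ.
Qed.

Fact kd0_linear : linear (fun p : (Q * Q)%type => kop1 1 1 p.1 + kop2 1 1 p.2 : Q).
Proof.
move=> r [u v] [u' v'] /=; rewrite kop1_kos kop2_kos [X in _ = X + _]scalerDr.
exact: addrACA.
Qed.
Definition kd0 : {linear (Q * Q)%type -> Q} :=
  HB.pack (fun p : (Q * Q)%type => kop1 1 1 p.1 + kop2 1 1 p.2 : Q)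
    (GRing.isLinear.Build R (Q * Q)%type Q *:%R _ kd0_linear).

(** The scalars come from x2 x1 - lam x1 x2: the first component of d1 (1 (x) m) is x2 (x) m - lam
    (x) x2 m, what surrounds x1 in the two terms; the second is - lam x1 (x) m + 1 (x) x1 m, what
    surrounds x2. *)
Fact kd1_linear : linear (fun w : Q => (kop2 1 lam w, kop1 (- lam) (- 1) w) : (Q * Q)%type).
Proof. by move=> r u v; rewrite kop1_kos kop2_kos. Qed.
Definition kd1 : {linear Q -> (Q * Q)%type} :=
  HB.pack (fun w : Q => (kop2 1 lam w, kop1 (- lam) (- 1) w) : (Q * Q)%type)
    (GRing.isLinear.Build R Q (Q * Q)%type *:%R _ kd1_linear).

Lemma kd0E p : kd0 p = kop1 1 1 p.1 + kop2 1 1 p.2 :> tens K. Proof. by []. Qed.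
Lemma kd1E w : kd1 w = (kop2 1 lam w, kop1 (- lam) (- 1) w) :> (tens K * tens K)%type.
Proof. by []. Qed.

(** The relation cancels x2 x1 against lam x1 x2 on the side of R and on the side of M; the mixed
    terms cancel in pairs. *)
Lemma kd01 w : kd0 (kd1 w) = 0.
Proof.
rewrite kd0E -[(kd1 w).1]/(kop2 1 lam w) -[(kd1 w).2]/(kop1 (- lam) (- 1) w).
rewrite [X in X + _]kop1E [X in _ + X]kop2E !scale1r.
have -> : kop2 1 lam w = rmul2 w - lam *: mact2 w by rewrite kop2E scale1r.
have -> : kop1 (- lam) (- 1) w = - lam *: rmul1 lam w + mact1 w.
  by rewrite kop1E scaleN1r opprK.
rewrite (linearB (rmul1 lam)) (linearB mact1) (linearD rmul2) (linearD mact2) /=.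
rewrite [rmul1 lam (_ *: _)]linearZ [mact1 (_ *: _)]linearZ.
rewrite [rmul2 (_ *: _)]linearZ [mact2 (_ *: _)]linearZ /=.
rewrite rmul12 mact21 [mact1 (rmul2 w)]tmap_rmul2 [mact2 (rmul1 lam w)]tmap_rmul1.
rewrite !scaleNr; exact: cross_cancel.
Qed.

End KoszulComplex.

Section TensorSupport.
Variables (k : fieldType) (V : lmodType k).
Implicit Types (u : tens V).

Lemma tens_bound u : exists N, forall a b, (N <= a + b)%N -> tcoef u a b = 0.
Proof.
pattern u; apply: tens_ind => [|v w [N hN] [N' hN']|i j x].
- by exists 0%N => a b _; rewrite tcoef0.
- exists (maxn N N') => a b; rewrite geq_max => /andP[ab ab'].
  by rewrite tcoefD hN // hN' // addr0.
exists (i + j).+1 => a b ab; rewrite tcoef_mono; case: ifP => // /andP[/eqP ia /eqP jb].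
by rewrite ia jb ltnn in ab.
Qed.

(** Finite support starts a descending induction: coefficients vanish in large total degree, and
    [step] propagates this downwards. *)
Lemma tens_tail1 u : (forall a b, tcoef u a.+1 b = 0 -> tcoef u a b = 0) -> u = 0.
Proof.
move=> step; have [N hN] := tens_bound u.
suff all n a b : (N <= a + b + n)%N -> tcoef u a b = 0.
  by apply: tensP => a b; rewrite tcoef0 (all N) // leq_addl.
elim: n a b => [|n IH] a b; first by rewrite addn0; apply: hN.
by move=> Nab; apply/step/IH; rewrite !addSn -addnS.
Qed.

Lemma tens_tail2 u : (forall a b, tcoef u a b.+1 = 0 -> tcoef u a b = 0) -> u = 0.
Proof.
move=> step; have [N hN] := tens_bound u.
suff all n a b : (N <= a + b + n)%N -> tcoef u a b = 0.
  by apply: tensP => a b; rewrite tcoef0 (all N) // leq_addl.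
elim: n a b => [|n IH] a b; first by rewrite addn0; apply: hN.
by move=> Nab; apply/step/IH; rewrite addnS addSn -addnS.
Qed.

End TensorSupport.

Section ProductMaps.
Variables (B : nzRingType) (P P' X : lmodType B) (f : {linear (P * P')%type -> X}).

Fact linl_linear : linear (fun p : P => f (p, 0)).
Proof.
move=> c u v; rewrite -linearP; congr (f _).
by congr (_, _); rewrite /= scaler0 addr0.
Qed.
Fact linr_linear : linear (fun p : P' => f (0, p)).
Proof.
move=> c u v; rewrite -linearP; congr (f _).
by congr (_, _); rewrite /= scaler0 addr0.
Qed.
Definition linl : {linear P -> X} :=
  HB.pack (fun p : P => f (p, 0)) (GRing.isLinear.Build B P X *:%R _ linl_linear).
Definition linr : {linear P' -> X} :=
  HB.pack (fun p : P' => f (0, p)) (GRing.isLinear.Build B P' X *:%R _ linr_linear).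

Lemma linear_pair p p' : f (p, p') = linl p + linr p'.
Proof.
rewrite /= -linearD; congr (f _).
by congr (_, _); rewrite /= ?addr0 ?add0r.
Qed.

End ProductMaps.

Section PairMap.
Variables (B : nzRingType) (P P' X : lmodType B) (h : {linear P -> X}) (h' : {linear P' -> X}).

Fact lpair_linear : linear (fun p : (P * P')%type => h p.1 + h' p.2).
Proof. by move=> c [u u'] [v v'] /=; rewrite !linearP scalerDr addrACA. Qed.
Definition lpair : {linear (P * P')%type -> X} := HB.pack
  (fun p : (P * P')%type => h p.1 + h' p.2) (GRing.isLinear.Build B _ _ *:%R _ lpair_linear).

End PairMap.

Lemma projective_prod (B : nzRingType) (P P' : lmodType B) :
  projective P -> projective P' -> projective (P * P')%type.
Proof.
move=> projP projP' X Y g f g_surj.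
have [h hE] := projP X Y g (linl f) g_surj.
have [h' hE'] := projP' X Y g (linr f) g_surj.
exists (lpair h h') => -[p p'].
by rewrite [RHS]linear_pair /= linearD hE hE'.
Qed.

Lemma projective_zero (B : nzRingType) (P : lmodType B) :
  (forall p : P, p = 0) -> projective P.
Proof.
move=> P0 X Y g f _; exists (\0 : {linear P -> X}) => p.
by rewrite (P0 p) !linear0.
Qed.

Lemma linear_sub0 (B : nzRingType) (U W : lmodType B) (f : {linear U -> W}) u v :
  f u = 0 -> f v = 0 -> f (u - v) = 0.
Proof. by move=> u0 v0; rewrite linearB u0 v0 subr0. Qed.

(** * Exactness of the Koszul complex *)

Section KoszulExact.
Variables (k : fieldType) (lam : k).
Hypothesis lam_neq0 : lam != 0.
Variable (M : lmodType (qplane lam)).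
Notation R := (qplane lam).
Notation x1 := (qx1 lam).
Notation x2 := (qx2 lam).
Notation Q := (kos M).
Notation K := (krestr M).
Notation op1 := (@kop1 k lam M).
Notation op2 := (@kop2 k lam M).
Notation d0 := (@kd0 k lam M).
Notation d1 := (@kd1 k lam M).

(** At (a, b + 1) the first component of d1 w has coefficient w_(a,b) - lam x2 w_(a,b+1), so
    vanishing descends in b. *)
Lemma kd1_inj (w : Q) : d1 w = 0 -> w = 0.
Proof.
move=> /(congr1 fst) w0; apply: tens_tail2 => a b wab.
have := congr1 (fun u : tens K => tcoef u a b.+1) w0; rewrite kd1E /=.
by rewrite tcoef_kop2 wab linear0 scaler0 subr0 scale1r tcoef0.
Qed.

(** Division with remainder by the second component of d1; the remainder is free of x1. *)
Lemma kop1_div (v : tens K) :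
  exists w, forall a b, tcoef (v - op1 (- lam) (- 1) w) a.+1 b = 0.
Proof.
pattern v; apply: tens_ind => [|u u' [w hw] [w' hw']|a b m].
- by exists 0 => a b; rewrite linear0 subr0 tcoef0.
- exists (w + w') => a b; rewrite (linearD (op1 (- lam) (- 1))) opprD addrACA tcoefD.
  by rewrite hw hw' addr0.
elim: a m => [|a IH] m.
  by exists 0 => a' b'; rewrite linear0 subr0 tcoef_mono.
(* The factor with which the operator sends x1^a x2^b to x1^(a+1) x2^b; it is invertible because lam
   is. *)
pose c := - lam * lam ^+ b.
have c0 : c != 0 by rewrite mulf_neq0 ?oppr_eq0 ?expf_neq0.
have [w hw] := IH (- 1 *: krestr_op x1 (c^-1 *: m)).
exists (mono a b (c^-1 *: m) + w) => a' b'.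
rewrite (linearD (op1 (- lam) (- 1))) opprD addrA -[X in tcoef X]/(_ - _).
have -> : mono a.+1 b m - op1 (- lam) (- 1) (mono a b (c^-1 *: m)) =
    mono a b (- 1 *: krestr_op x1 (c^-1 *: m)).
  by rewrite kop1_mono scalerA mulfV // scale1r opprB addrC subrK.
exact: hw.
Qed.

(** Subtracting d1 w makes the second entry free of x1. The coefficients of d0 at positive powers of
    x1 then see only the first entry, which vanishes by descent in the exponent of x1; the second
    entry then vanishes by descent in that of x2. *)
Lemma kd0_exact (p : (Q * Q)%type) : d0 p = 0 -> exists w, p = d1 w.
Proof.
case: p => u v uv0; have [w hw] := kop1_div v; exists w.
have := linear_sub0 uv0 (kd01 w).
have [u' eu] : {u' : tens K | u' = u - op2 1 lam w} by exists (u - op2 1 lam w).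
have [v' ev] : {v' : tens K | v' = v - op1 (- lam) (- 1) w}.
  by exists (v - op1 (- lam) (- 1) w).
have -> : (u, v) - d1 w = (u', v') :> (Q * Q)%type by rewrite eu ev.
have hv a b : tcoef v' a.+1 b = 0 by rewrite ev; exact: hw.
rewrite kd0E /= => uv'0.
have u'0 : u' = 0.
  apply: tens_tail1 => a b uab.
  have := congr1 (fun u : tens K => tcoef u a.+1 b) uv'0.
  rewrite tcoefD tcoef_kop1 tcoef_kop2 uab hv tcoef0.
  rewrite !linear0 !addr0 mul1r.
  have -> : (if b is b'.+1 then 1 *: tcoef v' a.+1 b' else 0) = 0.
    by case: b {uab} => // b; rewrite hv scaler0.
  by rewrite addr0 => /eqP; rewrite scaler_eq0 expf_eq0 (negPf lam_neq0) andbF => /eqP.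
have v'0 : v' = 0.
  move: uv'0; rewrite u'0 linear0 add0r => v0; apply: tens_tail2 => a b vab.
  have := congr1 (fun u : tens K => tcoef u a b.+1) v0.
  by rewrite tcoef_kop2 vab linear0 scaler0 subr0 scale1r tcoef0.
congr (_, _); apply/eqP; rewrite -subr_eq0; apply/eqP.
  by rewrite -[RHS]u'0 eu.
by rewrite -[RHS]v'0 ev.
Qed.

Definition kaug : {linear Q -> M} :=
  ext_lin (N := M) (h := id) (fun _ _ => erefl) (fun _ _ => erefl).

Lemma kaug_ktens m : kaug (ktens m) = m.
Proof. exact: ext_tens. Qed.

Lemma kd0_l m : d0 (ktens m, 0) = x1 *: ktens m - ktens (x1 *: m) :> Q.
Proof.
rewrite [LHS]kd0E /= linear0 addr0 kop1_mono mulr1 !scale1r.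
by congr (_ - _); rewrite -mono_ktens.
Qed.

Lemma kd0_r m : d0 (0, ktens m) = x2 *: ktens m - ktens (x2 *: m) :> Q.
Proof.
rewrite [LHS]kd0E /= linear0 add0r kop2_mono !scale1r.
by congr (_ - _); rewrite -mono_ktens.
Qed.

Lemma kos2_ext (N : lmodType R) (f g : {linear (Q * Q)%type -> N}) :
    (forall m, f (ktens m, 0) = g (ktens m, 0)) ->
    (forall m, f (0, ktens m) = g (0, ktens m)) ->
  f =1 g.
Proof.
move=> fl fr [u v]; rewrite !linear_pair.
by congr (_ + _); apply: kos_ext.
Qed.

Lemma kaug_kd0 p : kaug (d0 p) = 0.
Proof.
apply: (kos2_ext (f := kaug \o d0) (g := \0)) => m.
  rewrite -[LHS]/(kaug (d0 (ktens m, 0))) kd0_l.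
  by rewrite (linearB kaug) linearZ !kaug_ktens subrr.
rewrite -[LHS]/(kaug (d0 (0, ktens m))) kd0_r.
by rewrite (linearB kaug) linearZ !kaug_ktens subrr.
Qed.

(** Modulo boundaries, a factor x1 or x2 next to the tensor sign moves over to M. *)
Lemma kd0_div (u : Q) : exists p m, u = d0 p + ktens m.
Proof.
pattern u; apply: tens_ind => [|v w [p [m ->]] [p' [m' ->]]|a b m].
- by exists 0, 0; rewrite linear0 /ktens mono0 addr0.
- by exists (p + p'), (m + m'); rewrite linearD ktensD addrACA.
have shift a' b' n : mono a' b'.+1 n = d0 (0, mono a' b' n) + mono a' b' (krestr_op x2 n) :> Q.
  by rewrite [d0 _]kd0E /= linear0 add0r kop2_mono !scale1r subrK.
have shift' a' n : mono a'.+1 0 n = d0 (mono a' 0 n, 0) + mono a' 0 (krestr_op x1 n) :> Q.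
  by rewrite [d0 _]kd0E /= linear0 addr0 kop1_mono mulr1 !scale1r subrK.
(* x2 stands rightmost and is removed first; x1 is then removed at exponent 0 of x2, where no power
   of lam intervenes. *)
elim: b m => [|b IH] m.
  elim: a m => [|a IH] m; first by exists 0, m; rewrite linear0 add0r.
  have [p [n e]] := IH (krestr_op x1 m); exists ((mono a 0 m, 0) + p), n.
  by rewrite shift' e linearD addrA.
have [p [n e]] := IH (krestr_op x2 m); exists ((0, mono a b m) + p), n.
by rewrite shift e linearD addrA.
Qed.

Lemma kaug_exact (u : Q) : kaug u = 0 -> exists p, u = d0 p.
Proof.
have [p [m ->]] := kd0_div u; rewrite linearD kaug_kd0 add0r kaug_ktens => ->.
by exists p; rewrite /ktens mono0 addr0.
Qed.

Definition koszul_mod (i : nat) : lmodType R :=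
  match i with
  | 0 => Q
  | 1 => (Q * Q)%type
  | 2 => Q
  | _ => 'rV[R]_0
  end.

Definition koszul_d (i : nat) : {linear koszul_mod i.+1 -> koszul_mod i} :=
  match i with
  | 0 => d0
  | 1 => d1
  | 2 => \0 : {linear 'rV[R]_0 -> Q}
  | _ => \0 : {linear 'rV[R]_0 -> 'rV[R]_0}
  end.

Lemma koszul_mod0 i (p : koszul_mod i) : (2 < i)%N -> p = 0.
Proof. by case: i p => [|[|[|i]]] //= p _; apply: thinmx0. Qed.

Lemma koszul_projective i : projective (koszul_mod i).
Proof.
case: i => [|[|[|i]]].
- exact: kos_projective.
- by apply: projective_prod; apply: kos_projective.
- exact: kos_projective.
by apply: projective_zero => p; apply: thinmx0.
Qed.

Lemma koszul_exact i p : koszul_d i p = 0 <-> exists q, p = koszul_d i.+1 q.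
Proof.
case: i p => [|[|i]] p /=.
- split=> [/kd0_exact //|[w ->]]; exact: kd01.
- split=> [/kd1_inj ->|[w ->]]; last exact: (linear0 d1).
  by exists 0.
split=> [_|[w ->]]; last by case: i w {p}.
by exists 0; rewrite [LHS]thinmx0 [RHS]thinmx0.
Qed.

Definition koszul : resolution M :=
  @Resolution R M koszul_mod koszul_d kaug koszul_projective
    (fun y => ex_intro _ (ktens y) (kaug_ktens y))
    (fun p => conj (@kaug_exact p) (fun e => match e with ex_intro q eq =>
       etrans (congr1 kaug eq) (kaug_kd0 q) end))
    koszul_exact.

Lemma plane_proj_dim : proj_dim_le M 2.
Proof. by exists koszul => i p; apply: koszul_mod0. Qed.

End KoszulExact.

(** * Global dimension *)

Section KernelModule.
Variables (B : nzRingType) (Y Z : lmodType B) (f : {linear Y -> Z}).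

Definition in_kernel : {pred Y} := fun y => f y == 0.
Fact in_kernel_submod : submod_closed in_kernel.
Proof.
split=> [|c u v]; first by apply/eqP; rewrite linear0.
by move=> /eqP u0 /eqP v0; apply/eqP; rewrite linearP u0 v0 scaler0 addr0.
Qed.
HB.instance Definition _ := GRing.isSubmodClosed.Build B Y in_kernel in_kernel_submod.

Definition kernel_mod : Type := {y : Y | in_kernel y}.
HB.instance Definition _ := SubType.on kernel_mod.
HB.instance Definition _ := Choice.on kernel_mod.
HB.instance Definition _ := [SubChoice_isSubLmodule of kernel_mod by <:].

End KernelModule.

(** [phi] lands in the kernel of [d'], onto which [d] is surjective by exactness; [kernel_mod] makes
    this kernel a module, so that projectivity applies. *)
Lemma projective_lift (B : nzRingType) (P X Y Z : lmodType B)
    (d : {linear X -> Y}) (d' : {linear Y -> Z}) (phi : {linear P -> Y}) :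
    projective P -> (forall y, d' y = 0 <-> exists x, y = d x) ->
    (forall p, d' (phi p) = 0) ->
  exists psi : {linear P -> X}, forall p, d (psi p) = phi p.
Proof.
move=> projP exact_d phi0; pose N := kernel_mod d'.
have dK x : in_kernel d' (d x) by apply/eqP/exact_d; exists x.
have phiK p : in_kernel d' (phi p) by apply/eqP.
have g_lin : linear (fun x => Sub (d x) (dK x) : N).
  by move=> c u v; apply: val_inj; rewrite /= linearP.
have f_lin : linear (fun p => Sub (phi p) (phiK p) : N).
  by move=> c u v; apply: val_inj; rewrite /= linearP.
pose g : {linear X -> N} := HB.pack (fun x => Sub (d x) (dK x) : N)
  (GRing.isLinear.Build B X N *:%R _ g_lin).
pose f : {linear P -> N} := HB.pack (fun p => Sub (phi p) (phiK p) : N)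
  (GRing.isLinear.Build B P N *:%R _ f_lin).
have [|psi psiE] := projP _ _ g f.
  move=> y; have /eqP/exact_d[x yx] := valP y.
  by exists x; apply: val_inj; rewrite /= yx.
by exists psi => p; have := congr1 val (psiE p).
Qed.

Lemma linear_injB (B : nzRingType) (U W : lmodType B) (f : {linear U -> W}) :
  (forall u, f u = 0 -> u = 0) -> forall u v, f u = f v -> u = v.
Proof.
move=> f0 u v uv; apply/eqP; rewrite -subr_eq0; apply/eqP/f0.
by rewrite linearB uv subrr.
Qed.

(* If [P] has length at most 1, comparing [K] with [P] and back shows that the
   identity of the complex [K] is homotopic to a map vanishing in degree 2. *)
Lemma short_resolution_retract (B : nzRingType) (M : lmodType B) (P K : resolution M) :
    (forall p : P 2%N, p = 0) -> (forall w : K 3%N, w = 0) ->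
  exists s : {linear K 1%N -> K 2%N}, forall w, s (res_d K 1%N w) = - w.
Proof.
move=> P2 K3.
have dP_inj p : res_d P 0%N p = 0 -> p = 0.
  by move=> /res_exactS[q ->]; rewrite (P2 q) linear0.
have dK_inj w : res_d K 1%N w = 0 -> w = 0.
  by move=> /res_exactS[q ->]; rewrite (K3 q) linear0.
have ddK w : res_d K 0%N (res_d K 1%N w) = 0 by apply/res_exactS; exists w.
have ddP q : res_aug P (res_d P 0%N q) = 0 by apply/res_exact0; exists q.
have adK q : res_aug K (res_d K 0%N q) = 0 by apply/res_exact0; exists q.
have [f0 f0E] := res_projective (res_aug K) (@res_aug_surj _ _ P).
have [g0 g0E] := res_projective (res_aug P) (@res_aug_surj _ _ K).
have [|f1 f1E] := projective_lift (phi := f0 \o res_d K 0%N)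
    (@res_projective _ _ K 1%N) (@res_exact0 _ _ P).
  by move=> q; rewrite /= f0E adK.
have [|g1 g1E] := projective_lift (phi := g0 \o res_d P 0%N)
    (@res_projective _ _ P 1%N) (@res_exact0 _ _ K).
  by move=> q; rewrite /= g0E ddP.
have [|s0 s0E] := projective_lift (phi := (g0 \o f0) \- idfun)
    (@res_projective _ _ K 0%N) (@res_exact0 _ _ K).
  by move=> q; rewrite /= linearB /= g0E f0E subrr.
have [|s1 s1E] := projective_lift (phi := ((g1 \o f1) \- idfun) \- (s0 \o res_d K 0%N))
    (@res_projective _ _ K 1%N) (@res_exactS _ _ K 0%N).
  by move=> q; rewrite /= !linearB /= g1E s0E /= f1E subrr.
(* The length of [P] enters here: its first differential is injective, so the comparison map kills
   the image of [K 2]. *)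
have f1d w : f1 (res_d K 1%N w) = 0 by apply: dP_inj; rewrite f1E /= ddK linear0.
exists s1 => w; apply: (linear_injB dK_inj).
by rewrite s1E /= f1d ddK !linear0 addr0 add0r linearN.
Qed.

Section PlaneIdeal.
Variables (k : fieldType) (lam : k).
Notation R := (qplane lam).
Notation x1 := (qx1 lam).
Notation x2 := (qx2 lam).
Implicit Types (r : R).

Lemma qx1_inj r : x1 * r = 0 -> r = 0.
Proof.
rewrite qx1M => r0; apply: tensP => a b.
have := congr1 (fun u : tens k^o => tcoef u a.+1 b) r0.
by rewrite tcoef_lmul1 !tcoef0.
Qed.

(** In the ordered basis every monomial other than a pure power of x2 starts with x1. *)
Lemma qx1_div r : (forall b, tcoef r 0 b = 0) -> exists h, r = x1 * h.
Proof.
move=> r0; suff [h hr] : exists h, forall a b, tcoef (r - x1 * h) a.+1 b = 0.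
  exists h; apply/eqP; rewrite -subr_eq0; apply/eqP; apply: tensP => -[|a] b.
    by rewrite tcoefB qx1M tcoef_lmul1 r0 subr0 tcoef0.
  by rewrite hr tcoef0.
pattern r; apply: tens_ind => [|u v [h hu] [h' hv]|a b c] {r0}.
- by exists 0 => a b; rewrite mulr0 subr0 tcoef0.
- exists (h + h') => a b; rewrite mulrDr opprD addrACA tcoefD.
  by rewrite hu hv addr0.
case: a => [|a]; first by exists 0 => a' b'; rewrite mulr0 subr0 tcoef_mono.
by exists (mono a b c) => a' b'; rewrite qx1M lmul1_mono subrr tcoef0.
Qed.

Lemma plane_augmentation r : exists r1 r2, r = ((tcoef r 0 0 : k)%:A : R) + x1 * r1 + x2 * r2.
Proof.
pattern r; apply: tens_ind => [|u v [u1 [u2 eu]] [v1 [v2 ev]]|a b c].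
- by exists 0, 0; rewrite tcoef0 scale0r !mulr0 !addr0.
- exists (u1 + v1), (u2 + v2); rewrite tcoefD scalerDl !mulrDr [in LHS]eu [in LHS]ev addrACA.
  by rewrite [X in X + _ = _]addrACA.
case: a => [|a]; last first.
  by exists (mono a b c), 0; rewrite tcoef_mono scale0r add0r mulr0 addr0 qx1M lmul1_mono.
case: b => [|b]; last first.
  exists 0, (mono 0 b c); rewrite tcoef_mono scale0r add0r mulr0 add0r qx2M lmul2_mono.
  by rewrite scale1r.
exists 0, 0; rewrite tcoef_mono /= !mulr0 !addr0.
by rewrite qmono !expr0 mulr1.
Qed.

End PlaneIdeal.

Lemma triv12 (k : fieldType) (lam : k) (w : k^o) :
  (\0 : {linear k^o -> k^o}) ((\0 : {linear k^o -> k^o}) w) =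
  lam *: (\0 : {linear k^o -> k^o}) ((\0 : {linear k^o -> k^o}) w).
Proof. by rewrite /= scaler0. Qed.

(* The module [R / R_{>0}]. *)
Definition triv (k : fieldType) (lam : k) : Type := qrep (@triv12 k lam).
HB.instance Definition _ (k : fieldType) (lam : k) := GRing.Lmodule.on (triv lam).

Section Trivial.
Variables (k : fieldType) (lam : k).
Hypothesis lam_neq0 : lam != 0.
Notation R := (qplane lam).
Notation x1 := (qx1 lam).
Notation x2 := (qx2 lam).
Notation T := (triv lam).
Notation Q := (kos T).
Notation d0 := (kd0 T).
Notation d1 := (kd1 T).
Implicit Types (r : R) (t : T).

Lemma triv_x1 t : x1 *: t = 0. Proof. exact: qrep_x1. Qed.
Lemma triv_x2 t : x2 *: t = 0. Proof. exact: qrep_x2. Qed.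
Lemma trivZ (c : k) t : (c%:A : R) *: t = (c * (t : k) : k) :> k.
Proof. by rewrite -[RHS]/(c *: (t : k^o)); apply: (qrepZ (W := k^o)). Qed.

Lemma triv_scale r t : r *: t = ((tcoef r 0 0 : k)%:A : R) *: t.
Proof.
have [r1 [r2 {1}->]] := plane_augmentation r.
rewrite !scalerDl -[(x1 * r1) *: t]scalerA -[(x2 * r2) *: t]scalerA.
by rewrite triv_x1 triv_x2 !addr0.
Qed.

Lemma triv_trivial : trivial_module (@plane_gr k lam) T.
Proof.
exists (1 : k); split.
- exact: oner_neq0.
- by move=> t; exists (t : k); rewrite trivZ mulr1.
move=> n r n0 /plane_grP gr; rewrite triv_scale.
have -> : tcoef r 0 0 = 0.
  by apply/eqP; apply: contraTT n0 => /gr <-.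
by rewrite !scale0r.
Qed.

Definition triv1 : T := (1 : k).
Definition kone : Q := ktens triv1.

Lemma ktens_triv t : ktens t = ((t : k)%:A : R) *: kone.
Proof. by rewrite -ktensZ; congr ktens; rewrite trivZ mulr1. Qed.

Lemma kd0_one1 : d0 (kone, 0) = x1 *: kone.
Proof. by rewrite [LHS]kd0_l triv_x1 /ktens mono0 subr0. Qed.
Lemma kd0_one2 : d0 (0, kone) = x2 *: kone.
Proof. by rewrite [LHS]kd0_r triv_x2 /ktens mono0 subr0. Qed.
Lemma kd1_one : d1 kone = (x2 *: kone, (- lam)%:A *: (x1 *: kone)) :> (Q * Q)%type.
Proof.
rewrite [LHS]kd1E kop2_mono kop1_mono mulr1 !scale1r.
have -> : krestr_op x2 triv1 = 0 :> krestr T by exact: triv_x2.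
have -> : krestr_op x1 triv1 = 0 :> krestr T by exact: triv_x1.
rewrite !scaler0 !mono0 !subr0; congr (_, _); first by rewrite -mono_ktens.
by rewrite kosZ -mono_ktens; apply: (monoZ (V := krestr T)).
Qed.

Lemma kos_triv_ext (N : lmodType R) (f g : {linear Q -> N}) : f kone = g kone -> f =1 g.
Proof. by move=> fg; apply: kos_ext => t; rewrite ktens_triv !linearZ fg. Qed.

Lemma kos2_triv_ext (N : lmodType R) (f g : {linear (Q * Q)%type -> N}) :
  f (kone, 0) = g (kone, 0) -> f (0, kone) = g (0, kone) -> f =1 g.
Proof.
move=> fl fr [u v]; rewrite !linear_pair.
by congr (_ + _); apply: kos_triv_ext.
Qed.

Section FromOne.
Variables (N : lmodType R) (n : N).
Fact from_oneD (s t : T) :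
  (((s + t : T) : k)%:A : R) *: n = ((s : k)%:A : R) *: n + ((t : k)%:A : R) *: n.
Proof. by rewrite -!scalerDl. Qed.
Fact from_oneZ (c : k) t :
  (((c%:A : R) *: t : T) : k)%:A *: n = (c%:A : R) *: (((t : k)%:A : R) *: n).
Proof. by rewrite trivZ scalerA -scalerAl mul1r scalerA. Qed.
(** R (x) k is free of rank one on [kone], so a map out of it is the choice of one image. *)
Definition from_one : {linear Q -> N} := ext_lin from_oneD from_oneZ.

Lemma from_oneE : from_one kone = n.
Proof. by rewrite [LHS](ext_tens from_oneD) !scale1r. Qed.
End FromOne.

(** A short resolution would split the last differential and write - [kone] as x2 u - lam x1 v,
    whose constant term is 0. *)
Lemma triv_no_short_resolution e : (e < 2)%N -> ~ proj_dim_le T e.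
Proof.
move=> e2 [P P0].
have [s sE] := short_resolution_retract (P := P) (K := koszul lam_neq0 T)
  (fun p => P0 2%N p e2) (fun w => koszul_mod0 w isT).
have := congr1 (fun u : tens (krestr T) => tcoef u 0 0) (sE kone).
have -> : res_d (koszul lam_neq0 T) 1 kone = (x2 *: kone, (- lam)%:A *: (x1 *: kone)).
  exact: kd1_one.
rewrite (linear_pair s) 3!linearZ /=.
set u := s _; set v := s _.
have -> : x2 *: u + (- lam)%:A *: (x1 *: v) = lmul2 lam u + - lam *: lmul1 v :> tens (krestr T).
  by rewrite -!kos_x1 -!kos_x2 kosZ.
rewrite tcoefD tcoefZ tcoef_lmul1 tcoef_lmul2 scaler0 addr0 tcoefN tcoef_mono /=.
by move/eqP; rewrite eq_sym oppr_eq0 => /eqP/(@eqP k); rewrite oner_eq0.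
Qed.

End Trivial.

(** * The Gorenstein property *)

Lemma homogeneous_sum_eq0 (k : fieldType) (V : lmodType k) (s : nat) (S : seq int)
    (c : int -> tens V) :
    uniq S -> (forall i a b, tcoef (c i) a b != 0 -> (a + b + s)%N%:Z = i) ->
    \sum_(i <- S) c i = 0 ->
  forall i, i \in S -> c i = 0.
Proof.
move=> uS hc S0 i iS; apply: tensP => a b; rewrite tcoef0.
have := congr1 (fun u : tens V => tcoef u a b) S0.
rewrite (big_morph (fun u : tens V => tcoef u a b) (fun u v => tcoefD u v a b) (tcoef0 _ a b)).
rewrite tcoef0 (bigD1_seq i) //=.
have [-> //|ci] := eqVneq (tcoef (c i) a b) 0.
rewrite big1 ?addr0 // => j ji; apply/eqP; apply: contraNT ji => /hc <-.
by rewrite -(hc i a b ci).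
Qed.

(** * Shifted gradings on the free modules *)

Section ShiftedGrading.
Variables (k : fieldType) (V : lmodType k) (s : nat).
Implicit Types (u v : tens V) (j : int).

Definition tens_gr j u : Prop := forall a b, tcoef u a b != 0 -> (a + b + s)%N%:Z = j.

Definition tens_comp j : tens V -> tens V :=
  tlift (fun a b (x : V) => if (a + b + s)%N%:Z == j then mono a b x else 0).

Lemma tcoef_comp j u a b :
  tcoef (tens_comp j u) a b = if (a + b + s)%N%:Z == j then tcoef u a b else 0.
Proof.
have fD a' b' (x y : V) : (if (a' + b' + s)%N%:Z == j then mono a' b' (x + y) else 0) =
    (if (a' + b' + s)%N%:Z == j then mono a' b' x else 0) +
    (if (a' + b' + s)%N%:Z == j then mono a' b' y else 0) :> tens V.
  by case: ifP; rewrite ?monoD ?addr0.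
rewrite /tens_comp; pattern u; apply: tens_ind => [|v w hv hw|a' b' x].
- by rewrite tlift0 !tcoef0 if_same.
- by rewrite tliftD // !tcoefD hv hw; case: ifP; rewrite ?addr0.
rewrite tlift_mono // tcoef_mono.
case: (boolP ((a' == a) && (b' == b))) => [/andP[/eqP-> /eqP->]|ne].
  by case: ifP; rewrite ?tcoef0 // tcoef_mono !eqxx.
rewrite if_same; case: ifP; rewrite ?tcoef0 // tcoef_mono.
by rewrite (negPf ne).
Qed.

Lemma tens_comp_gr j u : tens_gr j (tens_comp j u).
Proof. by move=> a b; rewrite tcoef_comp; case: (_ =P j) => // _; rewrite eqxx. Qed.

(** Stated for every larger index set, so that the two entries of a pair can be decomposed over a
    common one. *)
Lemma tens_comp_sum u : exists S : seq int, forall S', uniq S' -> {subset S <= S'} ->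
  u = \sum_(j <- S') tens_comp j u.
Proof.
exists [seq (m.1 + m.2 + s)%N%:Z | m <- msupp u] => S' uS SS'.
apply: tensP => a b.
rewrite (big_morph (fun u : tens V => tcoef u a b) (fun u v => tcoefD u v a b) (tcoef0 _ a b)).
have [uab|uab] := eqVneq (tcoef u a b) 0.
  by rewrite uab big1 // => j _; rewrite tcoef_comp uab if_same.
rewrite (bigD1_seq (a + b + s)%N%:Z) //=; last first.
  apply: SS'; apply/mapP; exists (a, b) => //=.
  by rewrite -mcoeff_neq0 -tcoefE.
rewrite tcoef_comp eqxx big1 ?addr0 // => j /negPf jab.
by rewrite tcoef_comp eq_sym jab.
Qed.

Lemma tens_gr0 j : tens_gr j 0.
Proof. by move=> a b; rewrite tcoef0 eqxx. Qed.

Lemma tens_grD j u v : tens_gr j u -> tens_gr j v -> tens_gr j (u + v).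
Proof.
move=> hu hv a b; rewrite tcoefD; have [->|/hu->//] := eqVneq (tcoef u a b) 0.
by rewrite add0r; apply: hv.
Qed.

Lemma tens_grZ j c u : tens_gr j u -> tens_gr j (c *: u).
Proof.
move=> hu a b; rewrite tcoefZ; have [->|/hu->//] := eqVneq (tcoef u a b) 0.
by rewrite scaler0 eqxx.
Qed.

Lemma tens_grB j u v : tens_gr j u -> tens_gr j v -> tens_gr j (u - v).
Proof.
by move=> hu hv; apply: tens_grD => //; rewrite -scaleN1r; apply: tens_grZ.
Qed.

Lemma tens_gr_direct : direct_sum tens_gr.
Proof.
split=> [j|u|S c uS hc S0 i iS].
- by split; [apply: tens_gr0 | move=> u v; apply: tens_grB].
- have [S hS] := tens_comp_sum u; exists (undup S), (fun j => tens_comp j u).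
  split=> [j|]; first exact: tens_comp_gr.
  by apply: hS; rewrite ?undup_uniq // => j; rewrite mem_undup.
exact: (homogeneous_sum_eq0 uS hc S0 iS).
Qed.

Lemma tens_gr_lmul1 j u : tens_gr j u -> tens_gr (1 + j) (lmul1 u).
Proof.
move=> hu a b; rewrite tcoef_lmul1; case: a => [|a]; first by rewrite eqxx.
by move/hu <-; rewrite !addSn.
Qed.

Lemma tens_gr_lmul2 lam j u : tens_gr j u -> tens_gr (1 + j) (lmul2 lam u).
Proof.
move=> hu a b; rewrite tcoef_lmul2; case: b => [|b]; first by rewrite eqxx.
have [->|/hu <- _] := eqVneq (tcoef u a b) 0; first by rewrite scaler0 eqxx.
by rewrite addnS !addSn.
Qed.

End ShiftedGrading.

Lemma sum_pair (V W : zmodType) (I : Type) (s : seq I) (f : I -> V) (g : I -> W) :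
  \sum_(i <- s) (f i, g i) = (\sum_(i <- s) f i, \sum_(i <- s) g i).
Proof. by elim: s => [|i s IH]; rewrite ?big_nil // !big_cons IH. Qed.

Section Gorenstein.
Variables (k : fieldType) (lam : k).
Hypothesis lam_neq0 : lam != 0.
Notation R := (qplane lam).
Notation x1 := (qx1 lam).
Notation x2 := (qx2 lam).
Notation T := (triv lam).
Notation K := (krestr T).
Notation Q := (kos T).
Notation d0 := (kd0 T).
Notation d1 := (kd1 T).
Notation gr := (@plane_gr k lam).

(** The generators sit in degrees 0, 1 and 2, which compensates the linear forms by which the
    differentials multiply. *)
Definition koszul_gr (i : nat) : int -> koszul_mod T i -> Prop :=
  match i with
  | 0 => @tens_gr k K 0
  | 1 => fun j p => tens_gr (V := K) 1 j p.1 /\ tens_gr (V := K) 1 j p.2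
  | 2 => @tens_gr k K 2
  | _ => fun _ _ => True
  end.

Lemma kos_gr_action s i j r (u : Q) :
  gr i r -> tens_gr s j (u : tens K) -> tens_gr s (i%:Z + j) ((r *: u : Q) : tens K).
Proof.
move=> gr_r; move: i r gr_r j u.
apply: (gen_grading_ind (Q := fun i (r : R) => forall j (u : Q), tens_gr s j (u : tens K) ->
  tens_gr s (i%:Z + j) ((r *: u : Q) : tens K))) => [n|n a b ha hb|n c a ha||l n a ha] j u hu.
- by rewrite scale0r; apply: tens_gr0.
- by rewrite scalerDl; apply: tens_grD; [apply: ha | apply: hb].
- rewrite -mulr_algl -scalerA kosZ; apply: tens_grZ; exact: ha.
- by rewrite scale1r add0r.
rewrite -scalerA PoszD -addrA; have [->|->] := ord2P l.
  by rewrite [plane_gens _ _ *: _]kos_x1; apply: tens_gr_lmul1; apply: ha.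
by rewrite [plane_gens _ _ *: _]kos_x2; apply: tens_gr_lmul2; apply: ha.
Qed.

Lemma koszul_gr_module i : graded_module gr (@koszul_gr i).
Proof.
case: i => [|[|[|i]]].
- by split; [exact: tens_gr_direct | move=> i j a m; apply: kos_gr_action].
- split; last by move=> i j a [u v] ga [hu hv]; split; apply: kos_gr_action.
  split=> [j|[u v]|S c uS hc S0 i iS].
  + split; first by split; apply: tens_gr0.
    by move=> [u1 u2] [v1 v2] [hu1 hu2] [hv1 hv2]; split; apply: tens_grB.
  + have [S hS] := tens_comp_sum (V := K) 1 u; have [S' hS'] := tens_comp_sum (V := K) 1 v.
    exists (undup (S ++ S')), (fun j => (tens_comp 1 j u, tens_comp 1 j v)).
    split=> [j|]; first by split; apply: tens_comp_gr.
    rewrite sum_pair; congr (_, _); [apply: hS | apply: hS']; rewrite ?undup_uniq // => j jS;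
      by rewrite mem_undup mem_cat jS ?orbT.
  move: S0; rewrite (eq_bigr (fun i => ((c i).1, (c i).2))) => [|j _]; last by case: (c j).
  rewrite sum_pair => -[S1 S2]; rewrite [c i]surjective_pairing.
  congr (_, _).
    exact: (homogeneous_sum_eq0 uS (fun i => (hc i).1) S1 iS).
  exact: (homogeneous_sum_eq0 uS (fun i => (hc i).2) S2 iS).
- by split; [exact: tens_gr_direct | move=> i j a m; apply: kos_gr_action].
split=> //; split=> [j //|p|S c _ _ _ j _]; last exact: thinmx0.
by exists [::], (fun=> 0); split=> //; rewrite big_nil; apply: thinmx0.
Qed.

(** On the trivial module only the right multiplications survive in the differentials, which makes
    them homogeneous. *)
Lemma mact1_triv (u : tens K) : mact1 (M := T) u = 0.
Proof. by apply: tensP => a b; rewrite /mact1 tcoef_tmap tcoef0; apply: triv_x1. Qed.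
Lemma mact2_triv (u : tens K) : mact2 (M := T) u = 0.
Proof. by apply: tensP => a b; rewrite /mact2 tcoef_tmap tcoef0; apply: triv_x2. Qed.

Lemma rmul1_gr s j (u : tens K) : tens_gr s.+1 j u -> tens_gr s j (rmul1 lam u).
Proof.
move=> hu a b; rewrite tcoef_rmul1; case: a => [|a]; first by rewrite eqxx.
have [->|/hu <- _] := eqVneq (tcoef u a b) 0; first by rewrite scaler0 eqxx.
by rewrite !addSn addnS.
Qed.

Lemma rmul2_gr s j (u : tens K) : tens_gr s.+1 j u -> tens_gr s j (rmul2 u).
Proof.
move=> hu a b; rewrite tcoef_rmul2; case: b => [|b]; first by rewrite eqxx.
by move/hu <-; rewrite addnS addSn addnS.
Qed.

Lemma koszul_gr_d i j (p : koszul_mod T i.+1) :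
  koszul_gr j p -> koszul_gr j (koszul_d T i p).
Proof.
case: i p => [|[|[|i]]] p //=.
- move=> [h1 h2]; rewrite -[X in tens_gr _ _ X]/(d0 p) kd0E kop1E kop2E mact1_triv mact2_triv.
  rewrite !scaler0 !subr0; apply: tens_grD; apply: tens_grZ.
    exact: rmul1_gr.
  exact: rmul2_gr.
- move=> hp; change (tens_gr 1 j (kop2 1 lam (p : Q) : tens K) /\
    tens_gr 1 j (kop1 (- lam) (- 1) (p : Q) : tens K)).
  rewrite kop1E kop2E mact1_triv mact2_triv !scaler0 !subr0.
  split; apply: tens_grZ; [exact: rmul2_gr | exact: rmul1_gr].
by move=> _; apply: tens_gr0.
Qed.

Lemma kaug_gr j (p : Q) : koszul_gr (i := 0) j p -> j != 0 -> kaug T p = 0.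
Proof.
move=> hp j0; pattern p; apply: tens_support_ind => [|u v hu hv|a b pab].
- exact: linear0.
- by rewrite linearD hu hv addr0.
rewrite [kaug T _](ext_mono (h := id)) // triv_scale tcoef_mono.
case: ifP => [/andP[/eqP a0 /eqP b0]|]; last by rewrite !scale0r.
by move: j0; rewrite -(hp a b pab) a0 b0.
Qed.

Lemma koszul_graded_resolution : graded_resolution gr (P := koszul lam_neq0 T) koszul_gr.
Proof.
by split; [exact: koszul_gr_module | exact: koszul_gr_d | exact: kaug_gr].
Qed.

Notation e := (kone lam).

(** The dual of d1 in coordinates, (a, b) |-> x2 a - lam x1 b. *)
Lemma cochain1_d (f : {linear (Q * Q)%type -> R^o}) :
  f (d1 e) = x2 * (f (e, 0) : R) - lam *: (x1 * (f (0, e) : R)) :> R.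
Proof.
rewrite kd1_one linear_pair 2!linearZ linearZ -[X in _ + X]/((- lam)%:A * (x1 * (f (0, e) : R))).
by rewrite mulr_algl scaleNr.
Qed.

Lemma cochain1_d_aug (f : {linear (Q * Q)%type -> R^o}) : tcoef (f (d1 e) : R) 0 0 = 0.
Proof.
rewrite cochain1_d; move: (f _ : R) (f _ : R) => a b.
by rewrite tcoefB tcoefZ qx2M qx1M tcoef_lmul2 tcoef_lmul1 scaler0 subr0.
Qed.

Lemma koszul_coboundary1 (f : {linear (Q * Q)%type -> R^o}) :
    (forall w, f (d1 w) = 0) -> exists g : {linear Q -> R^o}, forall p, f p = g (d0 p).
Proof.
move=> fd; have := cochain1_d f; rewrite fd => /esym/eqP; rewrite subr_eq0 => /eqP.
set a : R := f (e, 0); set b : R := f (0, e) => ab.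
(* x2 a = lam x1 b contains no pure power of x2, hence neither does a. *)
have [|h ah] := @qx1_div k lam a.
  move=> j; have := congr1 (fun u : tens k^o => tcoef u 0 j.+1) ab.
  by rewrite qx2M tcoef_lmul2 scale1r tcoefZ qx1M tcoef_lmul1 scaler0.
(* Cancel lam x1 in lam x1 b = x2 x1 h = lam x1 x2 h. *)
have bh : b = x2 * h.
  apply/eqP; rewrite eq_sym -subr_eq0; apply/eqP/qx1_inj; rewrite mulrBr.
  apply: (scalerI lam_neq0); rewrite scaler0 scalerBr -ab ah !mulrA qx21.
  by rewrite scalerAl subrr.
exists (from_one (N := R^o) h); apply: (kos2_triv_ext (g := from_one (N := R^o) h \o d0)).
  by rewrite -[RHS]/(from_one (N := R^o) h (d0 (e, 0))) kd0_one1 linearZ from_oneE.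
by rewrite -[RHS]/(from_one (N := R^o) h (d0 (0, e))) kd0_one2 linearZ from_oneE.
Qed.

Lemma koszul_coboundary2 (f : {linear Q -> R^o}) :
    tcoef (f e : R) 0 0 = 0 ->
  exists g : {linear (Q * Q)%type -> R^o}, forall p, f p = g (d1 p).
Proof.
have [r1 [r2 re]] := plane_augmentation (f e : R); move=> fe0.
(* The scalar - lam^-1 undoes the factor - lam in the dual of d1. *)
pose g : {linear (Q * Q)%type -> R^o} :=
  lpair (from_one (N := R^o) r2) (from_one (N := R^o) (- lam^-1 *: r1)).
exists g; apply: (kos_triv_ext (g := g \o d1)).
have g1 : g (e, 0) = r2.
  by rewrite -[LHS]/(from_one (N := R^o) _ e + from_one (N := R^o) _ 0) from_oneE linear0 addr0.
have g2 : g (0, e) = - lam^-1 *: r1.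
  by rewrite -[LHS]/(from_one (N := R^o) _ 0 + from_one (N := R^o) _ e) from_oneE linear0 add0r.
rewrite -[RHS]/(g (d1 e)) cochain1_d g1 g2.
rewrite [LHS]re fe0 scale0r add0r -scalerAr scalerA mulrN mulfV // scaleN1r opprK.
exact: addrC.
Qed.

Notation f0 := (from_one (N := R^o) (1 : R)).

(** [f0] identifies R (x) k with R, so a map from R (x) k to R is [f0] followed by right
    multiplication by its value at [kone]. *)
Lemma from_one_mul (r : R) p : from_one (N := R^o) r p = (f0 p : R) * r.
Proof.
pattern p; apply: tens_ind => [|u v hu hv|a b t].
- by rewrite !linear0 mul0r.
- by rewrite !linearD hu hv mulrDl.
rewrite [LHS](ext_mono (from_oneD (N := R^o) r)).
rewrite [f0 _](ext_mono (from_oneD (N := R^o) 1)).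
rewrite -[LHS]/((mono a b 1 : R) * (((t : k)%:A : R) * r)).
by rewrite -[RHS]/((mono a b 1 : R) * (((t : k)%:A : R) * 1) * r) mulr1 mulrA.
Qed.

Lemma tcoef_f0 p a b : tcoef (f0 p : R) a b = tcoef (p : tens K) a b.
Proof.
pattern p; apply: tens_ind => [|u v hu hv|a' b' t].
- by rewrite linear0 !tcoef0.
- by rewrite linearD !tcoefD hu hv.
rewrite [f0 _](ext_mono (from_oneD (N := R^o) 1)).
rewrite -[X in tcoef X]/((mono a' b' 1 : R) * (((t : k)%:A : R) * 1)) mulr1 mulr_algr.
rewrite tcoefZ !tcoef_mono; case: ifP => _; last exact: scaler0.
exact: mulr1.
Qed.

Notation P := (koszul lam_neq0 T).

Lemma koszul_Ext0 : Ext_eq0 P 0.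
Proof.
move=> f fc; apply: (kos_triv_ext (f := f) (g := \0)).
have fe : f (d0 (e, 0)) = 0 := fc (e, 0).
by rewrite kd0_one1 linearZ in fe; exact: (qx1_inj fe).
Qed.

Lemma koszul_Ext1 : Ext_eq0 P 1.
Proof. by move=> f fc; exact: (koszul_coboundary1 fc). Qed.

Lemma koszul_Ext_gt2 i : Ext_eq0 P i.+3.
Proof. by move=> f _; exists \0 => p; rewrite (koszul_mod0 p) // linear0. Qed.

Lemma koszul_coboundary_mul (r : R) :
  tcoef r 0 0 = 0 -> coboundary (P := P) (i := 2) (fun p => (f0 p : R) * r).
Proof.
move=> r0; have [|g gE] := @koszul_coboundary2 (from_one (N := R^o) r).
  by rewrite from_oneE.
by exists g => p; exact: etrans (esym (from_one_mul r p)) (gE p).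
Qed.

Lemma koszul_not_coboundary : ~ coboundary (P := P) (i := 2) f0.
Proof.
move=> [g gE]; have := cochain1_d_aug g.
rewrite -[X in tcoef X]gE from_oneE tcoef_tone => /eqP.
by rewrite oner_eq0.
Qed.

Lemma koszul_cohomology (f : {linear Q -> R^o}) : exists c : k,
  coboundary (P := P) (i := 2) (fun p => (f p : R) - c *: (f0 p : R)).
Proof.
(* The constant term of f(kone) is the class of [f] in R / (x1 R + x2 R) = k. *)
pose c : k := tcoef (f e : R) 0 0; exists c.
have [|g gE] := @koszul_coboundary_mul ((f e : R) - c%:A).
  by rewrite tcoefB tcoefZ1 tcoef_tone mulr1 subrr.
exists g => p; rewrite -[RHS]gE mulrBr -from_one_mul mulr_algr; congr (_ - _).
apply: (kos_triv_ext (f := f) (g := from_one (N := R^o) (f e))).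
by rewrite from_oneE.
Qed.

(** The generator sits in degree 2 and goes to 1, in degree 0, whence the shift by -2; for j < 2 the
    module has nothing in degree j. *)
Lemma f0_degree j p : tens_gr (V := K) 2 j p -> gr_int gr (j - 2%:Z) (f0 p : R).
Proof.
move=> hp; have hw a b : tcoef (f0 p : R) a b != 0 -> (a + b)%N%:Z = j - 2%:Z.
  by rewrite tcoef_f0 => /hp <-; rewrite (PoszD (a + b) 2) addrK.
case: (j - 2%:Z) hw => n hw /=; first by apply/plane_grP => a b /hw [].
by apply: tensP => a b; rewrite tcoef0; apply/eqP; apply: contraTT isT => /hw.
Qed.

Lemma plane_gorenstein : gorenstein gr 2.
Proof.
exists T, P, koszul_gr; split.
- exact: triv_trivial.
- exact: koszul_graded_resolution.
- by case=> [|[|[|i]]] // _; [exact: koszul_Ext0 | exact: koszul_Ext1 | exact: koszul_Ext_gt2].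
exists f0; split.
- by move=> p; rewrite (koszul_mod0 p) // !linear0.
- by exists (- 2%:Z) => j p; apply: f0_degree.
- exact: koszul_not_coboundary.
- by move=> f _; exact: (koszul_cohomology f).
move=> n a n0 /plane_grP ga; apply: koszul_coboundary_mul.
by apply/eqP; apply: contraTT n0 => /ga <-.
Qed.

Lemma plane_global_dim : global_dim R 2.
Proof.
split=> [M|e e2]; first exact: plane_proj_dim.
by exists T; apply: triv_no_short_resolution.
Qed.

Lemma plane_regular : regular gr.
Proof.
exists 2; split.
- by split; [exact: plane_graded | exact: plane_connected | exact: plane_generated].
- exact: plane_global_dim.
- exact: plane_growth.
- exact: plane_gorenstein.
Qed.

End Gorenstein.

Theorem corollary2p3 (k : closedFieldType) (hk : 2%N \notin [pchar k])
    (lam : k) (hlam : lam * (lam ^+ 3 - 1) != 0)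
    (A : algType k) (x : 'I_3 -> A) (hA : presented_by x (A_relation lam)) :
  let grA := gen_grading x (fun=> 1%N) in
  (lam ^+ 3 = -1 -> graded_skew_clifford grA) /\
  (lam ^+ 3 != 0 /\ lam ^+ 3 != 1 ->
   exists (R : algType k) (grR : nat -> R -> Prop),
     regular_graded_skew_clifford grR /\ ore_extension grR grA).
Proof.
have two_neq0 : 2%:R != 0 :> k by apply: contraNneq hk => h; rewrite inE /= h eqxx.
have lam_neq0 : lam != 0 by move: hlam; rewrite mulf_eq0 negb_or => /andP[].
split; first exact: (A_clifford two_neq0 lam_neq0 hA).
move=> _; exists (qplane lam), (@plane_gr k lam).
split; last exact: (A_ore_extension lam_neq0 hA).
split; first exact: (plane_clifford two_neq0 lam_neq0).
  exact: plane_quadratic.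
exact: (plane_regular lam_neq0).
Qed.
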